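(* Assume that $S$ is a drift-free subordinator with no killing and with a Lévy measure $\nu$ on $(0,\infty)$ satisfying $$\nu([y,\infty))\sim y^{-\alpha}\ell(1/y),\qquad y\downarrow 0,$$ for some $\alpha\in(0,1)$ and a function $\ell$ slowly varying at infinity. Let $q$ be an $\mathbb{N}$-valued function, defined in a neighborhood of infinity, such that $q(t)\to\infty$ and $q(t)=o(t)$ as $t\to\infty$. Then, as $n\to\infty$, $$\frac{(q(n))^{\alpha}K_{n,\ge q(n)}}{n^{\alpha}\,\ell(n/q(n))}\ \overset{P}{\longrightarrow}\ \mathcal{I}_\alpha,\qquad\text{where}\quad \mathcal{I}_\alpha:=\int_0^\infty e^{-\alpha S(\tau)}\,\mathrm{d}\tau.$$
   Context: $S=(S(t))_{t\ge 0}$ is a drift-free subordinator with no killing and Lévy measure $\nu$ on $(0,\infty)$, so that $S(t)=\sum_{k:\tau_k\le t} j_k$, $t\geq 0$, almost surely, where $\{(\tau_k,j_k)\}$ are the atoms of a Poisson point process on $[0,\infty)\times(0,\infty)$ with intensity measure $\mathrm{Lebesgue}\times\nu$; $\{\tau_k\}$ is the set of jump epochs of $S$. The open intervals $(S(\tau_k-),S(\tau_k))$ are called boxes. Let $(E_k)_{k\in\mathbb{N}}$ be independent standard exponential random variables, independent of $S$ (''balls''). For $n,k,i\in\mathbb{N}$ put $$\mathcal{Z}_{n,k}:=\#\{1\le j\le n: E_j\in(S(\tau_k-),S(\tau_k))\},\qquad K_{n,\ge i}:=\sum_{k\ge1}\mathbf{1}_{\{\mathcal{Z}_{n,k}\ge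 i\}},$$ so $K_{n,\ge i}$ is the number of boxes occupied by at least $i$ of the first $n$ balls. The notation $f\sim g$ means that $f/g\to1$ in the indicated limit; $\overset{P}{\longrightarrow}$ denotes convergence in probability. *)

(* Defs.v *)
From HB Require Import structures.
From mathcomp Require Import all_boot all_order all_algebra finmap.
From mathcomp Require Import all_classical all_reals all_analysis.
From mathcomp Require Import measurable_realfun.

Set Implicit Arguments.
Unset Strict Implicit.
Unset Printing Implicit Defensive.

Import Order.TTheory GRing.Theory Num.Theory.
Import numFieldNormedType.Exports.

Local Open Scope classical_set_scope.
Local Open Scope ring_scope.

Definition slowly_varying {R : realType} (l : R -> R) : Prop :=
  (exists X : R, measurable_fun `[X, +oo[ l /\ forall x, X <= x -> 0 < l x) /\
  forall c : R, 0 < c -> l (c * x) / l x @[x --> +oo] --> (1 : R).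

Definition mutually_independent {R : realType} {d d' : measure_display}
    {T : measurableType d} {T' : measurableType d'} {I : choiceType}
    (P : probability T R) (X : I -> T -> T') : Prop :=
  forall (J : {fset I}) (B : I -> set T'), (forall i, measurable (B i)) ->
    P (\bigcap_(i in [set` J]) X i @^-1` B i) =
    (\prod_(i <- J) P (X i @^-1` B i))%E.

Definition sigma_generated {d d' : measure_display} {T : measurableType d}
    {T' : measurableType d'} {I : Type} (D : set I) (X : I -> T -> T') :
    set_system T :=
  <<s \bigcup_(i in D) preimage_set_system setT (X i) measurable >>.

Definition independent_systems {R : realType} {d : measure_display}
    {T : measurableType d} (P : probability T R) (F G : set_system T) : Prop :=
  forall A B, F A -> G B -> P (A `&` B) = (P A * P B)%E.

(* Convergence in probability.  The values are extended reals because the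
   random variables below are only almost surely finite; since
   +oo - +oo = -oo in \bar R, two infinite values count as far apart. *)
Definition cvg_in_probability {R : realType} {d : measure_display}
    {T : measurableType d} (P : probability T R)
    (X : nat -> T -> \bar R) (Y : T -> \bar R) : Prop :=
  forall eps : R, 0 < eps ->
    P [set w | (eps%:E <= `| X n w - Y w |)%E] @[n --> \oo] --> 0%E.

(* Only the times t >= 0 are meaningful.  There is no killing because the
   paths are real valued. *)
Definition subordinator {R : realType} {d : measure_display}
    {T : measurableType d} (P : probability T R) (S : R -> {RV P >-> R}) :
    Prop :=
  [/\ forall w, S 0 w = 0,
      forall w s t, 0 <= s -> s <= t -> S s w <= S t w,
      forall w t, 0 <= t -> S s w @[s --> t^'+] --> S t w,
      forall s t (B : set R), 0 <= s -> 0 <= t -> measurable B ->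
        P ((fun w => S (s + t) w - S s w) @^-1` B) = P (S t @^-1` B) &
      forall t : nat -> R, 0 <= t 0%N -> (forall i, t i <= t i.+1) ->
        mutually_independent P (fun i w => S (t i.+1) w - S (t i) w : R)].

(* Measures on (0, oo) are represented by measures on the line that do not
   charge (-oo, 0].  The integrability condition is the one for subordinators. *)
Definition levy_measure {R : realType}
    (nu : {sigma_finite_measure set R -> \bar R}) : Prop :=
  nu `]-oo, 0]%classic = 0%E /\
  (\int[nu]_(x in `]0%R, +oo[) (Num.min 1 x)%:E < +oo)%E.

Definition point_count {R : realType} {T : Type} (tau jmp : nat -> T -> R)
    (A : set (R * R)) (w : T) : \bar R :=
  (\sum_(0 <= k <oo) \d_(tau k w, jmp k w) A)%E.

(* The points (tau k, jmp k) are the atoms, enumerated in some measurable way,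
   of a Poisson point process on [0, oo) x (0, oo) with intensity
   Lebesgue x nu.  Poisson weights are written out because the library's
   poisson_pmf is constantly 1 at rate 0. *)
Definition poisson_point_process {R : realType} {d : measure_display}
    {T : measurableType d} (P : probability T R)
    (nu : {sigma_finite_measure set R -> \bar R})
    (tau jmp : nat -> {RV P >-> R}) : Prop :=
  let mu : set (R * R) -> \bar R := (lebesgue_measure \x nu)%E in
  let space : set (R * R) := `[0, +oo[ `*` `]0, +oo[ in
  [/\ forall k w, 0 <= tau k w /\ 0 < jmp k w,
      forall A : set (R * R), measurable A -> A `<=` space ->
        (mu A < +oo)%E -> forall m : nat,
        P [set w | point_count tau jmp A w = m%:R%:E] =
        (expR (- fine (mu A)) * fine (mu A) ^+ m / m`!%:R)%:E,
      forall A : set (R * R), measurable A -> A `<=` space ->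
        mu A = +oo%E -> P [set w | point_count tau jmp A w = +oo%E] = 1%E &
      forall (m : nat) (A : 'I_m -> set (R * R)),
        (forall i, measurable (A i)) -> (forall i, A i `<=` space) ->
        trivIset setT A ->
        mutually_independent P (fun i => point_count tau jmp (A i))].

(* A drift-free subordinator without killing and with Levy measure nu,
   together with the points (epoch, size) of its jumps. *)
Definition drift_free_subordinator {R : realType} {d : measure_display}
    {T : measurableType d} (P : probability T R)
    (nu : {sigma_finite_measure set R -> \bar R})
    (S : R -> {RV P >-> R}) (tau jmp : nat -> {RV P >-> R}) : Prop :=
  [/\ subordinator S, levy_measure nu, poisson_point_process nu tau jmp &
      {ae P, forall w, forall t : R, 0 <= t ->
        (S t w)%:E = (\sum_(0 <= k <oo | (tau k w <= t)%R) (jmp k w)%:E)%E}].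

(* S(t-), with the convention S(0-) = 0. *)
Definition left_value {R : realType} (f : R -> R) (t : R) : R :=
  if 0 < t then lim (f s @[s --> t^'-]) else 0.

Section boxes.
Context {R : realType} {T : Type}.
Variables (S : R -> T -> R) (tau : nat -> T -> R) (E : nat -> T -> R).

Definition box (k : nat) (w : T) : interval R :=
  `]left_value (S ^~ w) (tau k w), S (tau k w) w[.

(* The balls are numbered from 0, so the first n balls are E 0, ..., E n.-1. *)
Definition box_count (n k : nat) (w : T) : nat :=
  #|[set j : 'I_n | E j w \in box k w]|.

Definition occupied_boxes (n i : nat) (w : T) : \bar R :=
  (\sum_(0 <= k <oo) (i <= box_count n k w)%N%:R%:E)%E.

End boxes.

Definition exp_functional {R : realType} {T : Type} (alpha : R)
    (S : R -> T -> R) (w : T) : \bar R :=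
  (\int[lebesgue_measure]_(t in `[0%R, +oo[) (expR (- alpha * S t w))%:E)%E.

(* Main.v *)
Require Import Defs.
From HB Require Import structures.
From mathcomp Require Import all_boot all_order all_algebra finmap.
From mathcomp Require Import all_classical all_reals all_analysis.
From mathcomp Require Import measurable_realfun.
From mathcomp Require Import ring lra zify.

Set Implicit Arguments.
Unset Strict Implicit.
Unset Printing Implicit Defensive.

Import Order.TTheory GRing.Theory Num.Theory.
Import numFieldNormedType.Exports.

Local Open Scope classical_set_scope.
Local Open Scope ring_scope.


(** Map every position y of the half line to 1 - exp (- y).  The balls become
    uniform on [0, 1], and the box of the k-th jump becomes an interval whose
    length is its gap, gap k = exp (- S (tau k -)) - exp (- S (tau k)).  A box of
    gap g receives about n g of the first n balls, so that, q (n) being large,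
    it holds at least q (n) of them roughly when g >= q (n) / n.  The theorem
    thus splits into two statements, with a (x) = nu [x, oo):
    - the number of gaps that are at least x is close to
      a (x) * \int exp (- al S (t)) dt as x tends to 0 (large_gaps_lln);
    - the boxes with at least q (n) balls are, up to o (a (q (n) / n)) of them,
      the boxes whose gap is at least q (n) / n (occupied_boxes_estimate).
    The hypothesis on nu turns a (q (n) / n) into the normalisation of the
    theorem.

    Law of large numbers for the gaps.  A jump of size j at time t has
    gap >= x essentially when j >= x exp (S (t)), and such jumps occur at rate
    a (x exp (S (t))), which is close to a (x) exp (- al S (t)) by regular
    variation.  The threshold depends on the path, but only through the value of
    S: on a fine grid of times and a fine grid of levels there are finitely many
    deterministic strips of points, whose numbers are Poisson with means of order
    a (x), and these are all simultaneously concentrated by the Chebyshev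
    inequality.  Along a path, S is rounded to a level of the grid on each time
    step and the rounded counts form Riemann sums of the exponential functional
    (large_gaps_riemann_upper, large_gaps_riemann_lower).

    The times beyond a fixed horizon are controlled by cutting time into blocks
    of exponentially growing lengths.  With probability close to 1 each block
    contains a jump of size at least some y0 (block_event), so S is at least
    m y0 at the start of block m.  Then a large gap in block m comes from a jump
    of size at least x exp (m y0), and the expected number of these is summable
    in m by the Potter bounds; the first moment suffices (Qsum_expectation).  The
    same weights, counted from time 0, bound the number of cells of length x of
    [0, 1] that the range of 1 - exp (- S) meets by a constant times a (x)
    (cover_count, range_cover_tight).

    Balls.  Cut [0, 1] into cells of length x = q (n) / (n N), so that a cell
    expects q (n) / N balls.  A box of at least (N + 3) cells with fewer than
    q (n) balls, or a box of at most N - 2 cells with at least q (n) balls, has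
    near its right end a cell whose number of balls is off by a factor
    1 +- 1 / N.  By independence of the balls and S, and since the range meets
    only O (a (x)) cells, the expected number of such events is at most a
    constant times a (x) / q (n); this is where q (n) -> oo enters.  The boxes
    shorter than one cell lie in the cells next to the range, which hold in
    expectation at most n x * O (a (x)) balls, hence they provide at most
    O (a (x)) / N occupied boxes.  Here a (x) is of order N ^ al a (q (n) / n)
    with al < 1, so that this is negligible when N is large. *)

(** * Pure jump paths and the cells met by their range *)

Section nneseries_extra.
Context {R : realType}.
Implicit Types u v : nat -> \bar R.

Lemma nneseries_le_bound u (P : pred nat) (M : \bar R) :
  (forall n, P n -> (0 <= u n)%E) ->
  (forall n, (\sum_(0 <= k < n | P k) u k <= M)%E) ->
  (\sum_(0 <= k <oo | P k) u k <= M)%E.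
Proof.
move=> u0 uM; apply: lime_le; first by apply: is_cvg_nneseries => n _; exact: u0.
by apply: nearW => n; exact: uM.
Qed.

Lemma nneseries_ge_term u (P : pred nat) k :
  (forall n, P n -> (0 <= u n)%E) -> P k -> (u k <= \sum_(0 <= n <oo | P n) u n)%E.
Proof.
move=> u0 Pk; rewrite (nneseriesD1 u0 Pk) leeDl//.
by apply: nneseries_ge0 => n _ /andP[Pn _]; exact: u0.
Qed.

Lemma bigmax_nat_ge (x : R) (F : nat -> R) (P : pred nat) n i :
  (i < n)%N -> P i -> F i <= \big[Order.max/x]_(0 <= j < n | P j) F j.
Proof.
by move=> ni Pi; rewrite (le_bigmax_seq x)// mem_index_iota.
Qed.

End nneseries_extra.

Section pure_jump_path.
Context {R : realType}.
Variables (f : R -> R) (tau jmp : nat -> R).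

(** The almost sure properties of the paths that all pathwise arguments use.
    Since the epochs are distinct, the left limit at tau k misses exactly one
    jump. *)
Record pure_jump : Prop := PureJump {
  pj_tau_gt0 : forall k, 0 < tau k ;
  pj_jmp_gt0 : forall k, 0 < jmp k ;
  pj_tau_inj : injective tau ;
  pj_sum : forall t, 0 <= t ->
    (f t)%:E = (\sum_(0 <= k <oo | (tau k <= t)%R) (jmp k)%:E)%E }.

(** The length of the k-th box after the map y |-> 1 - exp (- y), under which
    the balls become uniform. *)
Definition gap k : R := expR (- (f (tau k) - jmp k)) - expR (- f (tau k)).

Hypothesis pj : pure_jump.

Let jmp_ge0 k : (0 <= (jmp k)%:E)%E.
Proof. by rewrite lee_fin ltW// pj_jmp_gt0. Qed.

Lemma pure_jump_incr s t : 0 <= s -> s <= t ->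
  (f t - f s)%:E = (\sum_(0 <= k <oo | (s < tau k <= t)%R) (jmp k)%:E)%E.
Proof.
move=> s0 st; have t0 := le_trans s0 st.
have -> : (f t - f s)%:E = ((f t)%:E - (f s)%:E)%E by rewrite EFinB.
apply/eqP; rewrite sube_eq//; last by rewrite fin_num_adde_defl.
rewrite !pj_sum// [X in (_ == X + _)%E]eseries_mkcond.
rewrite [X in (_ == _ + X)%E]eseries_mkcond -nneseriesD//; last 2 first.
  by move=> k _ _; case: ifP.
  by move=> k _ _; case: ifP.
rewrite eseries_mkcond; apply/eqP/eq_eseriesr => k _.
case: (ltP s (tau k)) => [stk|tks] /=; last by rewrite (le_trans tks st) add0e.
by case: ifP; rewrite ?adde0.
Qed.

Lemma pure_jump_psum_le s t n (Q : pred nat) : 0 <= s -> s <= t ->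
  (forall k, (k < n)%N -> Q k -> s < tau k <= t) ->
  \sum_(0 <= k < n | Q k) jmp k <= f t - f s.
Proof.
move=> s0 st Qst; rewrite -lee_fin pure_jump_incr// -sumEFin.
apply: (@le_trans _ _ (\sum_(0 <= k < n | (s < tau k <= t)%R) (jmp k)%:E)%E).
  rewrite big_mkcond [leRHS]big_mkcond/= big_seq_cond [leRHS]big_seq_cond.
  apply: lee_sum => k; rewrite mem_index_iota andbT => /= kn.
  by case: ifPn => [/(Qst _ kn)->//|_]; case: ifP.
exact: nneseries_lim_ge.
Qed.

Lemma pure_jump_nd s t : 0 <= s -> s <= t -> f s <= f t.
Proof.
move=> s0 st; rewrite -subr_ge0.
by have := @pure_jump_psum_le s t 0 pred0 s0 st; rewrite big_geq//; exact.
Qed.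

Lemma pure_jump0 : f 0 = 0.
Proof.
have := pj_sum pj (lexx 0); rewrite eseries_mkcond eseries0; first by case.
by move=> k _ _; rewrite leNgt pj_tau_gt0.
Qed.

Lemma pure_jump_ge0 t : 0 <= t -> 0 <= f t.
Proof. by move=> t0; rewrite -pure_jump0 pure_jump_nd. Qed.

Lemma jump_le u k : 0 <= u -> u < tau k -> f u <= f (tau k) - jmp k.
Proof.
move=> u0 utk; rewrite lerBrDl -lerBrDr.
rewrite -lee_fin (pure_jump_incr u0 (ltW utk)).
by apply: nneseries_ge_term => //; rewrite utk lexx.
Qed.

(** Finitely many jumps up to tau k account for f (tau k) up to e; u is the last
    of their epochs before tau k. *)
Lemma jump_attained k (e : R) : 0 < e ->
  exists2 u, 0 <= u < tau k & f (tau k) - jmp k - e < f u.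
Proof.
move=> e0.
have tk0 := pj_tau_gt0 pj k.
have : ((f (tau k) - e)%:E < (f (tau k))%:E)%E by rewrite lte_fin ltrBlDr ltrDl.
rewrite [X in (_ < X)%E](pj_sum pj (ltW tk0)) => fe.
have [n kn fen] : exists2 n, (k < n)%N &
    f (tau k) - e < \sum_(0 <= i < n | tau i <= tau k) jmp i.
  apply: contrapT => /forall2NP H.
  have := fe; rewrite ltNge => /negP; apply.
  apply: nneseries_le_bound => // n.
  have [kn|//] := H (maxn n k.+1); first by rewrite leq_max ltnS leqnn orbT in kn.
  move/negP; rewrite -leNgt => Hn; rewrite sumEFin lee_fin (le_trans _ Hn)//.
  rewrite [leRHS](@big_cat_nat _ _ _ n)//= ?leq_maxl// lerDl.
  by apply: sumr_ge0 => i _; rewrite ltW// pj_jmp_gt0.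
pose u := \big[Order.max/0]_(0 <= i < n | tau i < tau k) tau i.
have u0 : 0 <= u by exact: bigmax_ge_id.
have utk : u < tau k by apply: bigmax_lt => // i.
exists u; first by rewrite u0.
have fu : \sum_(0 <= i < n | tau i < tau k) jmp i <= f u.
  have := @pure_jump_psum_le 0 u n (fun i => tau i < tau k) (lexx _) u0.
  rewrite pure_jump0 subr0; apply=> i ni itk; rewrite pj_tau_gt0//=.
  exact: bigmax_nat_ge.
apply: lt_le_trans fu.
suff : \sum_(0 <= i < n | tau i <= tau k) jmp i =
       jmp k + \sum_(0 <= i < n | tau i < tau k) jmp i by lra.
rewrite (@big_mkcond _ _ _ _ _ (fun i => tau i <= tau k)) /=.
rewrite [in RHS](@big_mkcond _ _ _ _ _ (fun i => tau i < tau k)) /=.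
rewrite (bigD1_seq k) ?iota_uniq ?mem_index_iota//= lexx; congr (_ + _).
rewrite [RHS](bigD1_seq k) ?iota_uniq ?mem_index_iota//= ltxx add0r.
apply: eq_bigr => i ik; rewrite le_eqVlt (_ : (tau i == tau k) = false)//.
by apply/negbTE/eqP => /(pj_tau_inj pj)/eqP; rewrite (negbTE ik).
Qed.

Lemma left_value_jump k : left_value f (tau k) = f (tau k) - jmp k.
Proof.
rewrite /left_value pj_tau_gt0//; apply/cvg_lim => //.
apply/cvgrPdist_lt => e e0.
have [u /andP[u0 utk] fu] := jump_attained k e0.
near=> s.
have us : u < s by near: s; exact: nbhs_left_gt.
have stk : s < tau k by near: s; exact: nbhs_left_lt.
have fus : f u <= f s by rewrite pure_jump_nd// ltW.
have fs : f s <= f (tau k) - jmp k by rewrite jump_le// (le_trans u0 (ltW us)).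
by rewrite ger0_norm; lra.
Unshelve. all: end_near. Qed.

Lemma gap_gt0 k : 0 < gap k.
Proof. by rewrite subr_gt0 ltr_expR; have := pj_jmp_gt0 pj k; lra. Qed.

Lemma left_ge0 k : 0 <= f (tau k) - jmp k.
Proof. by have := jump_le (lexx 0) (pj_tau_gt0 pj k); rewrite pure_jump0. Qed.

Lemma gapE k : gap k = expR (- (f (tau k) - jmp k)) * (1 - expR (- jmp k)).
Proof.
rewrite /gap mulrBr mulr1 -expRD; congr (_ - expR _); lra.
Qed.

Lemma gap_le u k : 0 <= u -> u < tau k -> gap k <= expR (- f u) * Num.min 1 (jmp k).
Proof.
move=> u0 utk; rewrite gapE; apply: ler_pM; rewrite ?expR_ge0//.
- by rewrite subr_ge0 -expR0 ler_expR oppr_le0 ltW// pj_jmp_gt0.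
- by rewrite ler_expR lerN2; exact: jump_le.
- rewrite le_min; apply/andP; split; first by rewrite gerBl expR_ge0.
  by have := expR_ge1Dx (- jmp k); lra.
Qed.

Lemma gap_ge v k : tau k <= v -> expR (- f v) * (1 - expR (- jmp k)) <= gap k.
Proof.
move=> tkv; rewrite gapE ler_wpM2r//.
  by rewrite subr_ge0 -expR0 ler_expR oppr_le0 ltW// pj_jmp_gt0.
rewrite ler_expR lerN2 (@le_trans _ _ (f (tau k)))//.
  by rewrite gerBl ltW// pj_jmp_gt0.
by rewrite pure_jump_nd// ltW// pj_tau_gt0.
Qed.

End pure_jump_path.

Section sum_of_jumps.
Context {R : realType}.

(** For finitely many jumps the sum splits at an epoch, and there a function
    with jumps of size d k has already increased by that much. *)
Lemma sum_jumps_le (g : R -> R) (tau d : nat -> R) n s t :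
  injective tau ->
  (forall u v, 0 <= u -> u <= v -> g u <= g v) ->
  (forall k u, 0 <= u -> u < tau k -> d k <= g (tau k) - g u) ->
  0 <= s -> s <= t ->
  \sum_(0 <= k < n | s < tau k <= t) d k <= g t - g s.
Proof.
move=> tinj gnd dg; elim: n s t => [|n IH] s t s0 st.
  by rewrite big_geq// subr_ge0 gnd.
rewrite big_mkcond big_nat_recr//= -big_mkcond /=.
case: ifPn => [/andP[stn tnt]|_]; last by rewrite addr0; exact: IH.
pose u := \big[Order.max/s]_(0 <= i < n | tau i < tau n) tau i.
have su : s <= u by exact: bigmax_ge_id.
have utn : u < tau n by apply: bigmax_lt => // i.
have u0 := le_trans s0 su.
have tn0 := le_trans s0 (ltW stn).
have -> : \sum_(0 <= k < n | s < tau k <= t) d k =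
  \sum_(0 <= k < n | s < tau k <= u) d k + \sum_(0 <= k < n | tau n < tau k <= t) d k.
  rewrite (@big_mkcond _ _ _ _ _ (fun k => s < tau k <= t)) /=.
  rewrite (@big_mkcond _ _ _ _ _ (fun k => s < tau k <= u)) /=.
  rewrite (@big_mkcond _ _ _ _ _ (fun k => tau n < tau k <= t)) /= -big_split/=.
  rewrite !big_nat; apply: eq_bigr => k /andP[_ kn].
  have [tkn|tnk|/tinj ekn] := ltgtP (tau k) (tau n); last by rewrite ekn ltnn in kn.
    have -> : tau k <= u by apply: bigmax_nat_ge.
    by rewrite (le_trans (ltW tkn) tnt) addr0.
  by rewrite (lt_trans stn tnk) /= (leNgt (tau k) u) (lt_trans utn tnk) add0r.
have := IH s u s0 su; have := IH (tau n) t tn0 tnt.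
by have := dg n u u0 utn; lra.
Qed.

End sum_of_jumps.

Section cover.
Context {R : realType}.
Variables (f : R -> R) (tau jmp : nat -> R).
Hypothesis pj : pure_jump f tau jmp.
Local Notation gap := (gap f tau jmp).

Let gap_ge0 k : (0 <= (gap k)%:E)%E.
Proof. by rewrite lee_fin ltW// (gap_gt0 pj). Qed.

Let jmp_ge0 k : (0 <= (jmp k)%:E)%E.
Proof. by rewrite lee_fin ltW// (pj_jmp_gt0 pj). Qed.

(** The function exp (- f) only decreases by jumps.  The easy inequality bounds
    a function from below by its jumps; it is applied to f + exp (- f), which is
    nondecreasing with jumps jmp k - gap k, and the jumps of f, which sum up
    exactly to its increment, are then subtracted. *)
Lemma exp_decr_le_gaps s t : 0 <= s -> s <= t ->
  ((expR (- f s) - expR (- f t))%:E <=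
    \sum_(0 <= k <oo | (s < tau k <= t)%R) (gap k)%:E)%E.
Proof.
move=> s0 st; pose g u := f u + expR (- f u).
have exp_conv (a b : R) : 0 <= a -> a <= b -> a + expR (- a) <= b + expR (- b).
  move=> a0 ab; have := expR_ge1Dx (a - b).
  have -> : expR (- b) = expR (- a) * expR (a - b) by rewrite -expRD; congr expR; lra.
  have ea : expR (- a) <= 1 by rewrite -expR0 ler_expR oppr_le0.
  have ea0 : 0 <= expR (- a) by exact: expR_ge0.
  move=> h; have : expR (- a) * (1 + (a - b)) <= expR (- a) * expR (a - b).
    by rewrite ler_wpM2l.
  have : 0 <= (1 - expR (- a)) * (b - a) by rewrite mulr_ge0//; lra.
  by nra.
have gnd u v : 0 <= u -> u <= v -> g u <= g v.
  by move=> u0 uv; apply: exp_conv; [exact: (pure_jump_ge0 pj)|exact: (pure_jump_nd pj)].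
have dg k u : 0 <= u -> u < tau k -> jmp k - gap k <= g (tau k) - g u.
  move=> u0 utk; have := exp_conv _ _ (pure_jump_ge0 pj u0) (jump_le pj u0 utk).
  by rewrite /g /gap; lra.
have fin_tl n : ((expR (- f s) - expR (- f t))%:E
    + (\sum_(0 <= k < n | (s < tau k <= t)%R) (jmp k)%:E) <=
    (f t - f s)%:E + \sum_(0 <= k <oo | (s < tau k <= t)%R) (gap k)%:E)%E.
  apply: (@le_trans _ _ ((f t - f s)%:E +
      \sum_(0 <= k < n | (s < tau k <= t)%R) (gap k)%:E)%E); last first.
    by rewrite leeD2l//; exact: nneseries_lim_ge.
  rewrite !sumEFin -!EFinD lee_fin.
  have := @sum_jumps_le _ g tau (fun k => jmp k - gap k) n s t (pj_tau_inj pj) gnd dg s0 st.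
  by rewrite sumrB /g; lra.
have : ((expR (- f s) - expR (- f t))%:E + (f t - f s)%:E <=
    (f t - f s)%:E + \sum_(0 <= k <oo | (s < tau k <= t)%R) (gap k)%:E)%E.
  rewrite -leeBrDl// [X in (X <= _)%E](pure_jump_incr pj s0 st).
  apply: nneseries_le_bound => // n.
  by rewrite leeBrDl//; exact: fin_tl.
by rewrite addeC leeD2lE.
Qed.

Definition hit x c :=
  `[< exists2 t, 0 <= t & c%:R * x <= 1 - expR (- f t) < c.+1%:R * x >].

(** Between two hit cells of the same parity 1 - exp (- f) increases by at least
    x, so that a total of x is contributed by gaps, each of which counts for at
    most its min (1, gap / x).  Hence each parity class contributes at most one
    more than the sum of these minima.  The minima are replaced by arbitrary
    upper bounds v k, because v will be a weighted sum of indicators with a computable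
    expectation. *)
Lemma cover_count x (v : nat -> \bar R) n : 0 < x ->
  (forall k, (0 <= v k)%E) ->
  (forall k, ((Num.min 1 (gap k / x))%:E <= v k)%E) ->
  ((\sum_(0 <= c < n.*2) hit x c)%:R%:E <= 2%:E * (\sum_(0 <= k <oo) v k) + 2%:E)%E.
Proof.
move=> x0 v0 gv.
pose V t := (\sum_(0 <= k <oo | (tau k <= t)%R) v k)%E.
have V0 t : (0 <= V t)%E by apply: nneseries_ge0.
have Vtot t : (V t <= \sum_(0 <= k <oo) v k)%E by apply: subset_lee_nneseries.
have Vstep s t : 0 <= s -> 0 <= t -> expR (- f s) - expR (- f t) >= x -> (V s + 1 <= V t)%E.
  move=> s0 t0 xst.
  have st : s <= t.
    rewrite leNgt; apply/negP => /ltW ts.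
    have : expR (- f s) <= expR (- f t) by rewrite ler_expR lerN2 (pure_jump_nd pj).
    by lra.
  have -> : V t = (V s + \sum_(0 <= k <oo | (s < tau k <= t)%R) v k)%E.
    rewrite /V eseries_mkcond [X in (X + _)%E]eseries_mkcond.
    rewrite [X in (_ + X)%E]eseries_mkcond -nneseriesD//; last 2 first.
      by move=> k _ _; case: ifP.
      by move=> k _ _; case: ifP.
    apply: eq_eseriesr => k _.
    case: (ltP s (tau k)) => [stk|tks] /=; last by rewrite (le_trans tks st) adde0.
    by case: ifP; rewrite ?add0e.
  rewrite leeD2l//.
  (* either one gap is at least x and already counts for 1, or all the minima are
     gap / x and the gaps sum up to at least x *)
  have [[k /andP[stk xk]]|H] := pselect (exists k, (s < tau k <= t) && (x <= gap k)).
    apply: le_trans (nneseries_ge_term _ stk) => //.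
    apply: le_trans (gv k); rewrite lee_fin le_min lexx/=.
    by rewrite ler_pdivlMr// mul1r.
  apply: (@le_trans _ _ ((x^-1)%:E * \sum_(0 <= k <oo | (s < tau k <= t)%R) (gap k)%:E)%E).
    apply: (@le_trans _ _ ((x^-1)%:E * (expR (- f s) - expR (- f t))%:E)%E).
      by rewrite -EFinM lee_fin mulrC ler_pdivlMr// mul1r.
    by rewrite lee_pmul2l ?lte_fin ?invr_gt0//; exact: exp_decr_le_gaps.
  rewrite -nneseriesZl//; apply: lee_nneseries => k.
    by move=> _ _; rewrite mule_ge0// lee_fin invr_ge0 ltW.
  move=> stk; apply: le_trans (gv k); rewrite -EFinM lee_fin mulrC le_min lexx andbT.
  rewrite ler_pdivrMr// mul1r leNgt; apply/negP => /ltW xk.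
  by apply: H; exists k; rewrite stk.
have main (b : nat) i t : 0 <= t -> (i.*2 + b)%:R * x <= 1 - expR (- f t) ->
    ((\sum_(0 <= j < i) hit x (j.*2 + b))%:R%:E <= V t)%E.
  elim: i t => [|i IH] t t0; first by rewrite big_geq.
  move=> it; rewrite big_nat_recr//=.
  case: (boolP (hit x (i.*2 + b))) => [|_]; last first.
    rewrite addn0; apply: IH => //; apply: le_trans it.
    by apply: ler_wpM2r; [exact: ltW|rewrite ler_nat leq_add2r leq_double].
  move=> /asboolP[s s0 /andP[is1 is2]].
  have e1 : ((i.+1.*2 + b)%:R = (i.*2 + b).+1%:R + 1 :> R)
    by rewrite doubleS !addSn -natr1.
  have : (V s + 1 <= V t)%E.
    apply: Vstep => //; move: it; rewrite e1 mulrDl mul1r; lra.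
  apply: le_trans; rewrite natrD EFinD leeD2r//.
  exact: IH.
have mainT (b : nat) i :
    ((\sum_(0 <= j < i) hit x (j.*2 + b))%:R%:E <= \sum_(0 <= k <oo) v k + 1)%E.
  elim: i => [|i IH]; first by rewrite big_geq// adde_ge0// nneseries_ge0.
  rewrite big_nat_recr//=; case: (boolP (hit x (i.*2 + b))) => [|_]; last by rewrite addn0.
  move=> /asboolP[s s0 /andP[is1 is2]].
  rewrite natrD EFinD leeD2r//; apply: le_trans (Vtot s).
  exact: main.
have -> : (\sum_(0 <= c < n.*2) hit x c)%N =
   (\sum_(0 <= j < n) hit x (j.*2 + 0) + \sum_(0 <= j < n) hit x (j.*2 + 1))%N.
  elim: n => [|n IHn]; first by rewrite !big_geq.
  rewrite doubleS !big_nat_recr//= IHn addn0 addn1; lia.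
rewrite natrD EFinD (_ : 2%:E * _ + _ = (\sum_(0 <= k <oo) v k + 1) + (\sum_(0 <= k <oo) v k + 1))%E.
  by rewrite leeD.
have : (0 <= \sum_(0 <= k <oo) v k)%E by apply: nneseries_ge0.
case: (\sum_(0 <= k <oo) v k)%E => [r| |]//= _.
  by rewrite -EFinM -!EFinD; congr _%:E; lra.
by rewrite mulry gtr0_sg ?ltr0n// mul1e.
Qed.

End cover.

(** * Regular variation at the origin *)

Section regular_variation.
Context {R : realType}.
Implicit Types (a : R -> R) (al x y z : R).

Lemma near_at_right0 (P : R -> Prop) :
  (\forall x \near 0^'+, P x) <-> (exists2 x0, 0 < x0 & forall x, 0 < x -> x <= x0 -> P x).
Proof.
split.
  move=> [e /= e0 He]; exists (e / 2); first by rewrite divr_gt0.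
  move=> x x0 xe; apply: He => //=.
  rewrite sub0r normrN gtr0_norm//; lra.
move=> [x0 x00 H]; near=> x; apply: H.
- by near: x; exact: nbhs_right_gt.
- by near: x; exact: nbhs_right_le.
Unshelve. all: end_near. Qed.

(** Regular variation at 0 of index - al for a nonincreasing function.  The
    factor is written expR z because levels of S, hence logarithms of factors,
    are what is discretised later. *)
Record regvar a al : Prop := Regvar {
  rv_ge0 : forall y, 0 <= a y ;
  rv_ni : forall x y, 0 < x -> x <= y -> a y <= a x ;
  rv_gt0 : \forall y \near 0^'+, 0 < a y ;
  rv_cvg : forall z, a (expR z * y) / a y @[y --> 0^'+] --> expR (- al * z) }.

Variables (a : R -> R) (al : R).
Hypothesis rv : regvar a al.

Lemma regvar_bounds z lo hi : lo < expR (- al * z) < hi ->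
  \forall x \near 0^'+, lo * a x <= a (expR z * x) <= hi * a x.
Proof.
move=> /andP[loz zhi].
have H1 : \forall x \near 0^'+, lo < a (expR z * x) / a x.
  exact: (cvgr_gt _ (@rv_cvg _ _ rv z) _ loz).
have H2 : \forall x \near 0^'+, a (expR z * x) / a x < hi.
  exact: (cvgr_lt _ (@rv_cvg _ _ rv z) _ zhi).
have H3 := rv_gt0 rv.
near=> x.
have ax : 0 < a x by near: x.
apply/andP; split; apply: ltW.
  by rewrite -ltr_pdivlMr//; near: x.
by rewrite -ltr_pdivrMr//; near: x.
Unshelve. all: end_near. Qed.

(** Potter's bounds: one step by the factor e, or 1 / e, costs at most
    exp (- al') or exp be once the argument is small, and steps are iterated.
    Upward steps stop at x1, the bound below which a step is controlled; between
    x1 and 1 monotonicity loses only a constant. *)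
Lemma potter al' be : 0 < al' -> al' < al -> al < be ->
  exists2 C, 0 < C & \forall x \near 0^'+, forall z, expR z * x <= 1 ->
    a (expR z * x) <= C * a x * (expR (- al' * z) + expR (- be * z)).
Proof.
move=> al'0 al'al albe.
have /near_at_right0[x1 x10 H1] : \forall x \near 0^'+,
   expR (- be) * a x <= a (expR 1 * x) <= expR (- al') * a x.
  by apply: regvar_bounds; rewrite !ltr_expR; lra.
(* the iteration towards larger arguments, valid as long as they stay below x1 *)
have up k x : 0 < x -> expR k%:R * x <= x1 -> a (expR k%:R * x) <= expR (- al' * k%:R) * a x.
  elim: k => [|k IH] x0 kx; first by rewrite expR0 !mulr0 expR0 !mul1r.
  have e : expR k.+1%:R = expR 1 * expR k%:R :> R by rewrite -expRD -natr1 addrC.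
  have kx1 : expR k%:R * x <= x1.
    apply: le_trans kx; rewrite e -mulrA ler_peMl//.
      by rewrite mulr_ge0// ?expR_ge0// ltW.
    by rewrite -expR0 ler_expR.
  rewrite e -mulrA.
  have /andP[_] := H1 (expR k%:R * x) (mulr_gt0 (expR_gt0 _) x0) kx1.
  move/le_trans; apply.
  have -> : expR (- al' * k.+1%:R) = expR (- al') * expR (- al' * k%:R).
    by rewrite -expRD -natr1; congr expR; lra.
  by rewrite -mulrA ler_wpM2l ?expR_ge0// IH.
(* the iteration towards 0 *)
have down k x : 0 < x -> x <= x1 -> a (expR (- k%:R) * x) <= expR (be * k%:R) * a x.
  elim: k x => [|k IH] x x0 xx1; first by rewrite oppr0 expR0 !mulr0 expR0 !mul1r.
  have x'0 : 0 < expR (- 1) * x by rewrite mulr_gt0// expR_gt0.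
  have x'x : expR (- 1) * x <= x.
    by rewrite ler_piMl// ?(ltW x0)// -expR0 ler_expR; lra.
  have -> : expR (- k.+1%:R) * x = expR (- k%:R) * (expR (- 1) * x).
    by rewrite mulrA -expRD -natr1 opprD.
  apply: le_trans (IH _ x'0 (le_trans x'x xx1)) _.
  have -> : expR (be * k.+1%:R) = expR (be * k%:R) * expR be.
    by rewrite -expRD -natr1; congr expR; lra.
  rewrite -mulrA ler_wpM2l ?expR_ge0//.
  have /andP[+ _] := H1 _ x'0 (le_trans x'x xx1).
  rewrite mulrA -expRD subrr expR0 mul1r => h.
  by rewrite -(ler_pM2l (expR_gt0 (- be))) mulrA -expRD addNr expR0 mul1r.
have upz z x : 0 < x -> 0 <= z -> expR z * x <= x1 ->
    a (expR z * x) <= expR al' * expR (- al' * z) * a x.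
  move=> x0 z0 zx; have /andP[kz zk] := truncn_itv z0.
  set k := Num.trunc z in kz zk.
  have kzx : expR k%:R * x <= expR z * x.
    by rewrite ler_pM2r// ler_expR.
  apply: le_trans (rv_ni rv _ kzx) _; first by rewrite mulr_gt0 ?expR_gt0.
  apply: le_trans (up _ _ x0 (le_trans kzx zx)) _.
  rewrite ler_wpM2r ?(rv_ge0 rv)// -expRD ler_expR.
  rewrite -natr1 in zk; nra.
pose C := expR al' * expR (- al' * ln x1) + expR al' + expR be.
have C0 : 0 < C by rewrite !addr_gt0 ?mulr_gt0 ?expR_gt0.
exists C => //; apply/near_at_right0; exists x1 => // x x0 xx1 z zx1.
rewrite mulrAC.
have H (c w : R) : 0 <= w -> c <= C * w -> a (expR z * x) <= c * a x ->
   w <= expR (- al' * z) + expR (- be * z) ->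
   a (expR z * x) <= C * (expR (- al' * z) + expR (- be * z)) * a x.
  move=> w0 cC h wle; apply: le_trans h _; rewrite ler_wpM2r ?(rv_ge0 rv)//.
  by apply: le_trans cC _; rewrite ler_wpM2l// ltW.
have [z0|z0] := leP 0 z.
  have [zx|zx] := leP (expR z * x) x1.
    apply: (H (expR al' * expR (- al' * z)) (expR (- al' * z))); rewrite ?expR_ge0 ?upz//.
      rewrite ler_wpM2r ?expR_ge0// /C.
      have : 0 <= expR al' * expR (- al' * ln x1) by rewrite mulr_ge0 ?expR_ge0.
      by have := expR_ge0 be; lra.
    by rewrite lerDl expR_ge0.
  have lnx : ln x <= ln x1 by rewrite ler_ln// posrE.
  have ex1 : expR (ln x1 - ln x) * x = x1.
    by rewrite expRD expRN !lnK ?posrE// divfK// gt_eqF.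
  have := @upz (ln x1 - ln x) x x0; rewrite subr_ge0 ex1 lexx => /(_ lnx isT) h.
  have zln : z + ln x <= 0.
    by rewrite -ler_expR expR0 expRD lnK ?posrE.
  apply: (H (expR al' * expR (- al' * (ln x1 - ln x))) (expR (- al' * z))); rewrite ?expR_ge0//.
  - apply: (@le_trans _ _ (expR al' * expR (- al' * ln x1) * expR (- al' * z))).
      rewrite -mulrA ler_wpM2l ?expR_ge0// -expRD ler_expR; nra.
    rewrite ler_wpM2r ?expR_ge0// /C.
    by have := expR_ge0 be; have := expR_ge0 al'; lra.
  - by apply: le_trans h; rewrite (rv_ni rv)// ltW.
  - by rewrite lerDl expR_ge0.
have z0' : 0 <= - z by rewrite oppr_ge0 ltW.
have /andP[kz zk] := truncn_itv z0'.
set k := Num.trunc (- z) in kz zk.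
apply: (H (expR (be * k.+1%:R)) (expR (- be * z))); rewrite ?expR_ge0//.
- apply: (@le_trans _ _ (expR be * expR (- be * z))).
    by rewrite -expRD ler_expR -natr1; nra.
  rewrite ler_wpM2r ?expR_ge0// /C.
  have : 0 <= expR al' * expR (- al' * ln x1) by rewrite mulr_ge0 ?expR_ge0.
  by have := expR_ge0 al'; lra.
- apply: le_trans (down k.+1 _ x0 xx1); apply: (rv_ni rv).
    by rewrite mulr_gt0 ?expR_gt0.
  by rewrite ler_pM2r// ler_expR; lra.
- by rewrite lerDr expR_ge0.
Qed.

Lemma regvar_cvg_pinfty : 0 < al -> forall M, \forall x \near 0^'+, M <= a x.
Proof.
move=> al0 M.
have /near_at_right0[x1 x10 H1] : \forall x \near 0^'+,
    0 < a x /\ expR (al / 2) * a x <= a (expR (- 1) * x) <= expR (2 * al) * a x.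
  near=> x; split; first by near: x; exact: (rv_gt0 rv).
  by near: x; apply: regvar_bounds; rewrite !ltr_expR; lra.
have grow k : expR (al / 2 * k%:R) * a x1 <= a (expR (- k%:R) * x1).
  elim: k => [|k IH]; first by rewrite mulr0 oppr0 expR0 !mul1r.
  have kx0 : 0 < expR (- k%:R) * x1 by rewrite mulr_gt0 ?expR_gt0.
  have [|_ /andP[h _]] := H1 (expR (- k%:R) * x1) kx0.
    by rewrite ler_piMl// ?(ltW x10)// -expR0 ler_expR oppr_le0.
  rewrite [X in a (X * x1)](_ : _ = expR (- 1) * expR (- k%:R)); last first.
    by rewrite -expRD -natr1; congr expR; lra.
  rewrite -[expR (- 1) * _ * _]mulrA; apply: le_trans h.
  rewrite [X in X * a x1](_ : _ = expR (al / 2) * expR (al / 2 * k%:R)); last first.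
    by rewrite -expRD -natr1; congr expR; lra.
  by rewrite -mulrA ler_wpM2l ?expR_ge0.
have [ax1 _] := H1 x1 x10 (lexx _).
pose k := (Num.trunc (`|M| / a x1 / (al / 2))).+1.
have kM : `|M| / a x1 / (al / 2) < k%:R by exact: truncnS_gt.
apply/near_at_right0; exists (expR (- k%:R) * x1); first by rewrite mulr_gt0 ?expR_gt0.
move=> x x0 xk; apply: le_trans (rv_ni rv x0 xk); apply: le_trans (grow k).
apply: le_trans (ler_norm _) _; rewrite -ler_pdivrMr//.
rewrite ltr_pdivrMr in kM; last by rewrite divr_gt0.
by have := expR_ge1Dx (al / 2 * k%:R); lra.
Unshelve. all: end_near. Qed.

End regular_variation.

Section tail_of_levy_measure.
Context {R : realType}.
Variable nu : {sigma_finite_measure set R -> \bar R}.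
Hypothesis nu_levy : levy_measure nu.

Definition tail y : R := fine (nu `[y, +oo[%classic).

(** On [y, oo) the integrand min (1, x) of the Levy condition is at least
    min (1, y). *)
Lemma tail_fin y : 0 < y -> (nu `[y, +oo[%classic < +oo)%E.
Proof.
move=> y0; have [_ nu_int] := nu_levy.
set g := fun x : R => (Num.min 1 x)%:E.
have mg : measurable_fun [set: R] g.
  apply/measurable_EFinP; exact: measurable_minr.
have m0 : 0 < Num.min 1 y by rewrite lt_min ltr01.
have : ((Num.min 1 y)%:E * nu `[y, +oo[%classic <= \int[nu]_(x in `]0%R, +oo[) g x)%E.
  rewrite -integral_cst//.
  apply: (@le_trans _ _ (\int[nu]_(x in `[y, +oo[) g x)%E).
    apply: ge0_le_integral => //.
    - by move=> x _; rewrite lee_fin ltW.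
    - exact: measurable_funTS.
    - move=> x /=; rewrite in_itv/= andbT => yx.
      by rewrite lee_fin le_min ge_min lexx /= ge_min yx orbT.
  apply: ge0_subset_integral => //.
  - exact: measurable_funTS.
  - move=> x /=; rewrite in_itv/= andbT => x0.
    by rewrite lee_fin le_min ler01 ltW.
  - by move=> x /=; rewrite !in_itv/= !andbT; exact: lt_le_trans.
move=> /le_lt_trans /(_ nu_int).
case: (nu _) => [r _| |//]; first by rewrite ltry.
by rewrite mulry gtr0_sg// mul1e.
Qed.

Lemma tailE y : 0 < y -> nu `[y, +oo[%classic = (tail y)%:E.
Proof. by move=> y0; rewrite /tail fineK// ge0_fin_numE// tail_fin. Qed.

(** The quotient of the tails at expR z * y and y is the quotient of the two
    given asymptotic expressions, whose slowly varying factors cancel. *)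
Lemma regvar_tail (l : R -> R) al : slowly_varying l ->
  fine (nu `[y, +oo[%classic) / (y `^ (- al) * l (1 / y)) @[y --> 0^'+] --> (1 : R) ->
  regvar tail al.
Proof.
move=> [[X [_ lX]] lsv] Hnu.
have inv_cvg : (1 / y @[y --> (0 : R)^'+]) --> +oo.
  move=> A [M [Mreal MA]]; apply/near_at_right0.
  exists (`|M| + 1)^-1; first by rewrite invr_gt0 ltr_wpDl.
  move=> x x0 xM; apply: MA; rewrite div1r.
  have : `|M| + 1 <= x^-1 by rewrite -[leLHS]invrK lef_pV2// posrE invr_gt0 ltr_wpDl.
  by have := ler_norm M; lra.
have lpos : \forall y \near (0:R)^'+, 0 < l (1 / y).
  apply: (inv_cvg (fun x => 0 < l x)).
  by exists X; split; [exact: num_real|move=> x /ltW/lX].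
have tpos : \forall y \near (0:R)^'+, 0 < tail y.
  near=> y.
  have y0 : 0 < y by near: y; exact: nbhs_right_gt.
  have ly : 0 < l (1 / y) by near: y.
  have : 0 < tail y / (y `^ (- al) * l (1 / y)).
    by near: y; exact: (cvgr_gt _ Hnu _ ltr01).
  by rewrite pmulr_lgt0// invr_gt0 mulr_gt0// powR_gt0.
split => //.
- by move=> y; rewrite fine_ge0.
- move=> x y x0 xy; rewrite -lee_fin -!tailE//; last exact: lt_le_trans xy.
  apply: le_measure; rewrite ?inE//.
  by move=> t /=; rewrite !in_itv/= !andbT; exact: le_trans.
- move=> z.
  have scal : (expR z * y @[y --> (0:R)^'+]) --> (0 : R)^'+.
    move=> A /near_at_right0[x0 x00 H]; apply/near_at_right0.
    exists (x0 / expR z); first by rewrite divr_gt0 ?expR_gt0.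
    move=> x xgt0; rewrite ler_pdivlMr ?expR_gt0// mulrC => xx0.
    by apply: H => //; rewrite mulr_gt0 ?expR_gt0.
  pose r y := tail y / (y `^ (- al) * l (1 / y)).
  have cr : r y @[y --> 0^'+] --> (1 : R) := Hnu.
  have crz : r (expR z * y) @[y --> 0^'+] --> (1 : R) := cvg_comp _ _ scal Hnu.
  have cl : l (expR (- z) * (1 / y)) / l (1 / y) @[y --> (0:R)^'+] --> (1 : R).
    exact: (cvg_comp _ _ inv_cvg (lsv _ (expR_gt0 (- z)))).
  have crV : (r y)^-1 @[y --> 0^'+] --> (1^-1 : R) by apply: cvgV => //; exact: oner_neq0.
  have cc : r (expR z * y) * expR (- al * z) * (l (expR (- z) * (1 / y)) / l (1 / y))
      * (r y)^-1 @[y --> 0^'+] --> 1 * expR (- al * z) * 1 * 1^-1.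
    apply: cvgM crV; apply: cvgM cl; apply: cvgM crz _; exact: cvg_cst.
  move: cc; rewrite invr1 !mulr1 mul1r; apply: cvg_trans; apply: near_eq_cvg; near=> y.
  have y0 : 0 < y by near: y; exact: nbhs_right_gt.
  have ly : 0 < l (1 / y) by near: y.
  have lzy : 0 < l (expR (- z) * (1 / y)).
    have : 0 < l (1 / (expR z * y)) by near: y; exact: (scal (fun y => 0 < l (1 / y))).
    by rewrite invfM -expRN !div1r mul1r.
  have ty : 0 < tail y by near: y.
  have e1 : 1 / (expR z * y) = expR (- z) * (1 / y).
    by rewrite expRN; field; rewrite !gt_eqF ?expR_gt0.
  rewrite /r /= e1 powRM ?expR_ge0 ?(ltW y0)//.
  rewrite -expRM [z * - al]mulrC.
  have := expR_gt0 (- al * z); have : 0 < y `^ (- al) by exact: powR_gt0.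
  move: (y `^ _) (expR _) (l _) (l _) ly lzy (tail _) (tail _) ty => p e l1 l2 l10 l20 t1 t2 t20 p0 e0.
  by field; rewrite !gt_eqF.
Unshelve. all: end_near. Qed.

End tail_of_levy_measure.

(** * Poisson variables *)

Section real_series.
Context {R : realType}.

Lemma nneseries_EFin_cvg (u : nat -> R) (s : R) :
  \sum_(0 <= k < n) u k @[n --> \oo] --> s ->
  (\sum_(0 <= k <oo) (u k)%:E)%E = s%:E.
Proof.
move=> us; apply/cvg_lim => //.
under eq_fun do rewrite sumEFin.
by apply: cvg_EFin => //; exact: nearW.
Qed.

Lemma cvgn_mull (c : R) (u : nat -> R) (s : R) :
  u n @[n --> \oo] --> s -> c * u n @[n --> \oo] --> c * s.
Proof. by move=> us; apply: cvgM us; exact: cvg_cst. Qed.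

End real_series.

Section poisson_pmf.
Context {R : realType}.
Variable lam : R.

Definition pois m : R := expR (- lam) * lam ^+ m / m`!%:R.

Lemma pois_sum_cvg : \sum_(0 <= m < n) pois m @[n --> \oo] --> (1 : R).
Proof.
have h : series (exp_coeff lam) n @[n --> \oo] --> expR lam.
  rewrite /expR; exact: is_cvg_series_exp_coeff.
have := @cvgn_mull _ (expR (- lam)) _ _ h.
rewrite -expRD addNr expR0; apply: cvg_trans; apply: near_eq_cvg; near=> n.
by rewrite /series/= mulr_sumr; apply: eq_bigr => m _; rewrite /pois /exp_coeff mulrA.
Unshelve. all: end_near. Qed.

Lemma pois_shift m : m.+1%:R * pois m.+1 = lam * pois m.
Proof.
rewrite /pois factS natrM exprS; field.
by rewrite nat1r !pnatr_eq0 -!lt0n fact_gt0.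
Qed.

Lemma pois_mean_cvg : \sum_(0 <= m < n) m%:R * pois m @[n --> \oo] --> lam.
Proof.
rewrite -(cvg_shiftS (fun n => \sum_(0 <= m < n) m%:R * pois m)).
have := @cvgn_mull _ lam _ _ pois_sum_cvg; rewrite mulr1.
apply: cvg_trans; apply: near_eq_cvg; near=> n.
rewrite /= big_nat_recl//= mul0r add0r mulr_sumr; apply: eq_bigr => m _.
by rewrite pois_shift.
Unshelve. all: end_near. Qed.

Lemma pois_mean2_cvg : \sum_(0 <= m < n) m%:R * (m%:R - 1) * pois m @[n --> \oo] --> lam ^+ 2.
Proof.
rewrite -(cvg_shiftS (fun n => \sum_(0 <= m < n) m%:R * (m%:R - 1) * pois m)).
have := @cvgn_mull _ lam _ _ pois_mean_cvg; rewrite -expr2.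
apply: cvg_trans; apply: near_eq_cvg; near=> n.
rewrite /= big_nat_recl//= !mul0r add0r mulr_sumr; apply: eq_bigr => m _.
by rewrite mulrAC pois_shift -natr1; ring.
Unshelve. all: end_near. Qed.

Lemma pois_var_cvg : \sum_(0 <= m < n) (m%:R - lam) ^+ 2 * pois m @[n --> \oo] --> lam.
Proof.
have cc : \sum_(0 <= m < n) m%:R * (m%:R - 1) * pois m +
    ((1 - 2 * lam) * \sum_(0 <= m < n) m%:R * pois m +
     lam ^+ 2 * \sum_(0 <= m < n) pois m) @[n --> \oo] -->
    lam ^+ 2 + ((1 - 2 * lam) * lam + lam ^+ 2 * 1).
  apply: cvgD pois_mean2_cvg _.
  apply: cvgD; apply: cvgn_mull; [exact: pois_mean_cvg|exact: pois_sum_cvg].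
move: cc; rewrite (_ : lam ^+ 2 + _ = lam); last by ring.
apply: cvg_trans; apply: near_eq_cvg; near=> n.
rewrite !mulr_sumr -!big_split/=; apply: eq_bigr => m _; ring.
Unshelve. all: end_near. Qed.

End poisson_pmf.

Section poisson_variable.
Context {R : realType} {d : measure_display} {T : measurableType d}.
Variables (P : probability T R) (X : T -> \bar R) (lam : R).
Hypothesis mX : measurable_fun [set: T] X.
Hypothesis hX : forall m : nat, P [set w | X w = m%:R%:E] = (pois lam m)%:E.


Let A m := [set w | X w = m%:R%:E].

Let mA m : measurable (A m).
Proof. by rewrite -[A m]setTI; exact: (mX measurableT (emeasurable_set1 _)). Qed.

Let tA : trivIset [set: nat] A.
Proof.
apply/trivIsetP => i j _ _ ij; rewrite -subset0 => w []; rewrite /A /= => -> [] /eqP.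
by rewrite eqr_nat (negbTE ij).
Qed.

(** The weights sum up to 1, so X is almost surely a natural number and the
    integral is a series. *)
Lemma poisson_integral (g : nat -> R) (G : \bar R -> \bar R) s :
  measurable_fun [set: \bar R] G -> (forall e, (0 <= G e)%E) ->
  (forall m, G m%:R%:E = (g m)%:E) ->
  \sum_(0 <= m < n) g m * pois lam m @[n --> \oo] --> s ->
  (\int[P]_w G (X w) = s%:E)%E.
Proof.
move=> mG G0 Gg gs.
have mD : measurable (\bigcup_m A m) by exact: bigcup_measurable.
have PD : P (~` \bigcup_m A m) = 0%E.
  rewrite probability_setC// measure_bigcup//=.
  rewrite (eq_eseriesl (Q := xpredT)); last by move=> m; rewrite in_setT.
  rewrite (eq_eseriesr (fun m _ => hX m)).
  by rewrite (nneseries_EFin_cvg (@pois_sum_cvg _ lam)) subee.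
have mGX : measurable_fun [set: T] (G \o X) by exact: measurableT_comp.
rewrite -(setvU (\bigcup_m A m)) ge0_integral_setU//=; last 3 first.
- exact: measurableC.
- exact: measurable_funTS.
- by rewrite disj_set_sym; apply/disj_setPS; rewrite setICr.
rewrite (_ : (\int[P]_(x in ~` _) _)%E = 0%E) ?add0e; last first.
  by apply: null_set_integral => //; [exact: measurableC|exact: measurable_funTS].
rewrite ge0_integral_bigcup//=; last first.
  exact: measurable_funTS.
rewrite -(nneseries_EFin_cvg gs); apply: eq_eseriesr => m _.
rewrite EFinM -hX -[in RHS]Gg -integral_cst//; last exact: mA.
by apply: eq_integral => w; rewrite inE => /= ->.
Qed.

Lemma poisson_expectation : (\int[P]_w `|X w| = lam%:E)%E.
Proof.
apply: (@poisson_integral (fun m => m%:R) (fun e => `|e|%E)) => //.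
- exact: abse_measurable.
- by move=> m; rewrite abse_EFin ger0_norm.
- exact: pois_mean_cvg.
Qed.

Lemma poisson_chebyshev t : 0 < t ->
  (P [set w | (t%:E <= `|X w - lam%:E|)%E] <= (lam / t ^+ 2)%:E)%E.
Proof.
move=> t0.
pose G (e : \bar R) := (`|e - lam%:E| * `|e - lam%:E|)%E.
have mG : measurable_fun [set: \bar R] G.
  have m1 : measurable_fun [set: \bar R] (fun e : \bar R => `|e - lam%:E|%E).
    apply: measurableT_comp => //; exact: emeasurable_funB.
  exact: emeasurable_funM.
have G0 e : (0 <= G e)%E by rewrite mule_ge0.
have mGX : measurable_fun [set: T] (G \o X) by exact: measurableT_comp.
have mB : measurable [set w | (t%:E <= `|X w - lam%:E|)%E].
  rewrite -[X in measurable X]setTI; apply: emeasurable_fun_c_infty => //.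
  apply: measurableT_comp => //; exact: emeasurable_funB.
have EG : (\int[P]_w G (X w) = lam%:E)%E.
  apply: (@poisson_integral (fun m => (m%:R - lam) ^+ 2)) => //.
  - by move=> m; rewrite /G -EFinB abse_EFin -EFinM -expr2 real_normK// num_real.
  - exact: pois_var_cvg.
rewrite -(@lee_pmul2l _ (t ^+ 2)%:E) ?lte_fin ?exprn_gt0//.
rewrite -[X in (_ <= X)%E]EFinM mulrC divfK ?gt_eqF ?exprn_gt0//.
apply: (@le_trans _ _ (\int[P]_w G (X w))%E); last by rewrite EG.
rewrite -integral_cst//.
apply: (@le_trans _ _ (\int[P]_(w in [set w | (t%:E <= `|X w - lam%:E|)%E]) G (X w))%E).
  apply: ge0_le_integral => //.
  - by move=> w _; rewrite lee_fin sqr_ge0.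
  - exact: measurable_funTS.
  - by move=> w /= tw; rewrite expr2 EFinM; apply: lee_pmul => //; rewrite lee_fin ltW.
by apply: ge0_subset_integral => //; exact: measurable_funTS.
Qed.

End poisson_variable.

(** * The points of the Poisson process *)

Section geometric.
Context {R : realType}.

Lemma geometric_partial_sum_le (r : R) m n : 0 < r < 1 ->
  \sum_(0 <= i < n | (m <= i)%N) r ^+ i <= r ^+ m / (1 - r).
Proof.
move=> /andP[r0 r1].
suff H : \sum_(0 <= i < n | (m <= i)%N) r ^+ i * (1 - r) <= r ^+ m - r ^+ maxn m n.
  rewrite ler_pdivlMr ?subr_gt0// mulr_suml (le_trans H)// gerBl exprn_ge0//.
  exact: ltW.
elim: n => [|n IH]; first by rewrite big_geq// maxn0 subrr.
rewrite big_mkcond big_nat_recr//= -big_mkcond/=.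
case: (leqP m n) => mn.
  have -> : maxn m n.+1 = n.+1 by apply/maxn_idPr; rewrite (leq_trans mn).
  by have := IH; rewrite (maxn_idPr mn) exprSr; lra.
by move: IH; rewrite addr0 (maxn_idPl mn) (maxn_idPl (ltnW mn)).
Qed.

End geometric.

Section measurable_series.
Context {R : realType} {d : measure_display} {T : measurableType d}.

Lemma measurable_nneseries (h : nat -> T -> \bar R) :
  (forall k x, (0 <= h k x)%E) -> (forall k, measurable_fun [set: T] (h k)) ->
  measurable_fun [set: T] (fun x => \sum_(0 <= k <oo) h k x)%E.
Proof.
move=> h0 mh; rewrite (_ : (fun x => _) = (fun x => \sum_(0 <= k <oo | k \in xpredT) h k x)%E).
  by apply: ge0_emeasurable_sum => // k _; exact: mh.
by apply/funext => x; apply: eq_eseriesl.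
Qed.

End measurable_series.

Section point_counts.
Context {R : realType} {d : measure_display} {T : measurableType d}.
Variables (P : probability T R) (nu : {sigma_finite_measure set R -> \bar R}).
Variables (tau jmp : nat -> {RV P >-> R}).
Hypothesis nu_levy : levy_measure nu.
Hypothesis ppp : poisson_point_process nu tau jmp.

Lemma measurable_point_count A : measurable A ->
  measurable_fun [set: T] (point_count tau jmp A).
Proof.
move=> mA; rewrite /point_count.
apply: measurable_nneseries => [k w|k]; first by rewrite diracE lee_fin.
have -> : (fun w => \d_(tau k w, jmp k w) A) =
   (fun w => (\1_A ((fun w => (tau k w, jmp k w)) w))%:E :> \bar R).
  by apply/funext => w; rewrite diracE indicE.
apply/measurable_EFinP.
apply: (measurableT_comp (f := \1_A : R * R -> R) (g := fun x => (tau k x, jmp k x))).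
  exact: measurable_indic.
exact: measurable_fun_pair.
Qed.

Lemma point_count_ge0 A w : (0 <= point_count tau jmp A w)%E.
Proof. by apply: nneseries_ge0 => k _ _; rewrite diracE lee_fin. Qed.

Definition strip s t y : set (R * R) := `]s, t] `*` `[y, +oo[.

Lemma measurable_strip s t y : measurable (strip s t y).
Proof. exact: measurableX. Qed.

Lemma strip_measure s t y : s <= t -> 0 < y ->
  (lebesgue_measure \x nu)%E (strip s t y) = ((t - s) * tail nu y)%:E.
Proof.
move=> st y0; rewrite /strip product_measure1E//=.
rewrite lebesgue_measure_itv/= lte_fin tailE//.
by case: ltP => [_|ts]; rewrite ?EFinM// (_ : t - s = 0) ?mul0e ?mul0r//; lra.
Qed.

Lemma strip_sub s t y : 0 <= s -> 0 < y -> strip s t y `<=` `[0, +oo[ `*` `]0, +oo[.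
Proof.
move=> s0 y0 [u j] [] /=; rewrite !in_itv/= !andbT => /andP[su _] yj.
by rewrite (le_trans s0 (ltW su)) (lt_le_trans y0 yj).
Qed.

Lemma strip_poisson s t y m : 0 <= s -> s <= t -> 0 < y ->
  P [set w | point_count tau jmp (strip s t y) w = m%:R%:E] =
    (pois ((t - s) * tail nu y) m)%:E.
Proof.
move=> s0 st y0; have [_ pp _ _] := ppp.
rewrite pp ?strip_measure ?ltry//; [exact: measurable_strip|exact: strip_sub].
Qed.

Lemma strip_rate_ge0 s t y : s <= t -> 0 <= (t - s) * tail nu y.
Proof. by move=> st; rewrite mulr_ge0 ?subr_ge0// fine_ge0. Qed.

Lemma strip_expectation s t y : 0 <= s -> s <= t -> 0 < y ->
  (\int[P]_w point_count tau jmp (strip s t y) w = ((t - s) * tail nu y)%:E)%E.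
Proof.
move=> s0 st y0.
rewrite -(@poisson_expectation _ _ _ P (point_count tau jmp (strip s t y)) ((t - s) * tail nu y)).
- by apply: eq_integral => w _; rewrite gee0_abs// point_count_ge0.
- by apply: measurable_point_count; exact: measurable_strip.
- by move=> m; exact: strip_poisson.
Qed.

Lemma strip_chebyshev s t y e : 0 <= s -> s <= t -> 0 < y -> 0 < e ->
  (P [set w | (e%:E <= `|point_count tau jmp (strip s t y) w
                         - ((t - s) * tail nu y)%:E|)%E]
   <= ((t - s) * tail nu y / e ^+ 2)%:E)%E.
Proof.
move=> s0 st y0 e0; apply: poisson_chebyshev => //.
- by apply: measurable_point_count; exact: measurable_strip.
- by move=> m; exact: strip_poisson.
Qed.

Lemma point_count_neq0 A w : point_count tau jmp A w != 0%E ->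
  exists k, A (tau k w, jmp k w).
Proof.
move=> /eqP pc; apply: contrapT => /forallNP H; apply: pc.
by apply: eseries0 => k _ _; rewrite diracE memNset.
Qed.

Lemma point_count_ge2 A w k l : k != l -> A (tau k w, jmp k w) -> A (tau l w, jmp l w) ->
  (2%:E <= point_count tau jmp A w)%E.
Proof.
move=> kl Ak Al.
have d0 i : (0%R <= \d_(tau i w, jmp i w) A :> \bar R)%E by rewrite diracE lee_fin.
rewrite /point_count (@nneseriesD1 _ _ k)//= (@nneseriesD1 _ _ l)//=; last by rewrite eq_sym.
rewrite !diracE !mem_set// addeA -EFinD natr1 leeDl//; exact: nneseries_ge0.
Qed.

(** Indeed 1 - exp (- mu) * (1 + mu) <= mu ^ 2. *)
Lemma strip_two_points s t y : 0 <= s -> s <= t -> 0 < y ->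
  (P (~` ([set w | point_count tau jmp (strip s t y) w = 0%:R%:E] `|`
          [set w | point_count tau jmp (strip s t y) w = 1%:R%:E]))
   <= (((t - s) * tail nu y) ^+ 2)%:E)%E.
Proof.
move=> s0 st y0; set mu := (t - s) * tail nu y.
have mset m : measurable [set w | point_count tau jmp (strip s t y) w = m%:R%:E].
  rewrite -[X in measurable X]setTI.
  exact: (measurable_point_count (measurable_strip s t y) measurableT (emeasurable_set1 _)).
rewrite probability_setC; last exact: measurableU.
set A0 := [set w | _ = 0%:R%:E]; set A1 := [set w | _ = 1%:R%:E].
have -> : P (A0 `|` A1) = (pois mu 0 + pois mu 1)%:E.
  rewrite measureU.
  - by rewrite EFinD; congr (_ + _)%E; exact: strip_poisson.
  - exact: (mset 0%N).
  - exact: (mset 1%N).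
  - by rewrite -subset0 => w; rewrite /A0 /A1 /= => -[->] [] /eqP; rewrite eqr_nat.
rewrite -EFinB lee_fin /pois expr0 expr1 fact0 !divr1.
have mu0 : 0 <= mu by exact: strip_rate_ge0.
have := expR_ge1Dx (- mu); nra.
Qed.

(** Two points with the same epoch and sizes at least y lie, for every r, in one
    of r + 1 strips of equal duration; by the quadratic bound for two points in a
    strip this has probability O (1 / r). *)
Lemma ae_tau_inj : {ae P, forall w, (forall k, 0 < tau k w) -> injective (tau ^~ w)}.
Proof.
have [pos _ _ _] := ppp.
pose y N : R := N.+1%:R^-1.
have y0 N : 0 < y N by rewrite invr_gt0.
pose cell N r i := strip (i%:R * (N%:R / r.+1%:R)) (i.+1%:R * (N%:R / r.+1%:R)) (y N).
pose F N r i := ~` ([set w | point_count tau jmp (cell N r i) w = 0%:R%:E] `|`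
          [set w | point_count tau jmp (cell N r i) w = 1%:R%:E]).
pose G N r := \big[setU/set0]_(i < r.+1) F N r i.
have mF N r i : measurable (F N r i).
  have mset m : measurable [set w | point_count tau jmp (cell N r i) w = m%:R%:E].
    rewrite -[X in measurable X]setTI.
    exact: (measurable_point_count (measurable_strip _ _ _) measurableT (emeasurable_set1 _)).
  by apply: measurableC; exact: measurableU.
have mG N r : measurable (G N r) by exact: bigsetU_measurable.
have PG N r : (P (G N r) <= ((N%:R * tail nu (y N)) ^+ 2 / r.+1%:R)%:E)%E.
  apply: le_trans (Boole_inequality _ _) _ => [i _|]; first exact: mF.
  apply: (@le_trans _ _ (\sum_(i < r.+1) ((N%:R / r.+1%:R * tail nu (y N)) ^+ 2)%:E)%E).
    apply: lee_sum => i _; apply: le_trans (strip_two_points _ _ (y0 N)) _.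
    - by rewrite mulr_ge0// divr_ge0.
    - by rewrite ler_wpM2r ?divr_ge0// ler_nat.
    - by rewrite -mulrBl -natr1 addrAC subrr add0r mul1r.
  rewrite sumEFin lee_fin sumr_const card_ord -mulr_natr.
  rewrite le_eqVlt; apply/orP; left; apply/eqP; field.
  by rewrite nat1r pnatr_eq0.
have null N : P.-negligible (\bigcap_r G N r).
  exists (\bigcap_r G N r); split => //; first exact: bigcapT_measurable.
  apply/eqP; rewrite eq_le measure_ge0 andbT; apply/lee_addgt0Pr => e e0.
  rewrite add0e.
  set c := (N%:R * tail nu (y N)) ^+ 2 in PG.
  have [r rc] : exists r, c / r.+1%:R <= e.
    exists (Num.trunc (c / e)); rewrite ler_pdivrMr// mulrC -ler_pdivrMr//.
    by rewrite ltW// truncnS_gt.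
  apply: (@le_trans _ _ (P (G N r))); last first.
    by apply: le_trans (PG N r) _; rewrite lee_fin.
  by apply: le_measure; rewrite ?inE//; [exact: bigcapT_measurable|exact: bigcap_inf].
have := negligible_bigcup null.
apply: negligibleS => w /= /not_implyP[tpos].
move=> /existsNP[k] /existsNP[l] /not_implyP[/= tkl /eqP kl].
have [N [tN [jkN jlN]]] : exists N : nat, tau k w <= N%:R /\ y N <= jmp k w /\ y N <= jmp l w.
  have jk := (pos k w).2; have jl := (pos l w).2.
  pose m := Num.min (jmp k w) (jmp l w).
  have m0 : 0 < m by rewrite lt_min jk jl.
  exists (maxn (Num.trunc (tau k w)).+1 (Num.trunc m^-1)); split.
    rewrite (le_trans (ltW (truncnS_gt (tau k w))))// ler_nat leq_maxl//.
  have : y (maxn (Num.trunc (tau k w)).+1 (Num.trunc m^-1)) <= m.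
    rewrite /y -[leRHS]invrK lef_pV2 ?posrE// ?invr_gt0//.
    by rewrite (le_trans (ltW (truncnS_gt m^-1)))// ler_nat ltnS leq_maxr.
  by rewrite le_min => /andP[].
exists N => // r _.
have N0 : 0 < N%:R / r.+1%:R :> R by rewrite divr_gt0// (lt_le_trans (tpos k)).
pose h := N%:R / r.+1%:R : R.
have [i ir /andP[hi1 hi2]] : exists2 i, (i < r.+1)%N & i%:R * h < tau k w <= i.+1%:R * h.
  have hr : r.+1%:R * h = N%:R by rewrite /h mulrC divfK// pnatr_eq0.
  have : exists i, tau k w <= i.+1%:R * h.
    by exists r; rewrite hr.
  move=> ex; case: (ex_minnP ex) => i it imin; exists i.
    by rewrite ltnS; apply: imin; rewrite hr.
  rewrite it andbT; case: i {it} imin => [|i] imin; first by rewrite mul0r tpos.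
  by rewrite ltNge; apply/negP => /imin; rewrite ltnn.
have ck : cell N r i (tau k w, jmp k w).
  by split => /=; rewrite in_itv/= ?andbT// hi1.
have cl : cell N r i (tau l w, jmp l w).
  by split => /=; rewrite in_itv/= ?andbT// -tkl hi1.
have := point_count_ge2 kl ck cl.
by rewrite /G (bigD1 (Ordinal ir))//= => c2; left => -[] /= E;
  move: c2; rewrite E lee_fin ler_nat.
Qed.

Variable S : R -> {RV P >-> R}.

(** An epoch cannot be 0, because the jump would contribute to S 0 = 0. *)
Lemma ae_pure_jump : (forall w, S 0 w = 0) ->
  {ae P, forall w, forall t : R, 0 <= t ->
        (S t w)%:E = (\sum_(0 <= k <oo | (tau k w <= t)%R) (jmp k w)%:E)%E} ->
  {ae P, forall w, pure_jump (S ^~ w) (tau ^~ w) (jmp ^~ w)}.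
Proof.
move=> S0; apply: filterS2 ae_tau_inj => w inj sumS.
have [pos _ _ _] := ppp.
have tpos k : 0 < tau k w.
  rewrite lt_neqAle (pos k w).1 andbT; apply/eqP => t0.
  have := sumS 0 (lexx _); rewrite S0 => s0.
  have : ((jmp k w)%:E <= 0%:E)%E.
    rewrite s0; apply: (@nneseries_ge_term _ (fun k => (jmp k w)%:E)).
      by move=> n _; rewrite lee_fin ltW// (pos n w).2.
    by rewrite -t0.
  by rewrite lee_fin leNgt (pos k w).2.
split => //; first by move=> k; exact: (pos k w).2.
exact: inj.
Qed.

End point_counts.

(** * Time blocks and the weights of late jumps *)

Section blocks.
Context {R : realType}.
Variables (y0 kap del : R).
Hypotheses (y00 : 0 < y0) (kap0 : 0 < kap) (del0 : 0 < del).

(** Block m lasts blen m and starts at btime m.  The lengths grow so that the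
    probabilities that a block contains no jump of size y0 are summable, but
    slowly enough for exp (- al * (m * y0)) * blen m to be summable too. *)
Definition blen m : R := kap * expR (del * m%:R).
Definition btime m : R := \sum_(i < m) blen i.

Lemma blen_ge m : kap <= blen m.
Proof.
by rewrite /blen ler_peMr ?(ltW kap0)// -expR0 ler_expR mulr_ge0// ltW.
Qed.

Lemma blen_gt0 m : 0 < blen m.
Proof. exact: lt_le_trans kap0 (blen_ge m). Qed.

Lemma btime0 : btime 0 = 0.
Proof. by rewrite /btime big_ord0. Qed.

Lemma btimeS m : btime m.+1 = btime m + blen m.
Proof. by rewrite /btime big_ord_recr. Qed.

Lemma btime_nd m n : (m <= n)%N -> btime m <= btime n.
Proof.
move=> /subnKC <-; elim: (n - m)%N => [|k IH]; first by rewrite addn0.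
by rewrite addnS btimeS (le_trans IH)// lerDl ltW// blen_gt0.
Qed.

Lemma btime_ge0 m : 0 <= btime m.
Proof. by rewrite -btime0 btime_nd. Qed.

Lemma btime_lower m : m%:R * kap <= btime m.
Proof.
elim: m => [|m IH]; first by rewrite mul0r btime0.
by rewrite btimeS -natr1 mulrDl mul1r lerD// blen_ge.
Qed.

Lemma block_of t : 0 < t -> exists m, btime m < t <= btime m.+1.
Proof.
move=> t0.
have ex : exists m, t <= btime m.+1.
  exists (Num.trunc (t / kap)); apply: le_trans (btime_lower _).
  by rewrite -ler_pdivrMr// ltW// truncnS_gt.
case: (ex_minnP ex) => m tm mmin; exists m; rewrite tm andbT.
case: m tm mmin => [|m] tm mmin; first by rewrite btime0.
by rewrite ltNge; apply/negP => /mmin; rewrite ltnn.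
Qed.

(** A jump of gap at least x in block m has size at least level x m 0; the levels
    with i > 0 record jumps with a smaller gap.  Jumps above size 1 need no
    separate treatment, since gaps are controlled by min (1, size): strips above
    level 1 are dropped, which also keeps the arguments of the tail where the
    Potter bounds hold. *)
Definition level x m i : R := expR (y0 * (m%:R - i%:R)) * x.

Definition levelset x m i : set (R * R) :=
  if level x m i <= 1 then strip (btime m) (btime m.+1) (level x m i) else set0.

(** A weighted sum of indicators of strips that dominates min (1, gap / x) for
    the jumps in the blocks from m0 on; the expectation of its sum over all
    points is a series of tails of nu. *)
Definition qweight m0 x (p : R * R) : \bar R :=
  (\sum_(0 <= m <oo | (m0 <= m)%N)
     \sum_(0 <= i <oo) (expR (y0 * (1 - i%:R)))%:E * \d_p (levelset x m i))%E.

Lemma qterm_ge0 i (p : R * R) A : (0 <= (expR (y0 * (1 - i%:R)))%:E * (\d_p A : \bar R))%E.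
Proof. by rewrite diracE -EFinM lee_fin mulr_ge0// expR_ge0. Qed.

Lemma qweight_ge0 m0 x p : (0 <= qweight m0 x p)%E.
Proof.
apply: nneseries_ge0 => m _ _; apply: nneseries_ge0 => i _ _; exact: qterm_ge0.
Qed.

(** For the least i such that exp (- y0 * i) is at most the given bound of g / x,
    the point lies in the strip (m, i), and by minimality the factor of that
    strip is at least g / x. *)
Lemma qweight_lower m0 m x t j g : 0 < x -> (m0 <= m)%N -> btime m < t <= btime m.+1 ->
  0 < g -> g <= expR (- (y0 * m%:R)) * Num.min 1 j ->
  ((Num.min 1 (g / x))%:E <= qweight m0 x (t, j))%E.
Proof.
move=> x0 m0m tm g0 gj.
pose z := expR (- (y0 * m%:R)) * Num.min 1 j / x.
have z0 : 0 < z by rewrite divr_gt0// (lt_le_trans g0).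
have ex : exists i : nat, expR (- (y0 * i%:R)) <= z.
  exists (Num.trunc (- ln z / y0)).+1.
  rewrite -[leRHS]lnK ?posrE// ler_expR lerNl mulrC -ler_pdivrMr//.
  by rewrite ltW// truncnS_gt.
case: (ex_minnP ex) => i zi imin.
apply: (@le_trans _ _ ((expR (y0 * (1 - i%:R)))%:E * \d_(t, j) (levelset x m i))%E).
  have lj : level x m i <= Num.min 1 j.
    have -> : level x m i = expR (- (y0 * i%:R)) * (x * expR (y0 * m%:R)).
      rewrite /level mulrCA -expRD mulrC; congr (x * expR _); ring.
    have -> : Num.min 1 j = z * (x * expR (y0 * m%:R)).
      by rewrite /z expRN; field; rewrite !gt_eqF ?expR_gt0.
    by rewrite ler_pM2r// mulr_gt0// expR_gt0.
  have /andP[l1 l2] : (level x m i <= 1) && (level x m i <= j) by rewrite -le_min.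
  rewrite diracE mem_set ?mule1; last first.
    by rewrite /levelset l1; split => //=; rewrite in_itv/= andbT.
  rewrite lee_fin ge_min; case: i {zi lj l1 l2} imin => [|i] imin.
    by rewrite subr0 mulr1 -expR0 ler_expR ltW.
  apply/orP; right.
  have : z <= expR (- (y0 * i%:R)).
    by rewrite leNgt; apply/negP => /ltW/imin; rewrite ltnn.
  have -> : y0 * (1 - i.+1%:R) = - (y0 * i%:R) by rewrite -natr1; ring.
  by apply: le_trans; rewrite /z ler_pM2r// invr_gt0.
apply: (@le_trans _ _ (\sum_(0 <= i <oo) (expR (y0 * (1 - i%:R)))%:E *
   \d_(t, j) (levelset x m i))%E).
  apply: (@nneseries_ge_term _ (fun i => ((expR (y0 * (1 - i%:R)))%:E *
     \d_(t, j) (levelset x m i))%E) xpredT i) => // k _; exact: qterm_ge0.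
rewrite /qweight.
apply: (@nneseries_ge_term _ (fun m => (\sum_(0 <= i <oo) (expR (y0 * (1 - i%:R)))%:E *
   \d_(t, j) (levelset x m i))%E) (fun m => (m0 <= m)%N) m) => // k _.
by apply: nneseries_ge0 => n _ _; exact: qterm_ge0.
Qed.

End blocks.

Section block_path.
Context {R : realType}.
Variables (y0 kap del : R).
Hypotheses (y00 : 0 < y0) (kap0 : 0 < kap) (del0 : 0 < del).
Variables (f : R -> R) (tau jmp : nat -> R).
Hypothesis pj : pure_jump f tau jmp.
Local Notation bt := (btime kap del).
Hypothesis block_jump : forall m, exists2 k, bt m < tau k <= bt m.+1 & y0 <= jmp k.

(** Each block contains a jump of size at least y0. *)
Lemma block_growth_at m : y0 * m%:R <= f (bt m).
Proof.
elim: m => [|m IH]; first by rewrite mulr0 btime0 (pure_jump0 pj).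
have [k /andP[mk km] yj] := block_jump m.
have := jump_le pj (btime_ge0 kap0 del0 m) mk.
have := pure_jump_nd pj (ltW (pj_tau_gt0 pj k)) km.
by rewrite -natr1; lra.
Qed.

Lemma gap_block m k : bt m < tau k ->
  gap f tau jmp k <= expR (- (y0 * m%:R)) * Num.min 1 (jmp k).
Proof.
move=> mk; apply: le_trans (gap_le pj (btime_ge0 kap0 del0 m) mk) _.
rewrite ler_wpM2r//; last by rewrite ler_expR lerN2 block_growth_at.
by rewrite le_min ler01 ltW// (pj_jmp_gt0 pj).
Qed.

Lemma gap_le_qweight x k : 0 < x ->
  ((Num.min 1 (gap f tau jmp k / x))%:E <= qweight y0 kap del 0 x (tau k, jmp k))%E.
Proof.
move=> x0; have [m mk] := block_of kap0 del0 (pj_tau_gt0 pj k).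
apply: (@qweight_lower _ _ _ _ y00 0 m) => //; first exact: gap_gt0.
by apply: gap_block; case/andP: mk.
Qed.

Lemma late_gap_qweight m0 x k : 0 < x -> bt m0 < tau k -> x <= gap f tau jmp k ->
  (1 <= qweight y0 kap del m0 x (tau k, jmp k))%E.
Proof.
move=> x0 m0k xg; have [m mk] := block_of kap0 del0 (pj_tau_gt0 pj k).
have m0m : (m0 <= m)%N.
  rewrite leqNgt; apply/negP => mm0; case/andP: mk => _; apply/negP; rewrite -ltNge.
  by apply: le_lt_trans m0k; exact: btime_nd.
have := @qweight_lower _ _ kap del y00 m0 m x (tau k) (jmp k) (gap f tau jmp k) x0 m0m mk.
move=> /(_ (gap_gt0 pj k)); rewrite (_ : Num.min 1 (gap _ _ _ _ / x) = 1).
  by apply; apply: gap_block; case/andP: mk.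
by apply/min_idPl; rewrite ler_pdivlMr// mul1r.
Qed.

End block_path.

(** * Expected weights and the growth of paths *)

Section probability_tools.
Context {R : realType} {d : measure_display} {T : measurableType d}.
Variable P : probability T R.

Lemma markov_le (X : T -> \bar R) (m c : R) :
  measurable_fun [set: T] X -> (forall w, (0 <= X w)%E) ->
  (\int[P]_w X w <= m%:E)%E -> 0 < c ->
  (P [set w | (c%:E <= X w)%E] <= (m / c)%:E)%E.
Proof.
move=> mX X0 Xm c0.
have := @le_integral_abse _ _ _ P setT measurableT X c mX c0.
rewrite setTI => H.
have : (c%:E * P [set x | (c%:E <= `|X x|)%E] <= m%:E)%E.
  apply: le_trans H (le_trans _ Xm); rewrite le_eqVlt; apply/orP; left; apply/eqP.
  by apply: eq_integral => w _; rewrite gee0_abs.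
rewrite (_ : [set x | (c%:E <= `|X x|)%E] = [set w | (c%:E <= X w)%E]); last first.
  by apply/funext => w /=; rewrite gee0_abs.
move=> H2; rewrite -(@lee_pmul2l _ c%:E)// -[leRHS]EFinM mulrC.
by rewrite divfK// gt_eqF.
Qed.

Lemma measurable_ge (X : T -> \bar R) (c : R) : measurable_fun [set: T] X ->
  measurable [set w | (c%:E <= X w)%E].
Proof.
by move=> mX; rewrite -[X in measurable X]setTI; exact: emeasurable_fun_c_infty.
Qed.

End probability_tools.

Section jump_functionals.
Context {R : realType} {d : measure_display} {T : measurableType d}.
Variables (P : probability T R) (nu : {sigma_finite_measure set R -> \bar R}).
Variables (tau jmp : nat -> {RV P >-> R}).
Hypothesis nu_levy : levy_measure nu.
Hypothesis ppp : poisson_point_process nu tau jmp.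
Local Notation a := (tail nu).

Section weight.
Variables (y0 kap del : R).
Hypotheses (y00 : 0 < y0) (kap0 : 0 < kap) (del0 : 0 < del).
Local Notation bt := (btime kap del).
Local Notation lset := (levelset y0 kap del).

Definition Qsum m0 x w : \bar R :=
  (\sum_(0 <= k <oo) qweight y0 kap del m0 x (tau k w, jmp k w))%E.

Lemma Qsum_ge0 m0 x w : (0 <= Qsum m0 x w)%E.
Proof. by apply: nneseries_ge0 => k _ _; exact: qweight_ge0. Qed.

Lemma measurable_levelset x m i : measurable (lset x m i).
Proof. by rewrite /levelset; case: ifP => // _; exact: measurable_strip. Qed.

Lemma QsumE m0 x w : (Qsum m0 x w = \sum_(0 <= m <oo) \sum_(0 <= i <oo)
  if (m0 <= m)%N then (expR (y0 * (1 - i%:R)))%:E * point_count tau jmp (lset x m i) w else 0)%E.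
Proof.
rewrite /Qsum /qweight.
transitivity (\sum_(0 <= m <oo | (m0 <= m)%N) \sum_(0 <= k <oo) \sum_(0 <= i <oo)
    ((expR (y0 * (1 - i%:R)))%:E * \d_(tau k w, jmp k w) (lset x m i)))%E.
  apply: (@nneseries_interchange R (fun k m => \sum_(0 <= i <oo)
    ((expR (y0 * (1 - i%:R)))%:E * \d_(tau k w, jmp k w) (lset x m i)))%E
    xpredT (fun m => (m0 <= m)%N)).
  by move=> k m; apply: nneseries_ge0 => i _ _; exact: qterm_ge0.
rewrite eseries_mkcond; apply: eq_eseriesr => m _.
case: ifP => _; last by rewrite eseries0.
rewrite (@nneseries_interchange R (fun k i => (expR (y0 * (1 - i%:R)))%:E *
   \d_(tau k w, jmp k w) (lset x m i))%E xpredT xpredT); last first.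
  by move=> k i; exact: qterm_ge0.
apply: eq_eseriesr => i _; exact: nneseriesZl.
Qed.

Let term m0 x m i w : \bar R := if (m0 <= m)%N then
  ((expR (y0 * (1 - i%:R)))%:E * point_count tau jmp (lset x m i) w)%E else 0%E.

Let term_ge0 m0 x m i w : (0 <= term m0 x m i w)%E.
Proof.
rewrite /term; case: ifP => // _.
by rewrite mule_ge0// ?lee_fin ?expR_ge0// point_count_ge0.
Qed.

Let mterm m0 x m i : measurable_fun [set: T] (term m0 x m i).
Proof.
rewrite /term; case: (m0 <= m)%N => //; apply: emeasurable_funM => //.
apply: measurable_point_count; exact: measurable_levelset.
Qed.

Lemma measurable_Qsum m0 x : measurable_fun [set: T] (Qsum m0 x).
Proof.
rewrite (_ : Qsum m0 x = fun w => (\sum_(0 <= m <oo) \sum_(0 <= i <oo) term m0 x m i w)%E).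
  apply: measurable_nneseries => [m w|m]; first exact: nneseries_ge0.
  by apply: measurable_nneseries.
by apply/funext => w; rewrite QsumE.
Qed.

Lemma integral_term m0 x m i : 0 < x ->
  (\int[P]_w term m0 x m i w = if (m0 <= m)%N && (level y0 x m i <= 1)%R then
    (expR (y0 * (1 - i%:R)) * (blen kap del m * a (level y0 x m i)))%:E else 0)%E.
Proof.
move=> x0; rewrite /term; case: (leqP m0 m) => /= _; last by rewrite integral0.
rewrite ge0_integralZl//; last 2 first.
- by apply: measurable_point_count; exact: measurable_levelset.
- by move=> w _; exact: point_count_ge0.
rewrite /levelset; case: ifP => _.
  rewrite (strip_expectation nu_levy ppp) ?btime_ge0//; last 2 first.
  - exact: btime_nd.
  - by rewrite mulr_gt0 ?expR_gt0.
  by rewrite btimeS addrAC subrr add0r EFinM.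
rewrite (_ : (\int[P]_w _)%E = 0%E) ?mule0//.
rewrite -[RHS](@integral0 _ _ _ P setT); apply: eq_integral => w _.
by apply: eseries0 => k _ _; rewrite diracE in_set0.
Qed.

(** By the Potter bounds the term (m, i) is at most a constant times
    a x * exp (- del * m) * exp (- y0 * (1 - be) * i) with be < 1: the exponent
    al / 2 = al' wins over the block lengths, because y0 * al' = 2 * del, and the
    exponent be wins over the weights exp (y0 * (1 - i)).  Both series are
    geometric. *)
Lemma Qsum_expectation al : 0 < al < 1 -> del = y0 * al / 4 -> regvar a al ->
  exists2 C, 0 < C & \forall x \near 0^'+, forall m0,
    (\int[P]_w Qsum m0 x w <= (C * a x * expR (- del * m0%:R))%:E)%E.
Proof.
move=> /andP[al0 al1] delE rv.
pose al' := al / 2; pose be := (1 + al) / 2.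
have [||| C C0 HC] := @potter _ _ _ rv al' be; rewrite /al' /be; [lra|lra|lra|].
pose rho := expR (- del); pose sig := expR (- (y0 * (1 - be))).
have yb : 0 < y0 * (1 - be) by rewrite mulr_gt0// /be; lra.
have rho01 : 0 < rho < 1 by rewrite expR_gt0 -expR0 ltr_expR oppr_lt0.
have sig01 : 0 < sig < 1 by rewrite expR_gt0 -expR0 ltr_expR oppr_lt0.
have r1 : 0 < 1 - rho by lra.
have s1 : 0 < 1 - sig by lra.
pose K := 2 * C * kap * expR y0.
have K0 : 0 < K by rewrite !mulr_gt0// expR_gt0.
exists (K / (1 - rho) / (1 - sig)); first by rewrite !divr_gt0.
near=> x => m0.
have x0 : 0 < x by near: x; exact: nbhs_right_gt.
have pot : forall z, expR z * x <= 1 ->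
    a (expR z * x) <= C * a x * (expR (- al' * z) + expR (- be * z)) by near: x.
have ax0 : 0 <= a x by exact: (rv_ge0 rv).
have tb m i : (\int[P]_w term m0 x m i w <=
    if (m0 <= m)%N then (K * a x * rho ^+ m * sig ^+ i)%:E else 0)%E.
  rewrite integral_term//; case: (leqP m0 m) => //= _; case: ifPn => [l1|_]; last first.
    by rewrite lee_fin !mulr_ge0// ?exprn_ge0 ?expR_ge0// ltW.
  rewrite lee_fin /level; rewrite /level in l1.
  have := pot _ l1; set z := y0 * (m%:R - i%:R) => az.
  rewrite /blen; set ci := expR (y0 * (1 - i%:R)).
  apply: (@le_trans _ _ (ci * (kap * expR (del * m%:R) *
     (C * a x * (expR (- al' * z) + expR (- be * z)))))).
    by rewrite ler_pM2l ?expR_gt0// ler_pM2l// mulr_gt0// expR_gt0.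
  have rs : rho ^+ m * sig ^+ i = expR (- del * m%:R - y0 * (1 - be) * i%:R).
    rewrite /rho /sig -!expRM_natl -expRD; congr expR; ring.
  have i0 : 0 <= y0 * i%:R by rewrite mulr_ge0// ltW.
  have m00 : 0 <= y0 * m%:R by rewrite mulr_ge0// ltW.
  have bound q : al' <= q <= be -> ci * expR (del * m%:R) * expR (- q * z) <=
      expR y0 * expR (- del * m%:R - y0 * (1 - be) * i%:R).
    move=> /andP[q1 q2]; rewrite /ci -!expRD ler_expR /z delE.
    have : 0 <= (q - al') * (y0 * m%:R) by rewrite mulr_ge0//; lra.
    have : 0 <= (be - q) * (y0 * i%:R) by rewrite mulr_ge0//; lra.
    by rewrite /al'; lra.
  have b1 : ci * expR (del * m%:R) * expR (- al' * z) <=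
      expR y0 * expR (- del * m%:R - y0 * (1 - be) * i%:R).
    by apply: bound; rewrite /al' /be; lra.
  have b2 : ci * expR (del * m%:R) * expR (- be * z) <=
      expR y0 * expR (- del * m%:R - y0 * (1 - be) * i%:R).
    by apply: bound; rewrite /al' /be; lra.
  have -> : ci * (kap * expR (del * m%:R) *
     (C * a x * (expR (- al' * z) + expR (- be * z)))) =
     (kap * C * a x) * (ci * expR (del * m%:R) * expR (- al' * z) +
       ci * expR (del * m%:R) * expR (- be * z)) by ring.
  have -> : K * a x * rho ^+ m * sig ^+ i = K * a x * (rho ^+ m * sig ^+ i) by ring.
  rewrite rs.
  rewrite /K; set E := expR (- del * m%:R - _) in b1 b2 *.
  have kc : 0 <= kap * C * a x by rewrite !mulr_ge0// ltW.
  have := ler_wpM2l kc (lerD b1 b2); lra.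
rewrite (eq_integral (fun w => \sum_(0 <= m <oo) \sum_(0 <= i <oo) term m0 x m i w)%E); last first.
  by move=> w _; rewrite QsumE.
rewrite integral_nneseries//; last 2 first.
- by move=> m; apply: measurable_nneseries.
- by move=> m w _; exact: nneseries_ge0.
apply: nneseries_le_bound => [m _|n].
  by apply: integral_ge0 => w _; exact: nneseries_ge0.
apply: (@le_trans _ _ (\sum_(0 <= m < n | (m0 <= m)%N)
    (K * a x / (1 - sig) * rho ^+ m)%:E)%E).
  rewrite [leRHS]big_mkcond/=; apply: lee_sum => m _.
  rewrite integral_nneseries//.
  apply: nneseries_le_bound => [i _|n']; first exact: integral_ge0.
  apply: le_trans (lee_sum _ (fun i _ => tb m i)) _.
  case: ifP => _; last by rewrite big1.
  rewrite sumEFin lee_fin -mulr_sumr.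
  have -> : K * a x / (1 - sig) * rho ^+ m = K * a x * rho ^+ m * (sig ^+ 0 / (1 - sig)).
    by rewrite expr0; ring.
  rewrite ler_wpM2l//; first by rewrite !mulr_ge0// ?exprn_ge0 ?expR_ge0// ltW.
  exact: (@geometric_partial_sum_le _ sig 0 n' sig01).
rewrite sumEFin lee_fin -mulr_sumr.
have -> : K / (1 - rho) / (1 - sig) * a x * expR (- del * m0%:R) =
  K * a x / (1 - sig) * (rho ^+ m0 / (1 - rho)).
  rewrite /rho -expRM_natl [m0%:R * _]mulrC; ring.
rewrite ler_wpM2l//; last exact: geometric_partial_sum_le.
by rewrite !mulr_ge0// ?invr_ge0 ltW.
Unshelve. all: end_near. Qed.

End weight.

(** The block m contains no jump of size y0 with probability
    exp (- kap * a y0 * exp (del * m)) <= r ^ m.+1 for the right kap, and these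
    probabilities sum up to at most eta. *)
Lemma block_event y0 del eta : 0 < y0 -> 0 < a y0 -> 0 < del <= 1 -> 0 < eta ->
  exists2 kap, 0 < kap & exists B, [/\ measurable B, (P B <= eta%:E)%E &
   forall w, ~ B w -> forall m, exists2 k,
     btime kap del m < tau k w <= btime kap del m.+1 & y0 <= jmp k w].
Proof.
move=> y00 ay0 /andP[del0 del1] eta0.
pose r := Num.min (2^-1) (eta / 2).
have r0 : 0 < r by rewrite lt_min invr_gt0 ltr0n divr_gt0.
have r12 : r <= 2^-1 by rewrite ge_min lexx.
have reta : r <= eta / 2 by rewrite ge_min lexx orbT.
pose kap := - ln r / (a y0 * del).
have lnr : ln r < 0 by rewrite ln_lt0// r0 (le_lt_trans r12)// invf_lt1// ltr1n.
have kap0 : 0 < kap by rewrite divr_gt0 ?mulr_gt0// oppr_gt0.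
exists kap => //.
pose A m := [set w | point_count tau jmp
   (strip (btime kap del m) (btime kap del m.+1) y0) w = 0%:R%:E].
have mA m : measurable (A m).
  rewrite -[X in measurable X]setTI.
  exact: (measurable_point_count tau jmp (measurable_strip _ _ _) measurableT (emeasurable_set1 _)).
exists (\bigcup_m A m); split; first exact: bigcup_measurable.
  apply: le_trans (generalized_Boole_inequality _ mA _) _; first exact: bigcup_measurable.
  apply: nneseries_le_bound => // n.
  apply: (@le_trans _ _ (\sum_(0 <= m < n) (r * r ^+ m)%:E)%E).
    apply: lee_sum => m _; apply: (@le_trans _ _ (pois ((btime kap del m.+1 - btime kap del m) * a y0) 0)%:E).
      rewrite le_eqVlt; apply/orP; left; apply/eqP.
      by apply: (strip_poisson nu_levy ppp) => //; [exact: btime_ge0|exact: btime_nd].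
    rewrite /pois expr0 fact0 divr1 mulr1 btimeS addrAC subrr add0r lee_fin.
    rewrite -exprS -[in leRHS](lnK (x := r)) ?posrE// -expRM_natl ler_expR.
    rewrite lerNl -mulrN.
    have -> : - ln r = kap * (a y0 * del) by rewrite /kap divfK// mulf_neq0// gt_eqF.
    have -> : blen kap del m * a y0 = kap * a y0 * expR (del * m%:R) by rewrite /blen; ring.
    have -> : m.+1%:R * (kap * (a y0 * del)) = kap * a y0 * (del * m.+1%:R) by ring.
    have kay : 0 < kap * a y0 by exact: mulr_gt0.
    rewrite ler_pM2l//; have := expR_ge1Dx (del * m%:R).
    by rewrite -natr1; lra.
  rewrite sumEFin lee_fin -mulr_sumr.
  have r01 : 0 < r < 1 by rewrite r0 (le_lt_trans r12)// invf_lt1// ltr1n.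
  have := @geometric_partial_sum_le _ r 0 n r01; rewrite expr0.
  move=> /(ler_wpM2l (ltW r0)) /le_trans; apply.
  have i2 : 2^-1 <= 1 - r :> R by lra.
  rewrite mul1r ler_pdivrMr; last by lra.
  nra.
move=> w nB m; have : point_count tau jmp
   (strip (btime kap del m) (btime kap del m.+1) y0) w != 0%E.
  by apply/eqP => E0; apply: nB; exists m.
move=> /point_count_neq0[k [/=]]; rewrite !in_itv/= andbT => mk yk.
by exists k.
Qed.

End jump_functionals.

(** * Large gaps along a path *)

Section exponential_integral.
Context {R : realType}.
Variables (f : R -> R) (al : R).
Hypothesis al0 : 0 < al.
Hypothesis fnd : forall s t, 0 <= s -> s <= t -> f s <= f t.

Local Notation ef := (fun t => (expR (- al * f t))%:E).
Local Notation leb := (@lebesgue_measure R).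

Lemma measurable_exp_path (D : set R) : measurable D -> D `<=` `[0, +oo[ ->
  measurable_fun D (ef : R -> \bar R).
Proof.
move=> mD D0; apply/measurable_EFinP.
have H : measurable_fun D (fun t : R => expR (- al * f (Num.max t 0))).
  apply: measurableT_comp => //; apply: measurable_funM => //.
  apply: nondecreasing_measurable => // s t st.
  by apply: fnd; [rewrite le_max lexx orbT|rewrite ge_max !le_max st lexx !orbT].
apply: eq_measurable_fun H => t; rewrite inE => /D0 /=.
by rewrite in_itv/= andbT => /max_idPl ->.
Qed.

Lemma exp_integral_bounds s t : 0 <= s -> s <= t ->
  (((t - s) * expR (- al * f t))%:E <= \int[leb]_(u in `]s, t]) ef u)%E /\
  (\int[leb]_(u in `]s, t]) ef u <= ((t - s) * expR (- al * f s))%:E)%E.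
Proof.
move=> s0 st.
have mst : measurable_fun `]s, t]%classic (ef : R -> \bar R).
  apply: measurable_exp_path => // u /=; rewrite !in_itv/= andbT => /andP[su _].
  by rewrite (le_trans s0 (ltW su)).
have lst : leb `]s, t]%classic = (t - s)%:E.
  rewrite lebesgue_measure_itv/= lte_fin; case: ltP => [_|ts]; first by rewrite EFinB.
  by congr _%:E; lra.
split; rewrite mulrC EFinM -lst -integral_cst//.
  apply: ge0_le_integral => //.
  - by move=> u _; rewrite lee_fin expR_ge0.
  - move=> u /=; rewrite in_itv/= => /andP[su ut]; rewrite lee_fin ler_expR !mulNr lerN2.
    by rewrite ler_pM2l// fnd// (le_trans s0 (ltW su)).
apply: ge0_le_integral => //.
move=> u /=; rewrite in_itv/= => /andP[su ut]; rewrite lee_fin ler_expR !mulNr lerN2.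
by rewrite ler_pM2l// fnd// ltW.
Qed.

Lemma exp_integral_grid (t : nat -> R) n : 0 <= t 0%N -> (forall i, t i <= t i.+1) ->
  (\int[leb]_(u in `]t 0%N, t n]) ef u =
   \sum_(0 <= i < n) \int[leb]_(u in `]t i, t i.+1]) ef u)%E.
Proof.
move=> t00 tS.
have tnd i j : (i <= j)%N -> t i <= t j.
  by move=> /subnKC <-; elim: (j - i)%N => [|k IH]; rewrite ?addn0// addnS (le_trans IH).
elim: n => [|n IH]; first by rewrite big_geq// set_itvoc0 integral_set0.
rewrite big_nat_recr//= -IH.
have -> : `]t 0%N, t n.+1]%classic = `]t 0%N, t n]%classic `|` `]t n, t n.+1]%classic.
  apply/seteqP; split => u /=; rewrite !in_itv/=.
    by move=> /andP[-> ->]; case: (leP u (t n)) => h; [left|right].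
  by move=> [/andP[-> h]|/andP[h ->]]; rewrite ?(le_trans h)// ?(le_lt_trans _ h)//= tnd.
rewrite ge0_integral_setU//.
- apply: measurable_exp_path; first exact: measurableU.
  by move=> u /= []; rewrite !in_itv/= andbT => /andP[h _]; rewrite ltW// (le_lt_trans _ h)//
    (le_trans t00)// tnd.
- apply/disj_setPS => u /= []; rewrite !in_itv/= => /andP[_ h1] /andP[h2 _].
  by have := le_lt_trans h1 h2; rewrite ltxx.
Qed.

Lemma exp_integral_split T : 0 <= T ->
  (\int[leb]_(u in `[0%R, +oo[) ef u =
   \int[leb]_(u in `]0%R, T]) ef u + \int[leb]_(u in `]T, +oo[) ef u)%E.
Proof.
move=> T0.
rewrite -integral_itv_obnd_cbnd; last first.
  apply: measurable_exp_path => // u /=; rewrite !in_itv/= !andbT; exact: ltW.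
have -> : `]0, +oo[%classic = `]0, T]%classic `|` `]T, +oo[%classic.
  apply/seteqP; split => u /=; rewrite !in_itv/= !andbT.
    by move=> ->; case: (leP u T) => h; [left|right].
  by move=> [/andP[-> h]//|]; exact: le_lt_trans.
rewrite ge0_integral_setU//.
- apply: measurable_exp_path; first exact: measurableU.
  move=> u /= []; rewrite !in_itv/= !andbT; first by case/andP => /ltW.
  by move=> /(le_lt_trans T0)/ltW.
- apply/disj_setPS => u /= []; rewrite !in_itv/= andbT => /andP[_ h1] h2.
  by have := le_lt_trans h1 h2; rewrite ltxx.
Qed.

Variables (y0 kap del : R).
Hypotheses (kap0 : 0 < kap) (del0 : 0 < del) (delE : del = y0 * al / 4).
Local Notation bt := (btime kap del).
Hypothesis growth : forall m, y0 * m%:R <= f (bt m).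

(** On block m the integrand is at most exp (- 4 * del * m), since
    y0 * al = 4 * del, while the block has length kap * exp (del * m). *)
Lemma exp_integral_tail m0 :
  (\int[leb]_(u in `]bt m0, +oo[) ef u <=
    (kap / (1 - expR (- del)) * expR (- del * m0%:R))%:E)%E.
Proof.
pose rho := expR (- del).
have rho01 : 0 < rho < 1 by rewrite expR_gt0 -expR0 ltr_expR oppr_lt0.
pose F m := `]bt (m0 + m)%N, bt (m0 + m).+1]%classic.
have bt0 m : 0 <= bt m by exact: btime_ge0.
have btnd := btime_nd kap0 del0.
have UF : `]bt m0, +oo[%classic = \bigcup_m F m.
  apply/seteqP; split => u /=.
    rewrite in_itv/= andbT => mu; have u0 : 0 < u by apply: le_lt_trans mu.
    have [m /andP[mu1 mu2]] := block_of kap0 del0 u0.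
    have m0m : (m0 <= m)%N.
      rewrite leqNgt; apply/negP => mm0.
      by have := le_lt_trans (le_trans mu2 (btnd _ _ mm0)) mu; rewrite ltxx.
    by exists (m - m0)%N => //; rewrite /F /= subnKC// in_itv/= mu1.
  move=> [m _]; rewrite /F /= !in_itv/= andbT => /andP[h _].
  by apply: le_lt_trans h; rewrite btnd// leq_addr.
have tF : trivIset [set: nat] F.
  apply/trivIsetP => i j _ _; wlog ij : i j / (i < j)%N.
    move=> H; rewrite neq_lt => /orP[] ij; first by apply: H => //; rewrite lt_eqF.
    by rewrite setIC; apply: H => //; rewrite lt_eqF.
  move=> _; rewrite -subset0 /F => u /= []; rewrite !in_itv/= => /andP[_ h1] /andP[h2 _].
  have ij' : ((m0 + i).+1 <= m0 + j)%N by rewrite -addnS leq_add2l.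
  by have := le_lt_trans (le_trans h1 (btnd _ _ ij')) h2; rewrite ltxx.
rewrite UF ge0_integral_bigcup//; last first.
  apply: measurable_exp_path; first by rewrite -UF.
  by rewrite -UF => u /=; rewrite !in_itv/= !andbT => /(le_lt_trans (bt0 m0))/ltW.
  by move=> k; exact: measurable_itv.
apply: nneseries_le_bound => [m _|n].
  by apply: integral_ge0 => u _; rewrite lee_fin expR_ge0.
apply: (@le_trans _ _ (\sum_(0 <= m < n) (kap * rho ^+ m0 * rho ^+ m)%:E)%E).
  apply: lee_sum => m _.
  apply: le_trans (exp_integral_bounds (bt0 _) (btnd _ _ (leqnSn _))).2 _.
  rewrite lee_fin btimeS addrAC subrr add0r /blen -!mulrA ler_pM2l//.
  rewrite -exprD /rho -expRM_natl -expRD ler_expR.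
  have := growth (m0 + m); rewrite -(ler_pM2l al0) => h.
  have : 0 <= del * (m0 + m)%:R by rewrite mulr_ge0// ltW.
  rewrite delE in h *; lra.
rewrite sumEFin lee_fin -mulr_sumr.
have -> : kap / (1 - expR (- del)) * expR (- del * m0%:R) =
   kap * rho ^+ m0 * (rho ^+ 0 / (1 - rho)).
  rewrite /rho expr0 -expRM_natl [m0%:R * _]mulrC; ring.
rewrite ler_wpM2l//; first by rewrite mulr_ge0// ?exprn_ge0 ?expR_ge0// ltW.
exact: (@geometric_partial_sum_le _ rho 0 n rho01).
Qed.

End exponential_integral.

Section large_gaps_path.
Context {R : realType} {T : Type}.
Variables (y0 kap del : R).
Hypotheses (y00 : 0 < y0) (kap0 : 0 < kap) (del0 : 0 < del).
Variables (f : R -> R) (tau jmp : nat -> T -> R) (w : T).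
Hypothesis pj : pure_jump f (tau ^~ w) (jmp ^~ w).
Local Notation bt := (btime kap del).
Hypothesis block_jump : forall m, exists2 k, bt m < tau k w <= bt m.+1 & y0 <= jmp k w.
Local Notation gp := (gap f (tau ^~ w) (jmp ^~ w)).

Lemma grid_cell (h t : R) J : 0 < h -> 0 < t -> t <= J%:R * h ->
  exists2 i, (i < J)%N & i%:R * h < t <= i.+1%:R * h.
Proof.
move=> h0 t0 tJ.
case: J tJ => [|J] tJ; first by move: tJ; rewrite mul0r leNgt t0.
have ex : exists i, t <= i.+1%:R * h by exists J.
case: (ex_minnP ex) => i it imin; exists i; first by rewrite ltnS imin.
rewrite it andbT; case: i {it} imin => [|i] imin; first by rewrite mul0r t0.
by rewrite ltNge; apply/negP => /imin; rewrite ltnn.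
Qed.

Definition large_gaps x : \bar R := (\sum_(0 <= k <oo) (x <= gp k)%R%:R%:E)%E.

Definition slab (h : R) i y : set (R * R) := strip (i%:R * h) (i.+1%:R * h) y.

(** On a time step of the grid, a gap of size x forces a jump of size at least
    x * exp (f) with f at the left end of the step; after the horizon each large
    gap has weight at least 1. *)
Lemma large_gaps_upper x h J m0 : 0 < x -> 0 < h -> J%:R * h = bt m0 ->
  (large_gaps x <= \sum_(0 <= i < J)
      point_count tau jmp (slab h i (expR (f (i%:R * h)) * x)%R) w
    + \sum_(0 <= k <oo) qweight y0 kap del m0 x (tau k w, jmp k w))%E.
Proof.
move=> x0 h0 Jh; rewrite /point_count -nneseries_sum_nat; last first.
  by move=> i k; rewrite diracE lee_fin.
rewrite -nneseriesD; last 2 first.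
- by move=> k _ _; apply: sume_ge0 => i _; rewrite diracE lee_fin.
- by move=> k _ _; exact: qweight_ge0.
apply: lee_nneseries => k; first by rewrite lee_fin.
move=> _; case: (leP x (gp k)) => [xg|_]; last first.
  apply: adde_ge0; last exact: qweight_ge0.
  by apply: sume_ge0 => i _; rewrite diracE lee_fin.
have [tk|tk] := leP (tau k w) (bt m0).
  rewrite -Jh in tk; have [i iJ /andP[ik1 ik2]] := grid_cell h0 (pj_tau_gt0 pj k) tk.
  have sk : slab h i (expR (f (i%:R * h)) * x) (tau k w, jmp k w).
    split => /=; rewrite in_itv/= ?ik1 ?ik2// andbT.
    have ih0 : 0 <= i%:R * h by rewrite mulr_ge0// ltW.
    have := le_trans xg (gap_le pj ih0 ik1).
    rewrite expRN ler_pdivlMl ?expR_gt0// => /le_trans; apply.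
    by rewrite ge_min lexx orbT.
  apply: (@le_trans _ _ (\d_(tau k w, jmp k w)
     (slab h i (expR (f (i%:R * h)) * x)%R) : \bar R)).
    by rewrite diracE mem_set.
  apply: le_trans (leeDl _ (qweight_ge0 _ _ _ _ _ _)).
  rewrite (bigD1_seq i) ?mem_index_iota ?iota_uniq//= leeDl//.
  by apply: sume_ge0 => j _; rewrite diracE lee_fin.
apply: (@le_trans _ _ (qweight y0 kap del m0 x (tau k w, jmp k w))); last first.
  by rewrite leeDr//; apply: sume_ge0 => i _; rewrite diracE lee_fin.
exact: (late_gap_qweight y00 kap0 del0 pj block_jump).
Qed.

(** Conversely, a jump in step i has a gap of at least exp (- f) * (1 - exp (- j))
    with f at the right end of the step.  Only the steps selected by sel are
    counted, because concentration is available for finitely many levels y. *)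
Lemma large_gaps_lower x h J (sel : pred nat) (y : nat -> R) : 0 < h ->
  (forall i j, sel i -> y i <= j -> expR (f (i.+1%:R * h)) * x <= 1 - expR (- j)) ->
  (\sum_(0 <= i < J | sel i)
      point_count tau jmp (slab h i (y i)) w <= large_gaps x)%E.
Proof.
move=> h0 Hy; rewrite /point_count -nneseries_sum; last first.
  by move=> i k _; rewrite diracE lee_fin.
apply: lee_nneseries => k.
  by move=> _ _; apply: sume_ge0 => i _; rewrite diracE lee_fin.
move=> _.
pose A i := slab h i (y i).
have [[i /andP[si iJ] Ai]|nA] :=
    pselect (exists2 i, sel i && (i < J)%N & A i (tau k w, jmp k w)).
  rewrite big_mkcond (bigD1_seq i) ?mem_index_iota ?iota_uniq//= si big1 => [|j ji].
    rewrite adde0 diracE (mem_set Ai) lee_fin.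
    have [/= + +] := Ai; rewrite !in_itv/= andbT => /andP[_ ki] yj.
    suff -> : x <= gp k by [].
    apply: le_trans (gap_ge pj ki); have := Hy _ _ si yj.
    by rewrite -[in X in _ -> X](ler_pM2l (expR_gt0 (f (i.+1%:R * h))))
      [X in _ -> _ <= X]mulrA -expRD subrr expR0 mul1r.
  case: ifP => // _; rewrite diracE memNset// => -[/= + _]; have [/= + _] := Ai; rewrite !in_itv/=.
  move=> /andP[h1 h2] /andP[h3 h4].
  have := lt_le_trans h1 h4; have := lt_le_trans h3 h2.
  by rewrite !ltr_pM2r// !ltr_nat !ltnS => ji' ij'; move/negP: ji; apply; rewrite eqn_leq ji' ij'.
rewrite big1_seq ?lee_fin// => i; rewrite mem_index_iota => /andP[si iJ].
by rewrite diracE memNset// => Ai; apply: nA; exists i => //; rewrite si.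
Qed.

End large_gaps_path.

(** * Riemann sums over times and levels *)

Section exp_bounds.
Context {R : realType}.

Lemma expR_le1D2x (t : R) : 0 <= t -> t <= 1 / 2 -> expR t <= 1 + 2 * t.
Proof.
move=> t0 t1; have h := expR_ge1Dx (- t); rewrite expRN in h.
have t10 : 0 < 1 - t by lra.
have : expR t <= (1 - t)^-1.
  by rewrite -[leLHS]invrK lef_pV2 ?posrE ?invr_gt0 ?expR_gt0//; lra.
move/le_trans; apply; rewrite -[leLHS]mul1r ler_pdivrMr//; nra.
Qed.

(** A small j is close to 1 - exp (- j); the relative loss is one level of the
    grid of mesh e. *)
Lemma small_jump_gap (e u j : R) : 0 < e -> 0 < u -> u <= e / (1 + e) -> (1 + e) * u <= j ->
  u <= 1 - expR (- j).
Proof.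
move=> e0 u0 ue uj; have e1 : 0 < 1 + e by lra.
have v0 : 0 < (1 + e) * u by exact: mulr_gt0.
have : expR (- j) <= expR (- ((1 + e) * u)) by rewrite ler_expR lerN2.
suff : expR (- ((1 + e) * u)) <= 1 - u by lra.
have : expR (- ((1 + e) * u)) <= (1 + (1 + e) * u)^-1.
  by rewrite expRN lef_pV2 ?posrE ?expR_gt0//; [exact: expR_ge1Dx|lra].
move/le_trans; apply; rewrite -[leLHS]mul1r ler_pdivrMr; last by lra.
rewrite ler_pdivlMr// in ue; nra.
Qed.

End exp_bounds.

Section counts_monotone.
Context {R : realType} {T : Type}.
Variables (tau jmp : nat -> T -> R).

Lemma point_count_mono A B w : A `<=` B ->
  (point_count tau jmp A w <= point_count tau jmp B w)%E.
Proof.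
move=> AB; apply: lee_nneseries => k; first by rewrite diracE lee_fin.
move=> _; rewrite !diracE lee_fin ler_nat.
by case: (boolP (_ \in A)) => //; rewrite inE => /AB Bw; rewrite mem_set.
Qed.

Lemma slab_mono (h : R) i y y' : y <= y' -> slab h i y' `<=` slab h i y.
Proof.
move=> yy' [t j] [/= ht]; rewrite !in_itv/= !andbT => yj; split => //=.
by rewrite in_itv/= andbT (le_trans yy').
Qed.

End counts_monotone.

Section law_of_large_numbers_path.
Context {R : realType} {T : Type}.
Variables (al y0 kap del : R).
Hypotheses (al0 : 0 < al) (y00 : 0 < y0) (kap0 : 0 < kap) (del0 : 0 < del).
Hypothesis delE : del = y0 * al / 4.
Variables (S : R -> T -> R) (tau jmp : nat -> T -> R) (w : T).
Hypothesis pj : pure_jump (S ^~ w) (tau ^~ w) (jmp ^~ w).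
Local Notation bt := (btime kap del).
Hypothesis block_jump : forall m, exists2 k, bt m < tau k w <= bt m.+1 & y0 <= jmp k w.

(** A deterministic bound of the exponential functional on paths that have a
    jump of size y0 in every block. *)
Definition exp_functional_bound : R := kap / (1 - expR (- del)).

Let growth m : y0 * m%:R <= S (bt m) w.
Proof. exact: (block_growth_at kap0 del0 pj block_jump). Qed.

Let nd s t : 0 <= s -> s <= t -> S s w <= S t w.
Proof. exact: (pure_jump_nd pj). Qed.

Lemma exp_functional_riemann h J m0 : 0 < h -> J%:R * h = bt m0 ->
  exists I : R, [/\ exp_functional al S w = I%:E, 0 <= I, I <= exp_functional_bound,
    \sum_(0 <= i < J) h * expR (- al * S (i%:R * h) w) <= I + h &
    I - exp_functional_bound * expR (- del * m0%:R) - h <=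
      \sum_(0 <= i < J) h * expR (- al * S (i.+1%:R * h) w)].
Proof.
move=> h0 Jh; set K := exp_functional_bound.
have tail m := exp_integral_tail al0 nd kap0 del0 delE growth m.
have I0 : (0 <= exp_functional al S w)%E by apply: integral_ge0.
have IK : (exp_functional al S w <= K%:E)%E.
  have := tail 0%N; rewrite btime0 mulr0 expR0 mulr1 integral_itv_obnd_cbnd//.
  apply: measurable_exp_path => // u /=; rewrite !in_itv/= !andbT; exact: ltW.
have Ifin : exp_functional al S w \is a fin_num.
  by rewrite ge0_fin_numE// (le_lt_trans IK)// ltry.
have btm0 : 0 <= bt m0 by exact: btime_ge0.
have split := @exp_integral_split _ (S ^~ w) al nd (bt m0) btm0.
have It0 : (0 <= \int[@lebesgue_measure R]_(u in `]bt m0, +oo[) (expR (- al * S u w))%:E)%E.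
  by apply: integral_ge0.
have tg i : i%:R * h <= i.+1%:R * h by rewrite ler_pM2r// ler_nat.
have grid := @exp_integral_grid _ (S ^~ w) al nd (fun i => i%:R * h) J.
rewrite mul0r in grid; have {}grid := grid (lexx 0) tg.
have eb i := exp_integral_bounds al0 nd (mulr_ge0 (ler0n R i) (ltW h0)) (tg i).
have hE i : i.+1%:R * h - i%:R * h = h by rewrite -mulrBl -natr1 addrAC subrr add0r mul1r.
have lowI : ((\sum_(0 <= i < J) h * expR (- al * S (i.+1%:R * h) w))%R%:E <=
    \int[@lebesgue_measure R]_(u in `]0%R, bt m0]) (expR (- al * S u w))%:E)%E.
  rewrite -Jh grid -sumEFin; apply: lee_sum => i _.
  by have := (eb i).1; rewrite hE.
have upI : (\int[@lebesgue_measure R]_(u in `]0%R, bt m0]) (expR (- al * S u w))%:E <=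
    (\sum_(0 <= i < J) h * expR (- al * S (i%:R * h) w))%R%:E)%E.
  rewrite -Jh grid -sumEFin; apply: lee_sum => i _.
  by have := (eb i).2; rewrite hE.
have tele : \sum_(0 <= i < J) h * expR (- al * S (i%:R * h) w) <=
    \sum_(0 <= i < J) h * expR (- al * S (i.+1%:R * h) w) + h.
  rewrite -lerBlDl -sumrB.
  under eq_bigr do rewrite -mulrBr.
  rewrite -mulr_sumr.
  have -> : \sum_(0 <= i < J) (expR (- al * S (i%:R * h) w) - expR (- al * S (i.+1%:R * h) w)) =
     expR (- al * S (0%:R * h) w) - expR (- al * S (J%:R * h) w).
    elim: (J) => [|n IH]; first by rewrite big_geq// subrr.
    by rewrite big_nat_recr//= IH; ring.
  rewrite -[leRHS]mulr1 ler_pM2l// mul0r (pure_jump0 pj) mulr0 expR0.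
  by have := expR_ge0 (- al * S (J%:R * h) w); lra.
exists (fine (exp_functional al S w)).
have IE : exp_functional al S w = (fine (exp_functional al S w))%:E by rewrite fineK.
have low2 : ((\sum_(0 <= i < J) h * expR (- al * S (i.+1%:R * h) w))%R%:E <=
    exp_functional al S w)%E.
  apply: le_trans lowI _; rewrite /exp_functional split leeDl//.
have up2 : (exp_functional al S w <= (\sum_(0 <= i < J) h * expR (- al * S (i%:R * h) w))%R%:E
    + (K * expR (- del * m0%:R))%R%:E)%E.
  by rewrite /exp_functional split leeD//; exact: tail.
rewrite IE -EFinD lee_fin in up2; rewrite IE lee_fin in low2.
rewrite IE lee_fin in IK; rewrite IE lee_fin in I0.
split => //; lra.
Qed.

Variables (x A eps c1 h : R) (J L m0 : nat).
Hypotheses (x0 : 0 < x) (A0 : 0 <= A) (eps0 : 0 < eps) (h0 : 0 < h).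
Hypothesis Jh : J%:R * h = bt m0.
Hypothesis small : expR (eps * L%:R) * x <= eps / (1 + eps).
Hypothesis counts : forall i l, (i < J)%N -> (l <= L)%N ->
  ((A * (h * expR (- al * (eps * l%:R)) - c1))%:E <=
     point_count tau jmp (slab h i (expR (eps * l%:R) * x)%R) w)%E /\
  (point_count tau jmp (slab h i (expR (eps * l%:R) * x)%R) w <=
   (A * (h * expR (- al * (eps * l%:R)) + c1))%:E)%E.

Let S0 i : 0 <= S (i%:R * h) w.
Proof. by rewrite (pure_jump_ge0 pj)// mulr_ge0// ltW. Qed.

(** S at the left end of a step is rounded down to the level eps * l, which only
    lowers the threshold and costs a factor exp (al * eps).  Where S exceeds the
    last level eps * L the last level is used. *)
Lemma large_gaps_riemann_upper :
  (large_gaps (S ^~ w) tau jmp w x <=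
   (A * (expR (al * eps) * \sum_(0 <= i < J) h * expR (- al * S (i%:R * h) w)
     + bt m0 * expR (- al * (eps * L%:R)) + J%:R * c1))%:E
   + \sum_(0 <= k <oo) qweight y0 kap del m0 x (tau k w, jmp k w))%E.
Proof.
apply: le_trans (large_gaps_upper y00 kap0 del0 pj block_jump x0 h0 Jh) _.
rewrite leeD2r//.
apply: (@le_trans _ _ (\sum_(0 <= i < J) (A * (expR (al * eps) *
   (h * expR (- al * S (i%:R * h) w)) + h * expR (- al * (eps * L%:R)) + c1))%:E)%E).
  rewrite big_seq [leRHS]big_seq; apply: lee_sum => i; rewrite mem_index_iota /= => iJ.
  set s := S (i%:R * h) w; have s0 : 0 <= s by exact: S0.
  pose l := minn (Num.trunc (s / eps)) L.
  have lL : (l <= L)%N by rewrite geq_minr.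
  have /andP[k1 k2] := truncn_itv (divr_ge0 s0 (ltW eps0)).
  set k := Num.trunc (s / eps) in l lL k1 k2.
  rewrite ler_pdivlMr// in k1; rewrite ltr_pdivrMr// in k2.
  have ls : eps * l%:R <= s.
    by apply: le_trans k1; rewrite mulrC ler_pM2r// ler_nat geq_minl.
  apply: (@le_trans _ _ (point_count tau jmp (slab h i (expR (eps * l%:R) * x)%R) w)).
    apply: point_count_mono; apply: slab_mono.
    by rewrite ler_pM2r// ler_expR.
  apply: le_trans (counts iJ lL).2 _; rewrite lee_fin ler_wpM2l// lerD2r.
  rewrite [expR (al * eps) * _]mulrCA -mulrDr ler_pM2l// -expRD.
  rewrite /l /minn; case: ltnP => kL.
    apply: ler_wpDr; first exact: expR_ge0.
    rewrite ler_expR; have : al * s <= al * (k.+1%:R * eps) by rewrite ler_pM2l// ltW.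
    by rewrite -natr1; lra.
  by apply: ler_wpDl; first exact: expR_ge0.
rewrite sumEFin lee_fin -[X in X <= _]mulr_sumr ler_wpM2l// !big_split/= -[X in X + _ + _]mulr_sumr.
rewrite !sumr_const_nat !subn0 -Jh -[X in _ + X + _ <= _]mulr_natl.
by rewrite -[X in _ + X <= _]mulr_natl; lra.
Qed.

(** S at the right end of a step is rounded up; steps that would need a level
    above L are discarded, and their contribution to the Riemann sum is at most
    the subtracted term. *)
Lemma large_gaps_riemann_lower : 0 <= c1 ->
  ((A * (expR (- (2 * al * eps)) * \sum_(0 <= i < J) h * expR (- al * S (i.+1%:R * h) w)
     - bt m0 * expR (- al * (eps * (L - 2)%:R)) - J%:R * c1))%:E <=
   large_gaps (S ^~ w) tau jmp w x)%E.
Proof.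
move=> c10.
pose s i := S (i.+1%:R * h) w.
(* one step of eps rounds s i up, the other one pays for 1 - exp (- j) < j *)
pose l i := (Num.trunc (s i / eps)).+2.
pose sel i := (l i <= L)%N.
have s0 i : 0 <= s i by exact: S0.
have lb i : s i + eps <= eps * (l i)%:R <= s i + 2 * eps.
  have /andP[k1 k2] := truncn_itv (divr_ge0 (s0 i) (ltW eps0)).
  rewrite ler_pdivlMr// in k1; rewrite ltr_pdivrMr// in k2.
  by rewrite /l; move: k1 k2; rewrite -!natr1; lra.
apply: le_trans (@large_gaps_lower _ _ _ _ _ _ pj x h J sel
  (fun i => expR (eps * (l i)%:R) * x) h0 _); last first.
  move=> i j si yj; apply: (small_jump_gap eps0).
  - by rewrite mulr_gt0// expR_gt0.
  - apply: le_trans small; rewrite ler_pM2r// ler_expR.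
    have /andP[h1 _] := lb i.
    apply: (@le_trans _ _ (eps * (l i)%:R)); last by rewrite ler_pM2l// ler_nat.
    by apply: le_trans h1; rewrite lerDl ltW.
  - apply: le_trans yj; rewrite mulrA ler_pM2r//.
    apply: (@le_trans _ _ (expR eps * expR (s i))).
      by rewrite ler_pM2r ?expR_gt0// expR_ge1Dx.
    by rewrite -expRD ler_expR; have /andP[h1 _] := lb i; lra.
rewrite [leRHS]big_mkcond /=.
apply: (@le_trans _ _ (\sum_(0 <= i < J) (A * (expR (- (2 * al * eps)) *
   (h * expR (- al * s i)) - h * expR (- al * (eps * (L - 2)%:R)) - c1))%:E)%E).
  rewrite sumEFin lee_fin -[X in _ <= X]mulr_sumr ler_wpM2l// !sumrB -[X in _ <= X - _ - _]mulr_sumr.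
  rewrite !sumr_const_nat !subn0 -Jh -[X in _ <= _ - X - _]mulr_natl.
  by rewrite -[X in _ <= _ - X]mulr_natl; lra.
rewrite big_seq [leRHS]big_seq; apply: lee_sum => i; rewrite mem_index_iota /= => iJ.
have E0 := expR_ge0 (- al * (eps * (L - 2)%:R)).
have /andP[l1 l2] := lb i.
case: ifPn => [si|]; last first.
  rewrite /sel -ltnNge => Ll; rewrite lee_fin.
  suff : expR (- (2 * al * eps)) * (h * expR (- al * s i)) <= h * expR (- al * (eps * (L - 2)%:R)).
    by move=> ?; rewrite mulr_ge0_le0//; lra.
  rewrite mulrCA ler_pM2l// -expRD ler_expR.
  have : eps * (L - 2)%:R <= eps * (Num.trunc (s i / eps))%:R.
    by rewrite ler_pM2l// ler_nat leq_subLR; exact: (ltnW Ll).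
  have /andP[k1 _] := truncn_itv (divr_ge0 (s0 i) (ltW eps0)).
  rewrite ler_pdivlMr// in k1 => hh.
  have : al * (eps * (L - 2)%:R) <= al * s i by rewrite ler_pM2l//; lra.
  have : 0 <= al * eps by rewrite mulr_ge0// ltW.
  by lra.
apply: le_trans (counts iJ si).1; rewrite lee_fin ler_wpM2l//.
have : expR (- (2 * al * eps)) * (h * expR (- al * s i)) <= h * expR (- al * (eps * (l i)%:R)).
  rewrite mulrCA ler_pM2l// -expRD ler_expR.
  have : al * (eps * (l i)%:R) <= al * (s i + 2 * eps) by rewrite ler_pM2l.
  by lra.
have : 0 <= h * expR (- al * (eps * (L - 2)%:R)) by rewrite mulr_ge0// ltW.
by lra.
Qed.

End law_of_large_numbers_path.

(** * The law of large numbers for large gaps *)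

Section finite_unions.
Context {R : realType} {d : measure_display} {T : measurableType d}.
Variable P : probability T R.

Lemma prob_bigsetU_le (F : nat -> set T) n (c : R) :
  (forall i, measurable (F i)) -> (forall i, (i < n)%N -> (P (F i) <= c%:E)%E) ->
  (P (\big[setU/set0]_(i < n) F i) <= (n%:R * c)%:E)%E.
Proof.
move=> mF Fc; apply: le_trans (Boole_inequality _ _) _ => [i _|]; first exact: mF.
apply: (@le_trans _ _ (\sum_(i < n) c%:E)%E).
  by apply: lee_sum => i _; exact: Fc.
by rewrite sumEFin lee_fin sumr_const card_ord mulr_natl.
Qed.

Lemma prob_setU_le (A B : set T) (c1 c2 : R) : measurable A -> measurable B ->
  (P A <= c1%:E)%E -> (P B <= c2%:E)%E -> (P (A `|` B) <= (c1 + c2)%:E)%E.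
Proof.
move=> mA mB Ac Bc; apply: le_trans (measureU2 _ mA mB) _.
by rewrite EFinD leeD.
Qed.

Lemma notin_bigsetU (F : nat -> set T) n w i :
  ~ (\big[setU/set0]_(i < n) F i) w -> (i < n)%N -> ~ F i w.
Proof. by move=> nF ni Fi; apply: nF; rewrite (bigD1 (Ordinal ni))//=; left. Qed.

End finite_unions.

Section riemann_errors.
Context {R : realType}.
Implicit Types I K Su r eps e h th : R.

Lemma count_near_mean (r lam a c m : R) :
  m * a - c / 2 * a <= lam -> lam <= m * a + c / 2 * a ->
  - (c / 2 * a) < r - lam -> r - lam < c / 2 * a ->
  a * (m - c) <= r /\ r <= a * (m + c).
Proof. by move=> *; split; lra. Qed.

Lemma riemann_error_lower I K Su r eps e th :
  0 < e -> 0 <= r -> r <= 1 -> 1 - 2 * eps <= r -> 2 * eps * (K + 1) <= e ->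
  0 <= I -> I <= K -> 0 <= Su -> I - e - e / 2 <= Su -> th <= e ->
  I - 5 * e <= r * Su - th - e.
Proof.
move=> e0 r0 r1 er eK I0 IK Su0 ISu the.
(* the rounding error is relative to Su, and harmless once Su exceeds I anyway *)
have [SK|/ltW KS] := leP Su (K + 1).
  have : (1 - r) * Su <= 2 * eps * (K + 1) by apply: ler_pM; lra.
  by lra.
have : r * (K + 1) <= r * Su by rewrite ler_wpM2l.
have : (1 - 2 * eps) * (K + 1) <= r * (K + 1) by rewrite ler_wpM2r//; lra.
by lra.
Qed.

Lemma riemann_error_upper I K r eps e h :
  0 <= eps -> eps <= 1 / 2 -> 0 <= I -> I <= K -> 0 <= h -> h <= e / 2 ->
  r <= 1 + 2 * eps -> 2 * eps * (K + 1) <= e ->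
  r * (I + h) + e + e + e <= I + 5 * e.
Proof.
move=> eps0 eps12 I0 IK h0 he re eK.
have : r * (I + h) <= (1 + 2 * eps) * (I + h) by rewrite ler_wpM2r// addr_ge0.
have : 2 * eps * (I + h) <= 2 * eps * (K + h) by rewrite ler_wpM2l//; lra.
have : 2 * eps * h <= h by rewrite ler_piMl//; lra.
by lra.
Qed.

End riemann_errors.

Section law_of_large_numbers.
Context {R : realType} {d : measure_display} {T : measurableType d}.
Variables (P : probability T R) (nu : {sigma_finite_measure set R -> \bar R}).
Variables (tau jmp : nat -> {RV P >-> R}) (S : R -> {RV P >-> R}).
Hypothesis nu_levy : levy_measure nu.
Hypothesis ppp : poisson_point_process nu tau jmp.
Local Notation a := (tail nu).
Variables (al y0 kap del : R).
Hypotheses (al01 : 0 < al < 1) (rv : regvar a al).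
Hypotheses (y00 : 0 < y0) (kap0 : 0 < kap) (del0 : 0 < del) (delE : del = y0 * al / 4).
Local Notation bt := (btime kap del).

(** Both properties hold with probability close to 1, simultaneously for all the
    small x. *)
Definition good_path w := pure_jump (S ^~ w) (tau ^~ w) (jmp ^~ w) /\
  forall m, exists2 k, bt m < tau k w <= bt m.+1 & y0 <= jmp k w.

(** Markov's inequality for the total weight of all the jumps, which dominates
    the number of hit cells. *)
Lemma range_cover_tight eta : 0 < eta ->
  exists2 M, 0 < M & \forall x \near 0^'+, exists B, [/\ measurable B, (P B <= eta%:E)%E &
    forall w, ~ B w -> good_path w -> forall n,
      ((\sum_(0 <= c < n.*2) hit (S ^~ w) x c)%:R <= M * a x :> R)].
Proof.
move=> eta0; have [C C0 HC] := Qsum_expectation nu_levy ppp y00 kap0 del0 al01 delE rv.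
have al0 : 0 < al by case/andP: al01.
exists (2 * C / eta + 2); first by rewrite addr_gt0// divr_gt0// mulr_gt0.
near=> x.
have x0 : 0 < x by near: x; exact: nbhs_right_gt.
have ax1 : 1 <= a x by near: x; exact: (regvar_cvg_pinfty rv al0).
have EQ : forall m0, (\int[P]_w Qsum tau jmp y0 kap del m0 x w <=
   (C * a x * expR (- del * m0%:R))%:E)%E by near: x.
have c0 : 0 < C * a x / eta by rewrite divr_gt0// mulr_gt0//; lra.
exists [set w | ((C * a x / eta)%:E <= Qsum tau jmp y0 kap del 0 x w)%E]; split.
- by apply: measurable_ge; exact: measurable_Qsum.
- apply: le_trans (markov_le (m := C * a x) _ _ _ c0) _.
  + exact: measurable_Qsum.
  + by move=> w; exact: Qsum_ge0.
  + by have := EQ 0%N; rewrite mulr0 expR0 mulr1.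
  + rewrite lee_fin le_eqVlt; apply/orP; left; apply/eqP; field.
    by rewrite !gt_eqF//; lra.
- move=> w /= /negP; rewrite -ltNge => Qw [pj blk] n.
  rewrite -lee_fin.
  apply: le_trans (cover_count (v := fun k => qweight y0 kap del 0 x (tau k w, jmp k w))
     pj n x0 _ _) _.
  + by move=> k; exact: qweight_ge0.
  + by move=> k; exact: (gap_le_qweight y00 kap0 del0 pj blk).
  + apply: (@le_trans _ _ (2%:E * (C * a x / eta)%:E + 2%:E)%E).
      by rewrite leeD2r// lee_pmul2l// ltW.
    rewrite -EFinM -EFinD lee_fin mulrDl; nra.
Unshelve. all: end_near. Qed.

(** All the meshes are fixed before x tends to 0; then a x -> oo, and the
    variances, of order a x, are negligible against (a x) ^ 2 for each of the
    finitely many strips. *)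
Lemma large_gaps_lln e eta : 0 < e -> 0 < eta ->
  \forall x \near 0^'+, exists B, [/\ measurable B, (P B <= eta%:E)%E &
    forall w, ~ B w -> good_path w -> forall I, exp_functional al S w = I%:E ->
      ((a x * (I - e))%:E <= large_gaps (S ^~ w) tau jmp w x)%E /\
      (large_gaps (S ^~ w) tau jmp w x <= (a x * (I + e))%:E)%E].
Proof.
move=> e0 eta0; have [C C0 HC] := Qsum_expectation nu_levy ppp y00 kap0 del0 al01 delE rv.
have [al0 al1] : 0 < al /\ al < 1 by apply/andP.
pose K := exp_functional_bound kap del.
have K0 : 0 < K.
  by rewrite /K /exp_functional_bound divr_gt0// subr_gt0 -expR0 ltr_expR oppr_lt0.
pose e1 := e / 5; have e10 : 0 < e1 by rewrite /e1; lra.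
have e5 : e = 5 * e1 by rewrite /e1; field.
(* beyond bt m0 both the integral and the expected number of large gaps are small *)
have [m0 [m00 m0K m0C]] : exists m0 : nat, [/\ (0 < m0)%N,
    K * expR (- del * m0%:R) <= e1 & C * expR (- del * m0%:R) <= e1 * (eta / 2)].
  have expsmall (c b : R) : 0 < c -> 0 < b -> exists N : nat, forall m : nat, (N <= m)%N ->
      c * expR (- del * m%:R) <= b.
    move=> c0 b0; exists (Num.trunc (c / b / del)).+1 => m Nm.
    have h1 : c / b / del <= m%:R.
      by apply: le_trans (ltW (truncnS_gt _)) _; rewrite ler_nat.
    rewrite ler_pdivrMr// in h1.
    rewrite mulNr expRN ler_pdivrMr ?expR_gt0// mulrC -ler_pdivrMr//.
    apply: le_trans h1 _; rewrite mulrC; have := expR_ge1Dx (del * m%:R); lra.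
  have [N1 H1] := expsmall K e1 K0 e10.
  have [N2 H2] := expsmall C (e1 * (eta / 2)) C0 (mulr_gt0 e10 (divr_gt0 eta0 (ltr0n _ 2))).
  exists (maxn 1 (maxn N1 N2)); split; first by rewrite leq_max.
    by apply: H1; rewrite !leq_max leqnn orbT.
  by apply: H2; rewrite !leq_max leqnn !orbT.
pose Th := bt m0.
have Th0 : 0 < Th.
  apply: lt_le_trans (btime_lower kap0 del0 m0).
  by rewrite mulr_gt0// ltr0n.
(* level mesh: rounding changes the sums by a factor 1 + O (eps) *)
pose eps := Num.min (1 / 2) (e1 / (2 * (K + 1))).
have eps0 : 0 < eps by rewrite lt_min divr_gt0//= divr_gt0// mulr_gt0//; lra.
have eps12 : eps <= 1 / 2 by rewrite ge_min lexx.
have epsK : 2 * eps * (K + 1) <= e1.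
  have : eps <= e1 / (2 * (K + 1)) by rewrite ge_min lexx orbT.
  by rewrite ler_pdivlMr; lra.
have aleps : 0 < al * eps by exact: mulr_gt0.
have aleps2 : al * eps <= eps by rewrite ler_piMl// ltW.
(* time mesh: upper and lower Riemann sums differ by at most h *)
pose J := (Num.trunc (Th / (e1 / 2))).+1.
pose h := Th / J%:R.
have J0 : (0 : R) < J%:R by rewrite ltr0n.
have h0 : 0 < h by exact: divr_gt0.
have he : h <= e1 / 2.
  rewrite /h ler_pdivrMr// mulrC -ler_pdivrMr; last by lra.
  by rewrite ltW// /J truncnS_gt.
have Jh : J%:R * h = bt m0 by rewrite /h mulrC divfK// gt_eqF.
(* steps where S exceeds eps * (L - 2) contribute at most e1 *)
pose L := (Num.trunc (Th / e1 / (al * eps))).+3.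
have LT : Th * expR (- al * (eps * (L - 2)%:R)) <= e1.
  have h1 : Th / e1 / (al * eps) <= (L - 2)%:R.
    by rewrite /L subSS subSS subn0 ltW// truncnS_gt.
  rewrite ler_pdivrMr// in h1.
  rewrite mulNr expRN ler_pdivrMr ?expR_gt0// mulrC -ler_pdivrMr//.
  apply: le_trans h1 _; have := expR_ge1Dx (al * (eps * (L - 2)%:R)); lra.
have LT2 : Th * expR (- al * (eps * L%:R)) <= e1.
  apply: le_trans LT; rewrite ler_pM2l// ler_expR !mulNr lerN2 ler_pM2l// ler_pM2l//.
  by rewrite ler_nat leq_subr.
pose c1 := e1 / J%:R.
have c10 : 0 < c1 by exact: divr_gt0.
have Jc1 : J%:R * c1 = e1 by rewrite /c1 mulrC divfK// gt_eqF.
pose z (l : nat) := eps * l%:R.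
have z0 l : 0 <= z l by rewrite mulr_ge0// ltW.
have lvl : \forall x \near 0^'+, forall l : 'I_L.+1,
   (expR (- al * z l) - c1 / (2 * h)) * a x <= a (expR (z l) * x) <=
   (expR (- al * z l) + c1 / (2 * h)) * a x.
  apply: filter_forall => l; apply: (regvar_bounds rv).
  have : 0 < c1 / (2 * h) by rewrite divr_gt0// mulr_gt0.
  by lra.
near=> x.
have x0 : 0 < x by near: x; exact: nbhs_right_gt.
have EQ : forall m0, (\int[P]_w Qsum tau jmp y0 kap del m0 x w <=
   (C * a x * expR (- del * m0%:R))%:E)%E by near: x.
have lx : forall l : 'I_L.+1,
   (expR (- al * z l) - c1 / (2 * h)) * a x <= a (expR (z l) * x) <=
   (expR (- al * z l) + c1 / (2 * h)) * a x by near: x.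
(* a x >= D makes each of the J * (L + 1) Chebyshev bounds at most an equal share
   of eta / 2 *)
pose D := 8 * h * J%:R * L.+1%:R / (c1 ^+ 2 * eta) + 1.
have axD : D <= a x by near: x; exact: (regvar_cvg_pinfty rv al0).
have D0 : 0 < D.
  by rewrite /D ltr_wpDl// divr_ge0// !mulr_ge0// ?exprn_ge0// ltW.
have ax0 : 0 < a x by exact: lt_le_trans axD.
have xL : expR (eps * L%:R) * x <= eps / (1 + eps).
  rewrite mulrC -ler_pdivlMr ?expR_gt0//; near: x; apply: nbhs_right_le.
  by rewrite !divr_gt0 ?expR_gt0//; lra.
pose lam l := h * a (expR (z l) * x).
pose F i l := [set w | ((c1 / 2 * a x)%:E <=
   `| point_count tau jmp (slab h i (expR (z l) * x)%R) w - (lam l)%:E |)%E].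
have hE i : i.+1%:R * h - i%:R * h = h by rewrite -mulrBl -natr1 addrAC subrr add0r mul1r.
have ih0 i : 0 <= i%:R * h by rewrite mulr_ge0// ltW.
have ihS i : i%:R * h <= i.+1%:R * h by rewrite ler_pM2r// ler_nat.
have dev0 : 0 < c1 / 2 * a x by rewrite mulr_gt0// divr_gt0.
have mF i l : measurable (F i l).
  apply: measurable_ge; apply: measurableT_comp => //; apply: emeasurable_funB => //.
  by apply: measurable_point_count; exact: measurable_strip.
have PF i l : (P (F i l) <= (eta / 2 / J%:R / L.+1%:R)%:E)%E.
  have := strip_chebyshev nu_levy ppp (ih0 i) (ihS i) (mulr_gt0 (expR_gt0 (z l)) x0) dev0.
  rewrite hE -/(lam l) => /le_trans; apply; rewrite lee_fin.
  have la : lam l <= h * a x.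
    rewrite ler_pM2l//; apply: (rv_ni rv) => //.
    by rewrite ler_peMl ?(ltW x0)// -expR0 ler_expR.
  rewrite ler_pdivrMr ?exprn_gt0//; apply: le_trans la _.
  have -> : eta / 2 / J%:R / L.+1%:R * (c1 / 2 * a x) ^+ 2 =
     (c1 ^+ 2 * eta / (8 * J%:R * L.+1%:R) * a x) * a x.
    by field; rewrite !gt_eqF// ltr0n.
  rewrite ler_pM2r//; apply: le_trans (ler_wpM2l _ axD); last first.
    by rewrite divr_ge0// mulr_ge0// ?exprn_ge0// ltW.
  have c0 : 0 <= c1 ^+ 2 * eta / (8 * J%:R * L.+1%:R).
    by rewrite divr_ge0// mulr_ge0// ?exprn_ge0// ltW.
  rewrite /D mulrDr mulr1 -[leLHS]addr0 lerD//.
  rewrite le_eqVlt; apply/orP; left; apply/eqP; field.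
  by rewrite !gt_eqF// ltr0n.
pose G i := \big[setU/set0]_(l < L.+1) F i l.
have mG i : measurable (G i) by exact: bigsetU_measurable.
have PG i : (P (G i) <= (eta / 2 / J%:R)%:E)%E.
  apply: le_trans (prob_bigsetU_le (mF i) (fun l _ => PF i l)) _.
  by rewrite lee_fin mulrC divfK// gt_eqF// ltr0n.
pose B1 := \big[setU/set0]_(i < J) G i.
pose B2 := [set w | ((e1 * a x)%:E <= Qsum tau jmp y0 kap del m0 x w)%E].
have mB1 : measurable B1 by exact: bigsetU_measurable.
have mB2 : measurable B2 by apply: measurable_ge; exact: measurable_Qsum.
have PB1 : (P B1 <= (eta / 2)%:E)%E.
  apply: le_trans (prob_bigsetU_le mG (fun i _ => PG i)) _.
  by rewrite lee_fin mulrC divfK// gt_eqF.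
have PB2 : (P B2 <= (eta / 2)%:E)%E.
  have c0 : 0 < e1 * a x by exact: mulr_gt0.
  apply: le_trans (markov_le (measurable_Qsum tau jmp y0 kap del m0 x)
    (fun w => Qsum_ge0 _ _ _ _ _ _ _ _) (EQ m0) c0) _.
  rewrite lee_fin ler_pdivrMr// [eta / 2 * _]mulrA mulrAC ler_pM2r//.
  by rewrite [_ * e1]mulrC.
exists (B1 `|` B2); split; first exact: measurableU.
  apply: le_trans (prob_setU_le mB1 mB2 PB1 PB2) _.
  by rewrite lee_fin -splitr.
move=> w /not_orP[nB1 /= /negP]; rewrite -ltNge => Qw [pj blk] I IE.
have counts i l : (i < J)%N -> (l <= L)%N ->
  ((a x * (h * expR (- al * (eps * l%:R)) - c1))%:E <=
     point_count tau jmp (slab h i (expR (eps * l%:R) * x)%R) w)%E /\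
  (point_count tau jmp (slab h i (expR (eps * l%:R) * x)%R) w <=
   (a x * (h * expR (- al * (eps * l%:R)) + c1))%:E)%E.
  move=> iJ lL; have := notin_bigsetU (notin_bigsetU nB1 iJ) (lL : (l < L.+1)%N).
  rewrite /F /= => /negP; rewrite -ltNge.
  rewrite -/(z l); have /andP[] := lx (Ordinal (lL : (l < L.+1)%N)); rewrite /= => l1 l2.
  have {}l1 : h * expR (- al * z l) * a x - c1 / 2 * a x <= lam l.
    rewrite /lam (le_trans _ (ler_wpM2l (ltW h0) l1))// le_eqVlt; apply/orP; left; apply/eqP.
    by field; rewrite gt_eqF.
  have {}l2 : lam l <= h * expR (- al * z l) * a x + c1 / 2 * a x.
    rewrite /lam (le_trans (ler_wpM2l (ltW h0) l2))// le_eqVlt; apply/orP; left; apply/eqP.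
    by field; rewrite gt_eqF.
  case: (point_count _ _ _ w) => [r| |] //=.
  rewrite !lte_fin ltr_norml => /andP[r1 r2]; rewrite !lee_fin.
  exact: (count_near_mean l1 l2 r1 r2).
have [I' [IE' I0 IK lowR upR]] := exp_functional_riemann (S := fun t => S t) (tau := fun k => tau k) (jmp := fun k => jmp k) al0 kap0 del0 delE pj blk h0 Jh.
have {IE'}II : I' = I by move: IE; rewrite IE' => -[].
rewrite {}II in I0 IK lowR upR.
have Kle : I <= K := IK.
have ea1 : expR (al * eps) <= 1 + 2 * eps.
  apply: le_trans (expR_le1D2x (ltW aleps) (le_trans aleps2 eps12)) _.
  by rewrite lerD2l ler_pM2l.
have ea2 : 1 - 2 * eps <= expR (- (2 * al * eps)).
  by apply: le_trans (expR_ge1Dx _); rewrite lerD2l lerN2 -mulrA ler_pM2l.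
split.
  apply: le_trans (large_gaps_riemann_lower (S := fun t => S t) (tau := fun k => tau k) (jmp := fun k => jmp k)
    al0 pj x0 (ltW ax0) eps0 h0 Jh xL counts (ltW c10)) => //.
  rewrite lee_fin ler_pM2l// Jc1 -/Th.
  set Su := \sum_(0 <= i < J) _ in upR *.
  have Su0 : 0 <= Su by apply: sumr_ge0 => i _; rewrite mulr_ge0// ?expR_ge0// ltW.
  have q0 := expR_ge0 (- (2 * al * eps)).
  have q1 : expR (- (2 * al * eps)) <= 1.
    by rewrite -expR0 ler_expR oppr_le0 !mulr_ge0// ltW.
  have SuI : I - e1 - e1 / 2 <= Su.
    by apply: le_trans upR; rewrite !lerB.
  rewrite e5; exact: (riemann_error_lower e10 q0 q1 ea2 epsK I0 Kle Su0 SuI LT).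
apply: le_trans (large_gaps_riemann_upper (S := fun t => S t) (tau := fun k => tau k) (jmp := fun k => jmp k) al0 y00 kap0 del0 pj blk x0 (ltW ax0) eps0 h0 Jh counts) _.
apply: (@le_trans _ _ ((a x * (expR (al * eps) * (I + h) + e1 + e1))%:E + (e1 * a x)%:E)%E).
  rewrite leeD//; last exact: ltW.
  rewrite lee_fin ler_pM2l// Jc1 -/Th !lerD// ler_wpM2l ?expR_ge0//.
rewrite -EFinD lee_fin [e1 * _]mulrC -mulrDr ler_pM2l//.
rewrite e5; exact: (riemann_error_upper (ltW eps0) eps12 I0 Kle (ltW h0) he ea1 epsK).
Unshelve. all: end_near. Qed.

End law_of_large_numbers.

(** * Balls in cells and in boxes *)

Lemma injective_count_le (A b : pred nat) (phi : nat -> nat) r Nc :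
  (forall k l, A k -> A l -> phi k = phi l -> k = l) ->
  (forall k, A k -> (phi k < Nc)%N /\ b (phi k)) ->
  (\sum_(0 <= k < r) A k <= \sum_(0 <= c < Nc) b c)%N.
Proof.
move=> inj Ab; rewrite -big_mkcond -[X in (_ <= X)%N]big_mkcond/= !sum1_count -!size_filter.
rewrite -(size_map phi); apply: uniq_leq_size.
  rewrite map_inj_in_uniq ?filter_uniq ?iota_uniq// => k l.
  by rewrite !mem_filter => /andP[Ak _] /andP[Al _]; exact: inj.
move=> c /mapP[k]; rewrite mem_filter => /andP[Ak _] ->.
by have [h1 h2] := Ab k Ak; rewrite mem_filter h2 mem_index_iota h1.
Qed.

Lemma offset_lt a c N : (c <= a)%N -> (a < c.+1 + (N - 2))%N -> (2 <= N)%N -> (a - c < N.-1)%N.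
Proof. lia. Qed.

Lemma predecessor_eq a c : (a < c.+2)%N -> (c < a)%N -> (a - 1)%N = c.
Proof. lia. Qed.

Section balls_in_boxes_path.
Context {R : realType}.
Variables (f : R -> R) (tau jmp : nat -> R) (e : nat -> R).
Hypothesis pj : pure_jump f tau jmp.
Local Notation gp := (gap f tau jmp).

Definition in_box k (y : R) : bool := f (tau k) - jmp k < y < f (tau k).

Definition in_cell (x : R) c (y : R) : bool := c%:R * x <= 1 - expR (- y) < c.+1%:R * x.

Definition box_load n k : nat := \sum_(0 <= j < n) in_box k (e j).
Definition cell_load (x : R) n c : nat := \sum_(0 <= j < n) in_cell x c (e j).

(** The cell of the right end of box k.  Boxes longer than a cell have distinct
    anchors, and anchors are hit cells: counts of boxes become counts of hit
    cells. *)
Definition anchor (x : R) k : nat := Num.trunc ((1 - expR (- f (tau k))) / x).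

Variables (x : R) (n N q Nc : nat) (p : nat -> R).
Hypotheses (x0 : 0 < x) (NcP : 1 <= Nc%:R * x).

Let U (y : R) := 1 - expR (- y).

Let U_lt y z : (U y < U z) = (y < z).
Proof. by rewrite /U ltrD2l ltrN2 ltr_expR ltrN2. Qed.

Let U_le y z : (U y <= U z) = (y <= z).
Proof. by rewrite /U lerD2l lerN2 ler_expR lerN2. Qed.

Let in_boxU k y : in_box k y = (U (f (tau k) - jmp k) < U y < U (f (tau k))).
Proof. by rewrite !U_lt. Qed.

Let gapU k : gp k = U (f (tau k)) - U (f (tau k) - jmp k).
Proof. by rewrite /gap /U; lra. Qed.

Let Uleft0 k : 0 <= U (f (tau k) - jmp k).
Proof. by rewrite subr_ge0 -expR0 ler_expR oppr_le0 (left_ge0 pj). Qed.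

Let Uright0 k : 0 <= U (f (tau k)).
Proof. by have := Uleft0 k; have := gap_gt0 pj k; rewrite gapU; lra. Qed.

Lemma anchorP k : (anchor x k)%:R * x <= U (f (tau k)) < (anchor x k).+1%:R * x.
Proof.
have /andP[h1 h2] := truncn_itv (divr_ge0 (Uright0 k) (ltW x0)).
by rewrite /anchor -ler_pdivlMr// h1 /= -ltr_pdivrMr.
Qed.

Lemma hit_anchor k : hit f x (anchor x k).
Proof.
apply/asboolP; exists (tau k); first by rewrite ltW// (pj_tau_gt0 pj).
exact: anchorP.
Qed.

Lemma anchor_lt k : (anchor x k < Nc)%N.
Proof.
have /andP[h _] := anchorP k.
have : (anchor x k)%:R * x < Nc%:R * x.
  by apply: le_lt_trans h (lt_le_trans _ NcP); rewrite /U gtrBl expR_gt0.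
by rewrite ltr_pM2r// ltr_nat.
Qed.

Lemma anchor_inj k l : x <= gp k -> x <= gp l -> anchor x k = anchor x l -> k = l.
Proof.
wlog kl : k l / tau k < tau l.
  move=> H xk xl a; have [kl|lk|/(pj_tau_inj pj)//] := ltgtP (tau k) (tau l).
    exact: H.
  by apply/esym; exact: H.
move=> _ xl a; exfalso.
have := jump_le pj (ltW (pj_tau_gt0 pj k)) kl; rewrite -U_le => h.
have /andP[k1 _] := anchorP k; have /andP[_ l2] := anchorP l.
by rewrite gapU in xl; rewrite -a -natr1 mulrDl mul1r in l2; lra.
Qed.

Lemma in_box_inj k l y : in_box k y -> in_box l y -> k = l.
Proof.
wlog kl : k l / tau k < tau l.
  move=> H yk yl; have [kl|lk|/(pj_tau_inj pj)//] := ltgtP (tau k) (tau l).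
    exact: H.
  by apply/esym; exact: H.
move=> /andP[_ y1] /andP[y2 _].
have h := jump_le pj (ltW (pj_tau_gt0 pj k)) kl.
by have := lt_le_trans (lt_trans y2 y1) h; rewrite ltxx.
Qed.

Lemma in_cell_inj c c' y : in_cell x c y -> in_cell x c' y -> c = c'.
Proof.
move=> /andP[c1 c2] /andP[c3 c4]; apply/eqP; rewrite eqn_leq.
have := le_lt_trans c1 c4; have := le_lt_trans c3 c2.
by rewrite !ltr_pM2r// !ltr_nat !ltnS => -> ->.
Qed.

Hypothesis nq : n%:R * x * N%:R = q%:R.
Hypothesis N2 : (2 <= N)%N.
Hypothesis q0 : (0 < q)%N.
Hypothesis px : forall c, p c <= x.
Hypothesis pfull : forall c, c.+1%:R * x <= 1 -> p c = x.

Definition bad_cell c : bool := n%:R * x / N%:R <= `|(cell_load x n c)%:R - n%:R * p c|.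

Let N0 : 0 < N%:R :> R.
Proof. by rewrite ltr0n; lia. Qed.

Let nx0 : 0 < n%:R * x.
Proof. by rewrite -(pmulr_lgt0 _ N0) nq ltr0n. Qed.

(** The box contains the N + 2 cells before its anchor, and if these are all good
    it holds at least (N + 2) * (q / N) * (1 - 1 / N) >= q balls; this is the
    inequality that needs N >= 2. *)
Lemma underfull_box k : N.+3%:R * x <= gp k -> (box_load n k < q)%N ->
  exists2 s, (s < N.+3)%N & bad_cell (anchor x k - s).
Proof.
move=> xk load; apply: contrapT => /forall2NP H.
have good s : (s < N.+3)%N -> ~~ bad_cell (anchor x k - s).
  by move=> sN; have [//|/negP] := H s.
have /andP[a1 a2] := anchorP k; set a := anchor x k in a1 a2 good.
have left_lt : U (f (tau k) - jmp k) < (a%:R - N.+2%:R) * x.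
  by rewrite gapU -[N.+3%:R]natr1 in xk; rewrite -[a.+1%:R]natr1 in a2; lra.
have aN : (N.+2 < a)%N.
  have := le_lt_trans (Uleft0 k) left_lt.
  by rewrite pmulr_lgt0// subr_gt0 ltr_nat.
have sub s y : (0 < s < N.+3)%N -> in_cell x (a - s) y -> in_box k y.
  move=> /andP[s0 sN] /andP[y1 y2].
  rewrite -/(U y) in y1 y2.
  rewrite in_boxU; apply/andP; split.
    apply: lt_le_trans left_lt (le_trans _ y1); rewrite ler_pM2r// natrB; last by lia.
    by rewrite lerD2l lerN2 ler_nat.
  apply: lt_le_trans y2 (le_trans _ a1); rewrite ler_pM2r// ler_nat; lia.
have big_load : (\sum_(1 <= s < N.+3) cell_load x n (a - s) <= box_load n k)%N.
  rewrite /cell_load exchange_big/=; apply: leq_sum => j _.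
  case: (boolP (in_box k (e j))) => bj; last first.
    rewrite big_nat big1// => s sN; case: (boolP (in_cell _ _ _)) => // cj.
    by rewrite (sub s (e j) sN cj) in bj.
  case: (pselect (exists2 s, (0 < s < N.+3)%N & in_cell x (a - s) (e j))) => [[s sN cj]|nc].
    rewrite (bigD1_seq s) ?mem_index_iota ?iota_uniq//= big_seq_cond big1 ?addn0 ?leq_b1//.
    move=> s' /andP[]; rewrite mem_index_iota => s'N ss'.
    case: (boolP (in_cell _ _ _)) => // cj'.
    by have := in_cell_inj cj cj'; move: ss' sN s'N aN; clear; lia.
  rewrite big_nat big1// => s sN; case: (boolP (in_cell _ _ _)) => // cj.
  by exfalso; apply: nc; exists s.
have each s : (0 < s < N.+3)%N -> n%:R * x * (1 - N%:R^-1) <= (cell_load x n (a - s))%:R.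
  move=> /andP[s0 sN]; have := good s sN; rewrite /bad_cell -ltNge pfull; last first.
    apply: (@le_trans _ _ (a%:R * x)).
      by rewrite ler_pM2r// ler_nat; lia.
    by apply: le_trans a1 _; rewrite /U gerBl expR_ge0.
  by rewrite ltr_norml => /andP[h _]; lra.
have : N.+2%:R * (n%:R * x * (1 - N%:R^-1)) <= (box_load n k)%:R.
  apply: le_trans (_ : (\sum_(1 <= s < N.+3) cell_load x n (a - s))%:R <= _); last by rewrite ler_nat.
  have -> : N.+2%:R * (n%:R * x * (1 - N%:R^-1)) =
      \sum_(1 <= s < N.+3) (n%:R * x * (1 - N%:R^-1)).
    by rewrite sumr_const_nat mulr_natl subn1.
  by rewrite natr_sum; apply: ler_sum_nat.
have e1 : n%:R * x = q%:R / N%:R by rewrite -nq mulfK// gt_eqF.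
have loadR : (box_load n k)%:R + 1 <= q%:R :> R by rewrite natr1 ler_nat.
have N2' : 2 <= N%:R :> R by rewrite ler_nat.
have : q%:R <= N.+2%:R * (n%:R * x * (1 - N%:R^-1)).
  rewrite e1 -!natr1.
  have -> : (N%:R + 1 + 1) * (q%:R / N%:R * (1 - N%:R^-1)) =
     q%:R * ((N%:R + 2) * (N%:R - 1) / N%:R ^+ 2) :> R.
    by field; rewrite gt_eqF.
  rewrite -[leLHS]mulr1 ler_wpM2l// ler_pdivlMr ?exprn_gt0// mul1r expr2; lra.
by lra.
Qed.

(** The box is covered by the N - 1 cells that end with its anchor, and if these
    are all good it holds at most (N - 1) * (q / N) * (1 + 1 / N) < q balls. *)
Lemma overfull_box k : gp k <= (N - 2)%:R * x -> (q <= box_load n k)%N ->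
  exists2 s, (s < N.+3)%N & bad_cell (anchor x k - s).
Proof.
move=> xk load; apply: contrapT => /forall2NP H.
have good s : (s < N.+3)%N -> ~~ bad_cell (anchor x k - s).
  by move=> sN; have [//|/negP] := H s.
have /andP[a1 a2] := anchorP k; set a := anchor x k in a1 a2 good.
have small_load : (box_load n k <= \sum_(0 <= s < N.-1) cell_load x n (a - s))%N.
  rewrite /cell_load exchange_big/=; apply: leq_sum => j _.
  case: (boolP (in_box k (e j))) => //; rewrite in_boxU => /andP[b1 b2].
  have Uj0 : 0 <= U (e j) by exact: le_trans (Uleft0 k) (ltW b1).
  pose c := Num.trunc (U (e j) / x).
  have /andP[c1 c2] := truncn_itv (divr_ge0 Uj0 (ltW x0)).
  rewrite ler_pdivlMr// in c1; rewrite ltr_pdivrMr// in c2.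
  have ca : (c <= a)%N.
    have := le_lt_trans c1 (lt_trans b2 a2); by rewrite ltr_pM2r// ltr_nat ltnS.
  have ac : (a < c.+1 + (N - 2))%N.
    have : a%:R * x < c.+1%:R * x + (N - 2)%:R * x.
      apply: le_lt_trans a1 _; rewrite gapU in xk; move: c2 b1 xk; rewrite -/c; lra.
    by rewrite -mulrDl -natrD ltr_pM2r// ltr_nat.
  have sN : (a - c < N.-1)%N by exact: offset_lt.
  rewrite (bigD1_seq (a - c)%N) ?mem_index_iota ?iota_uniq//= subKn//.
  by rewrite /in_cell -/(U (e j)) c1 c2.
have each s : (s < N.-1)%N -> (cell_load x n (a - s))%:R <= n%:R * x * (1 + N%:R^-1).
  move=> sN; have sN3 : (s < N.+3)%N by lia.
  have := good s sN3; rewrite /bad_cell -ltNge.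
  rewrite ltr_norml => /andP[_ h].
  have : n%:R * p (a - s)%N <= n%:R * x by rewrite ler_wpM2l.
  by lra.
have : (box_load n k)%:R <= N.-1%:R * (n%:R * x * (1 + N%:R^-1)).
  apply: (@le_trans _ _ (\sum_(0 <= s < N.-1) cell_load x n (a - s))%:R); first by rewrite ler_nat.
  have -> : N.-1%:R * (n%:R * x * (1 + N%:R^-1)) =
      \sum_(0 <= s < N.-1) (n%:R * x * (1 + N%:R^-1)).
    by rewrite sumr_const_nat mulr_natl subn0.
  by rewrite natr_sum; apply: ler_sum_nat.
have e1 : n%:R * x = q%:R / N%:R by rewrite -nq mulfK// gt_eqF.
have loadR : q%:R <= (box_load n k)%:R :> R by rewrite ler_nat.
have q0R : 0 < q%:R :> R by rewrite ltr0n.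
have : N.-1%:R * (n%:R * x * (1 + N%:R^-1)) < q%:R.
  have -> : N.-1%:R = N%:R - 1 :> R by rewrite -subn1 natrB//; lia.
  rewrite e1.
  have -> : (N%:R - 1) * (q%:R / N%:R * (1 + N%:R^-1)) =
     q%:R * ((N%:R - 1) * (N%:R + 1) / N%:R ^+ 2) :> R.
    by field; rewrite gt_eqF.
  rewrite -[ltRHS]mulr1 ltr_pM2l// ltr_pdivrMr ?exprn_gt0// mul1r expr2; lra.
by lra.
Qed.

(** Hit cells with a bad cell at most N + 2 cells below.  For c < s the truncated
    c - s repeats cell 0, which can only increase the count. *)
Definition bad_anchors : nat :=
  \sum_(0 <= c < Nc) \sum_(0 <= s < N.+3) (hit f x c && bad_cell (c - s)).

(** Balls in a hit cell or in the cell below a hit cell.  The index i stands for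
    the ball i./2 and the offset odd i, so that for each c a single family of
    2 * n events is summed, as for the bad anchors. *)
Definition small_box_balls : nat :=
  \sum_(0 <= c < Nc) \sum_(0 <= i < n.*2) (hit f x c && in_cell x (c - odd i) (e i./2)).

Lemma bad_anchors_le :
  (\sum_(0 <= c < Nc) (hit f x c && `[< exists2 s, (s < N.+3)%N & bad_cell (c - s) >])
    <= bad_anchors)%N.
Proof.
apply: leq_sum => c _; case: (boolP (hit f x c)) => //= _.
case: (asboolP _) => // -[s sN bo].
by rewrite (bigD1_seq s) ?mem_index_iota ?iota_uniq//= bo.
Qed.

Lemma underfull_count r :
  (\sum_(0 <= k < r) ((N.+3%:R * x <= gp k)%R && (box_load n k < q)) <= bad_anchors)%N.
Proof.
apply: leq_trans bad_anchors_le.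
apply: (@injective_count_le (fun k => (N.+3%:R * x <= gp k) && (box_load n k < q)%N)
  (fun c => hit f x c && `[< exists2 s, (s < N.+3)%N & bad_cell (c - s) >]) (anchor x)).
  have xN k : N.+3%:R * x <= gp k -> x <= gp k.
    by apply: le_trans; rewrite -natr1 mulrDl mul1r lerDr mulr_ge0// ltW.
  by move=> k l /andP[/xN xk _] /andP[/xN xl _]; exact: anchor_inj.
move=> k /andP[xk lk]; split; first exact: anchor_lt.
by rewrite hit_anchor/=; apply/asboolP; exact: underfull_box.
Qed.

Lemma overfull_count r :
  (\sum_(0 <= k < r) [&& (x <= gp k)%R, (gp k <= (N - 2)%:R * x)%R & (q <= box_load n k)]
    <= bad_anchors)%N.
Proof.
apply: leq_trans bad_anchors_le.
apply: (@injective_count_le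
  (fun k => [&& x <= gp k, gp k <= (N - 2)%:R * x & (q <= box_load n k)%N])
  (fun c => hit f x c && `[< exists2 s, (s < N.+3)%N & bad_cell (c - s) >]) (anchor x)).
  by move=> k l /and3P[xk _ _] /and3P[xl _ _]; exact: anchor_inj.
move=> k /and3P[xk xk' lk]; split; first exact: anchor_lt.
by rewrite hit_anchor/=; apply/asboolP; exact: overfull_box.
Qed.

(** A box shorter than a cell lies in its anchor and the cell below, and it takes
    q balls to fill it; a ball lies in at most one box. *)
Lemma small_box_count r :
  (q * \sum_(0 <= k < r) ((gp k < x)%R && (q <= box_load n k)) <= small_box_balls)%N.
Proof.
pose A k := (gp k < x)%R && (q <= box_load n k)%N.
apply: (@leq_trans (\sum_(0 <= j < n) \sum_(0 <= k < r) (A k && in_box k (e j)))).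
  rewrite exchange_big/= big_distrr/=; apply: leq_sum => k _.
  rewrite -/(A k); case: (boolP (A k)) => [Ak|_]; last by rewrite muln0.
  by rewrite muln1 /=; case/andP: Ak => _ /leq_trans; exact.
rewrite /small_box_balls [leqRHS]exchange_big/=.
have dbl (F : nat -> nat) m : (\sum_(0 <= i < m.*2) F i = \sum_(0 <= j < m) (F j.*2 + F j.*2.+1))%N.
  elim: m => [|m IH]; first by rewrite !big_geq.
  by rewrite doubleS !big_nat_recr//= IH addnA.
rewrite dbl; apply: leq_sum => j _.
have [[k _ /andP[Ak bk]]|nk] := pselect (exists2 k, (k < r)%N & A k && in_box k (e j)); last first.
  rewrite big_nat big1// => k /andP[_ kr]; apply/eqP; rewrite eqb0; apply/negP => h.
  by apply: nk; exists k.
apply: (@leq_trans 1).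
  rewrite -big_mkcond sum1_count -size_filter.
  apply: (@leq_trans (size [:: k])) => //; apply: uniq_leq_size.
    by rewrite filter_uniq// iota_uniq.
  move=> l; rewrite mem_filter => /andP[/andP[_ bl] _].
  by rewrite inE; apply/eqP; exact: in_box_inj bl bk.
have /andP[xk _] := Ak; have /andP[a1 a2] := anchorP k.
move: (bk); rewrite in_boxU => /andP[b1 b2].
have Uj0 : 0 <= U (e j) by exact: le_trans (Uleft0 k) (ltW b1).
pose c := Num.trunc (U (e j) / x).
have /andP[c1 c2] := truncn_itv (divr_ge0 Uj0 (ltW x0)).
rewrite ler_pdivlMr// in c1; rewrite ltr_pdivrMr// in c2.
set a := anchor x k in a1 a2.
have ca : (c <= a)%N.
  have := le_lt_trans c1 (lt_trans b2 a2); by rewrite ltr_pM2r// ltr_nat ltnS.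
have ac : (a < c.+2)%N.
  have : a%:R * x < c.+2%:R * x.
    rewrite -[c.+2%:R]natr1; move: xk c2 b1; rewrite gapU -/c; lra.
  by rewrite ltr_pM2r// ltr_nat.
have inc : in_cell x c (e j) by rewrite /in_cell -/(U (e j)) c1 c2.
rewrite -big_split/= (bigD1_seq a) ?mem_index_iota ?iota_uniq ?anchor_lt//=.
rewrite hit_anchor/= odd_double uphalf_double doubleK/= subn0.
have [ac'|ac'] := leqP a c.
  have -> : a = c by apply/eqP; rewrite eqn_leq ac' ca.
  by rewrite inc.
have -> : (a - 1)%N = c by exact: predecessor_eq.
by rewrite inc addn1.
Qed.

End balls_in_boxes_path.

(** * Moments of counts and the exponential law *)

Section counting_markov.
Context {R : realType} {d : measure_display} {T : measurableType d}.
Variable P : probability T R.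

Lemma integral_count (I : Type) (r : seq I) (A : I -> set T) :
  (forall i, measurable (A i)) ->
  (\int[P]_w (\sum_(i <- r) (w \in A i))%N%:R%:E = \sum_(i <- r) P (A i))%E.
Proof.
move=> mA.
rewrite (eq_integral (fun w => \sum_(i <- r) (\1_(A i) w)%:E)%E); last first.
  by move=> w _; rewrite natr_sum sumEFin; congr _%:E; apply: eq_bigr => i _; rewrite indicE.
rewrite ge0_integral_sum//.
  by apply: eq_bigr => i _; rewrite integral_indic ?setIT.
move=> i; apply/measurable_EFinP; exact: measurable_indic.
Qed.

Lemma measurable_count (I : Type) (r : seq I) (A : I -> set T) :
  (forall i, measurable (A i)) ->
  measurable_fun [set: T] (fun w => (\sum_(i <- r) (w \in A i))%N%:R : R).
Proof.
move=> mA.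
rewrite (_ : (fun w => _) = (fun w => \sum_(i <- r) \1_(A i) w)); last first.
  by apply/funext => w; rewrite natr_sum; apply: eq_bigr => i _; rewrite indicE.
by apply: measurable_sum => i; exact: measurable_indic.
Qed.

(** The first moment is at most b * be times the expected number of A c, and that
    number is at most m by assumption. *)
Lemma count_markov (A : nat -> set T) (F : nat -> nat -> set T) (Nc b : nat) (be m t : R) :
  (forall c, measurable (A c)) -> (forall c i, measurable (F c i)) ->
  (forall c i, P (A c `&` F c i) = P (A c) * P (F c i))%E ->
  (forall c i, (P (F c i) <= be%:E)%E) -> 0 <= be -> 0 < t ->
  (forall w, (\sum_(0 <= c < Nc) (w \in A c))%N%:R <= m) ->
  (P [set w | (t <= (\sum_(0 <= c < Nc) \sum_(0 <= i < b) ((w \in A c) && (w \in F c i)))%N%:R)%R]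
    <= (b%:R * be * m / t)%:E)%E.
Proof.
move=> mA mF ind Fbe be0 t0 Am.
have mAF c i : measurable (A c `&` F c i) by exact: measurableI.
pose X w := (\sum_(0 <= c < Nc) \sum_(0 <= i < b) ((w \in A c) && (w \in F c i)))%N.
have XE w : X w = (\sum_(ci <- [seq (c, i) | c <- index_iota 0 Nc, i <- index_iota 0 b])
    (w \in A ci.1 `&` F ci.1 ci.2))%N.
  rewrite big_allpairs_dep/=; apply: eq_bigr => c _; apply: eq_bigr => i _.
  by rewrite in_setI.
have mX : measurable_fun [set: T] (fun w => (X w)%:R%:E : \bar R).
  apply/measurable_EFinP; under eq_fun do rewrite XE.
  by apply: (@measurable_count _ _ (fun ci => A ci.1 `&` F ci.1 ci.2)) => -[c i]; exact: mAF.
have -> : [set w | t <= (X w)%:R] = [set w | (t%:E <= (X w)%:R%:E)%E].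
  by apply/funext => w /=; rewrite lee_fin.
apply: markov_le => //.
under eq_integral do rewrite XE.
rewrite (@integral_count _ _ (fun ci => A ci.1 `&` F ci.1 ci.2)); last by move=> -[c i]; exact: mAF.
rewrite big_allpairs_dep/=.
apply: (@le_trans _ _ (\sum_(0 <= c < Nc) ((b%:R * be)%:E * P (A c)))%E).
  apply: lee_sum => c _.
  apply: (@le_trans _ _ (\sum_(0 <= i < b) (be%:E * P (A c)))%E).
    apply: lee_sum => i _; apply: (@le_trans _ _ (P (A c) * P (F c i))%E).
      by rewrite le_eqVlt; apply/orP; left; apply/eqP; exact: ind.
    by rewrite muleC lee_wpmul2r.
  have PAfin : P (A c) \is a fin_num by exact: fin_num_measure.
  rewrite -(fineK PAfin) -!EFinM sumEFin lee_fin sumr_const_nat subn0.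
  by rewrite -[X in X <= _]mulr_natl mulrA.
have PAfin c : P (A c) \is a fin_num by exact: fin_num_measure.
under eq_bigr do rewrite -[P _]fineK// -EFinM.
rewrite sumEFin lee_fin -mulr_sumr ler_wpM2l ?mulr_ge0//.
rewrite -lee_fin -sumEFin; under eq_bigr do rewrite fineK//.
rewrite -integral_count//.
apply: (@le_trans _ _ (\int[P]_(w in setT) m%:E)%E).
  apply: ge0_le_integral => //.
  - apply/measurable_EFinP; exact: measurable_count.
  - by move=> w _; rewrite lee_fin.
by rewrite integral_cst//= probability_setT mule1.
Qed.

(** Pairwise independence suffices for the variance n * (p - p ^ 2) <= n * p. *)
Lemma count_chebyshev (A : nat -> set T) n (p t : R) :
  (forall j, measurable (A j)) -> (forall j, P (A j) = p%:E) ->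
  (forall i j, i != j -> P (A i `&` A j) = (p * p)%:E) -> 0 <= p -> 0 < t ->
  (P [set w | (t <= `|(\sum_(0 <= j < n) (w \in A j))%N%:R - n%:R * p|)%R]
    <= (n%:R * p / t ^+ 2)%:E)%E.
Proof.
move=> mA PA PAA p0 t0.
pose Z w : R := (\sum_(0 <= j < n) (w \in A j))%N%:R.
have mZ : measurable_fun [set: T] Z by exact: measurable_count.
pose Y w : R := (Z w - n%:R * p) ^+ 2.
have mY : measurable_fun [set: T] Y.
  by apply: measurable_funX; apply: measurable_funB.
have EZ : (\int[P]_w (Z w)%:E = (n%:R * p)%:E)%E.
  rewrite integral_count//; under eq_bigr do rewrite PA.
  by rewrite sumEFin sumr_const_nat subn0 mulr_natl.
have EZ2 : (\int[P]_w (Z w ^+ 2)%:E = (n%:R * p + n%:R * (n%:R - 1) * p ^+ 2)%:E)%E.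
  pose r := [seq (i, j) | i <- index_iota 0 n, j <- index_iota 0 n].
  rewrite (eq_integral (fun w => (\sum_(ij <- r) (w \in A ij.1 `&` A ij.2))%N%:R%:E)); last first.
    move=> w _; congr _%:E; rewrite /Z -natrX; congr _%:R.
    rewrite /r big_allpairs_dep/= -mulnn big_distrl/=; apply: eq_bigr => i _.
    by rewrite big_distrr/=; apply: eq_bigr => j _; rewrite in_setI mulnb.
  rewrite (@integral_count _ _ (fun ij => A ij.1 `&` A ij.2)); last first.
    by move=> -[i j]; exact: measurableI.
  rewrite /r big_allpairs_dep/=.
  rewrite (eq_big_seq (fun i => (p + (n%:R - 1) * p ^+ 2)%:E)); last first.
    move=> i; rewrite mem_index_iota => /= ni.
    rewrite (bigD1_seq i) ?mem_index_iota ?iota_uniq//= setIid PA EFinD; congr (_ + _)%E.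
    rewrite (eq_bigr (fun=> (p * p)%:E)); last by move=> j ji; rewrite PAA// eq_sym.
    rewrite sumEFin; congr _%:E.
    have : \sum_(0 <= k < n) (p * p) = p * p + \sum_(k <- index_iota 0 n | k != i) (p * p).
      by rewrite (bigD1_seq i) ?mem_index_iota ?iota_uniq.
    by rewrite sumr_const_nat subn0 -[X in X = _ -> _]mulr_natl; lra.
  rewrite sumEFin sumr_const_nat subn0 ; congr _%:E; rewrite -[LHS]mulr_natl; ring.
have EY : (\int[P]_w (Y w)%:E <= (n%:R * p)%:E)%E.
  have np0 : 0 <= n%:R * p by rewrite mulr_ge0.
  have H : (\int[P]_w (Y w)%:E + (2 * (n%:R * p))%:E * \int[P]_w (Z w)%:E =
            \int[P]_w (Z w ^+ 2)%:E + ((n%:R * p) ^+ 2)%:E)%E.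
    have Z0 w : [set: T] w -> (0 <= (Z w)%:E)%E by rewrite lee_fin.
    have Y0 w : [set: T] w -> (0 <= (Y w)%:E)%E by rewrite lee_fin sqr_ge0.
    have Z20 w : [set: T] w -> (0 <= (Z w ^+ 2)%:E)%E by rewrite lee_fin sqr_ge0.
    have c0 : (0 <= (2 * (n%:R * p))%:E)%E by rewrite lee_fin mulr_ge0.
    have cZ0 w : [set: T] w -> (0 <= (2 * (n%:R * p))%:E * (Z w)%:E)%E.
      by move=> _; rewrite mule_ge0// lee_fin.
    have d0 w : [set: T] w -> (0 <= ((n%:R * p) ^+ 2)%:E)%E by rewrite lee_fin sqr_ge0.
    have mZE : measurable_fun [set: T] (fun w => (Z w)%:E) by exact/measurable_EFinP.
    have mYE : measurable_fun [set: T] (fun w => (Y w)%:E) by exact/measurable_EFinP.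
    have mcZ : measurable_fun [set: T] (fun w => (2 * (n%:R * p))%:E * (Z w)%:E)%E.
      exact: emeasurable_funM.
    have mZ2 : measurable_fun [set: T] (fun w => (Z w ^+ 2)%:E).
      by apply/measurable_EFinP; exact: measurable_funX.
    rewrite -ge0_integralZl// -ge0_integralD//.
    have -> : ((n%:R * p) ^+ 2)%:E = (\int[P]_(w in setT) ((n%:R * p) ^+ 2)%:E)%E.
      by rewrite integral_cst//= probability_setT mule1.
    rewrite -ge0_integralD//.
    apply: eq_integral => w _; rewrite -!EFinM -!EFinD; congr _%:E; rewrite /Y; ring.
  move: H; rewrite EZ EZ2; case: (\int[P]_w (Y w)%:E)%E => [y| |]//=.
  rewrite -!EFinM -!EFinD => -[H]; rewrite lee_fin.
  have : 0 <= n%:R * p ^+ 2 by rewrite mulr_ge0// sqr_ge0.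
  by lra.
have -> : [set w | t <= `|Z w - n%:R * p|] = [set w | ((t ^+ 2)%:E <= (Y w)%:E)%E].
  apply/funext => w /=; rewrite lee_fin /Y -(real_normK (num_real (Z w - n%:R * p))).
  by rewrite ler_sqr ?nnegrE// (ltW t0).
apply: markov_le => //.
- exact/measurable_EFinP.
- by move=> w; rewrite lee_fin sqr_ge0.
- by rewrite exprn_gt0.
Qed.

End counting_markov.

Section exponential_cells.
Context {R : realType}.

Lemma exponential_cdf (u : R) : 0 <= u ->
  exponential_prob 1 [set y | 1 - expR (- y) < u] = (Num.min u 1)%:E.
Proof.
move=> u0.
have pdf0 (y : R) : y < 0 -> exponential_pdf 1 y = 0 by exact: lt0_exponential_pdf.
have [u1|u1] := leP 1 u.
  rewrite (_ : [set y | _] = setT); last first.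
    by apply/seteqP; split => // y _ /=; apply: lt_le_trans u1; rewrite gtrBl expR_gt0.
  exact: integral_exponential_pdf.
pose y0 := - ln (1 - u).
have u1' : 0 < 1 - u by lra.
have ey : expR (- y0) = 1 - u by rewrite opprK lnK.
have y00 : 0 <= y0 by rewrite oppr_ge0 ln_le0//; lra.
have -> : [set y | 1 - expR (- y) < u] = `]-oo, 0[%classic `|` `[0, y0[%classic.
  apply/seteqP; split => y /=; rewrite !in_itv/= => h.
    have yy : y < y0 by rewrite -ltrN2 -ltr_expR ey; move: h; lra.
    by case: (ltP y 0) => y0'; [left|right].
  have yy : y < y0 by case: h => [h|/andP[]//]; exact: lt_le_trans y00.
  have : expR (- y0) < expR (- y) by rewrite ltr_expR ltrN2.
  by rewrite ey; lra.
rewrite /exponential_prob ge0_integral_setU//=; last 3 first.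
- by apply/measurable_funTS/measurable_EFinP; exact: measurable_exponential_pdf.
- by move=> y _; rewrite lee_fin exponential_pdf_ge0.
- by apply/disj_setPS => y /= []; rewrite !in_itv/= => h /andP[]; rewrite leNgt h.
rewrite integral0_eq ?add0e; last by move=> y /=; rewrite in_itv/= => /pdf0 ->.
have [yy|yy] := eqVneq y0 0.
  rewrite yy set_itvco0 integral_set0; congr _%:E.
  by move: ey; rewrite yy oppr0 expR0; lra.
rewrite integral_itv_bndo_bndc; last first.
  by apply/measurable_funTS/measurable_EFinP; exact: measurable_exponential_pdf.
have := @exponential_prob_itv0c R 1 y0; rewrite /exponential_prob => ->.
  by rewrite mulN1r ey -EFinB; congr _%:E; lra.
by rewrite lt_neqAle eq_sym yy.
Qed.

Lemma measurable_cell (x : R) c : measurable [set y : R | in_cell x c y].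
Proof.
have mU : measurable_fun [set: R] (fun y : R => 1 - expR (- y)).
  apply: measurable_funB => //; apply: measurableT_comp => //; exact: measurableT_comp.
rewrite (_ : [set y | _] = (fun y => 1 - expR (- y)) @^-1` `[c%:R * x, c.+1%:R * x[%classic).
  by rewrite -[X in measurable X]setTI; exact: mU.
by apply/seteqP; split => y /=; rewrite in_itv.
Qed.

(** The last cell that meets [0, 1] may stick out, and later cells are empty. *)
Definition cell_prob (x : R) c : R := Num.min (c.+1%:R * x) 1 - Num.min (c%:R * x) 1.

Lemma cell_prob_ge0 x c : 0 < x -> 0 <= cell_prob x c.
Proof.
move=> x0; rewrite subr_ge0 le_min !ge_min lexx orbT andbT.
by rewrite ler_pM2r// ler_nat leqnSn.
Qed.

Lemma cell_prob_le x c : 0 < x -> cell_prob x c <= x.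
Proof.
move=> x0; rewrite /cell_prob -natr1 mulrDl mul1r /Num.min.
by case: ifP; case: ifP => /negP ? /negP ?; lra.
Qed.

Lemma cell_prob_full x c : 0 < x -> c.+1%:R * x <= 1 -> cell_prob x c = x.
Proof.
move=> x0 cx; rewrite /cell_prob (min_idPl cx).
have cx' : c%:R * x <= 1.
  by apply: le_trans cx; rewrite ler_pM2r// ler_nat leqnSn.
by rewrite (min_idPl cx') -natr1 mulrDl mul1r addrAC subrr add0r.
Qed.

End exponential_cells.

(** * Concentration of the balls near the range *)

Section path_measurability.
Context {R : realType} {d : measure_display} {T : measurableType d}.

Lemma measurable_pred_set (A : T -> bool) :
  measurable [set w | A w] -> measurable_fun [set: T] (fun w => (A w)%:R : R).
Proof.
move=> mA; rewrite (_ : (fun w => _) = \1_[set w | A w]); last first.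
  apply/funext => w; rewrite indicE; congr (nat_of_bool _)%:R.
  by apply/idP/idP => [Aw|]; rewrite inE.
exact: measurable_indic.
Qed.

Lemma measurable_preimage_set (X : T -> R) (B : set R) :
  measurable_fun [set: T] X -> measurable B -> measurable [set w | B (X w)].
Proof. by move=> mX mB; rewrite -[X in measurable X]setTI; exact: mX. Qed.

Lemma measurable_bad_cell (e : nat -> T -> R) x n N p c :
  (forall j, measurable_fun [set: T] (e j)) ->
  measurable [set w | bad_cell (e ^~ w) x n N p c].
Proof.
move=> me.
have mZ : measurable_fun [set: T] (fun w => (cell_load (e ^~ w) x n c)%:R : R).
  rewrite /cell_load; under eq_fun do rewrite natr_sum.
  apply: measurable_sum => j; apply: measurable_pred_set.
  exact: (measurable_preimage_set (me j) (measurable_cell x c)).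
have mB : measurable [set r : R | n%:R * x / N%:R <= `|r - n%:R * p c|].
  have mf : measurable_fun [set: R] (fun r : R => `|r - n%:R * p c|).
    by apply: measurableT_comp => //; exact: measurable_funB.
  have := mf measurableT `[n%:R * x / N%:R, +oo[%classic (measurable_itv _).
  rewrite setTI; congr (measurable _); apply/seteqP.
  by split => r /=; rewrite in_itv/= andbT.
exact: (measurable_preimage_set mZ mB).
Qed.

Variable S : R -> T -> R.
Hypothesis mS : forall t, 0 <= t -> measurable_fun [set: T] (S t).
Hypothesis S_nd : forall w s t, 0 <= s -> s <= t -> S s w <= S t w.
Hypothesis S_rc : forall w t, 0 <= t -> S s w @[s --> t^'+] --> S t w.

(** Right continuity turns events about all times into countable unions. *)
Lemma right_rational_time w t y : 0 <= t -> S t w < y ->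
  exists r : rat, [/\ 0 <= ratr r :> R, t < ratr r & S (ratr r) w < y].
Proof.
move=> t0 Sty.
have : \forall s \near t^'+, S s w < y by exact: (cvgr_lt _ (@S_rc w t t0) _ Sty).
move=> [e /= e0 He].
have : t < t + e by rewrite ltrDl.
move=> /rat_in_itvoo[r]; rewrite in_itv/= => /andP[tr re].
exists r; split => //; first by rewrite ltW// (le_lt_trans t0 tr).
apply: He => //=; rewrite ltr0_norm; last by rewrite subr_lt0.
by rewrite opprB ltrBlDl.
Qed.

Lemma measurable_hit x c : measurable [set w | hit (S ^~ w) x c].
Proof.
have -> : [set w | hit (S ^~ w) x c] = \bigcup_(r : rat)
    [set w | (0 <= ratr r :> R) && in_cell x c (S (ratr r) w)].
  apply/seteqP; split => w /=.
    move=> /asboolP[t t0 /andP[h1 h2]].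
    have [r [r0 tr Sr]] : exists r : rat, [/\ 0 <= ratr r :> R, t < ratr r &
        1 - expR (- S (ratr r) w) < c.+1%:R * x].
      have [c1|c1] := leP 1 (c.+1%:R * x).
        have [r] : exists r : rat, (ratr r : R) \in `]t, (t + 1)%R[.
          have : t < t + 1 by rewrite ltrDl.
          by move=> /rat_in_itvoo[r rr]; exists r.
        rewrite in_itv/= => /andP[tr _]; exists r; split => //.
          by rewrite ltW// (le_lt_trans t0 tr).
        by apply: lt_le_trans c1; rewrite gtrBl expR_gt0.
      have u0 : 0 < 1 - c.+1%:R * x by lra.
      have : S t w < - ln (1 - c.+1%:R * x).
        rewrite -ltrN2 opprK -ltr_expR lnK ?posrE//; lra.
      move=> /(right_rational_time t0)[r [r0 tr Sr]]; exists r; split => //.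
      move: Sr; rewrite -ltrN2 opprK -ltr_expR lnK ?posrE//; lra.
    exists r => //=; rewrite r0 /in_cell Sr andbT (le_trans h1)//.
    by rewrite lerD2l lerN2 ler_expR lerN2 S_nd// ltW.
  by move=> [r _ /= /andP[r0 rc]]; apply/asboolP; exists (ratr r).
apply: countable_bigcupT_measurable => [|r]; first exact: countableP.
have [r0|r0] := boolP (0 <= ratr r :> R); last by rewrite (_ : [set w | _] = set0)// -subset0.
exact: (measurable_preimage_set (mS r0) (measurable_cell x c)).
Qed.

Lemma measurable_few_hits x Nc (m : R) :
  measurable [set w | (\sum_(0 <= c < Nc) hit (S ^~ w) x c)%N%:R <= m].
Proof.
have mZ : measurable_fun [set: T] (fun w => (\sum_(0 <= c < Nc) hit (S ^~ w) x c)%N%:R : R).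
  under eq_fun do rewrite natr_sum.
  by apply: measurable_sum => c; apply: measurable_pred_set; exact: measurable_hit.
have := measurable_preimage_set mZ (measurable_itv `]-oo, m]).
by congr (measurable _); apply/seteqP; split => w /=; rewrite in_itv.
Qed.

End path_measurability.

Section balls.
Context {R : realType} {d : measure_display} {T : measurableType d}.
Variables (P : probability T R) (S : R -> {RV P >-> R}) (E : nat -> {RV P >-> R}).
Hypothesis S_nd : forall w s t, 0 <= s -> s <= t -> S s w <= S t w.
Hypothesis S_rc : forall w t, 0 <= t -> S s w @[s --> t^'+] --> S t w.
Hypothesis hEdist : forall k (B : set R), measurable B ->
  distribution P (E k) B = exponential_prob 1 B.
Hypothesis hEind : mutually_independent P E.
Hypothesis hES : independent_systems P (sigma_generated setT E)
  (sigma_generated [set t : R | 0 <= t] S).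

Let GE := \bigcup_(i in [set: nat]) preimage_set_system setT (E i) (@measurable _ R).
Let GS := \bigcup_(i in [set t : R | 0 <= t]) preimage_set_system setT (S i) (@measurable _ R).

Lemma sigma_E_measurable j : measurable_fun [set: g_sigma_algebraType GE] (E j).
Proof.
move=> _ B mB; apply: sub_sigma_algebra; exists j => //.
by exists B.
Qed.

Lemma sigma_S_measurable t : 0 <= t -> measurable_fun [set: g_sigma_algebraType GS] (S t).
Proof.
move=> t0 _ B mB; apply: sub_sigma_algebra; exists t => //.
by exists B.
Qed.

Lemma ball_cell_prob (x : R) j c : 0 < x ->
  P [set w | in_cell x c (E j w)] = (cell_prob x c)%:E.
Proof.
move=> x0.
have mle u : measurable [set y : R | 1 - expR (- y) < u].
  have mU : measurable_fun [set: R] (fun y : R => 1 - expR (- y)).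
    apply: measurable_funB => //; apply: measurableT_comp => //; exact: measurableT_comp.
  have := measurable_preimage_set mU (measurable_itv `]-oo, u[).
  by congr (measurable _); apply/seteqP; split => y /=; rewrite in_itv.
pose V u := [set y : R | 1 - expR (- y) < u].
have Vprob u : 0 <= u -> distribution P (E j) (V u) = (Num.min u 1)%:E.
  by move=> u0; rewrite hEdist; [exact: exponential_cdf|exact: mle].
have -> : P [set w | in_cell x c (E j w)] = distribution P (E j) (V (c.+1%:R * x) `\` V (c%:R * x)).
  rewrite /distribution /pushforward; congr (P _); apply/seteqP; split => w /=.
    by move=> /andP[h1 h2]; split => //; apply/negP; rewrite -leNgt.
  by move=> [h1 /negP]; rewrite -leNgt => h2; rewrite /in_cell h1 h2.
have c0 : 0 <= c%:R * x by rewrite mulr_ge0// ltW.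
have c10 : 0 <= c.+1%:R * x by rewrite mulr_ge0// ltW.
rewrite measureD//; last 3 first.
- exact: mle.
- exact: mle.
- by rewrite -ge0_fin_numE// fin_num_measure//; exact: mle.
rewrite (_ : V (c.+1%:R * x) `&` V (c%:R * x) = V (c%:R * x)); last first.
  apply/setIidPr => y /=; rewrite /V/= => /lt_trans; apply.
  by rewrite ltr_pM2r// ltr_nat.
rewrite EFinB; congr (_ - _)%E; exact: Vprob.
Qed.

Lemma ball_cell_pair (x : R) i j c : 0 < x -> i != j ->
  P ([set w | in_cell x c (E i w)] `&` [set w | in_cell x c (E j w)]) =
  (cell_prob x c * cell_prob x c)%:E.
Proof.
move=> x0 ij; pose B := [set y : R | in_cell x c y].
have := hEind [fset i; j]%fset (fun=> measurable_cell x c : measurable B).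
rewrite (_ : \bigcap_(k in _) _ = [set w | in_cell x c (E i w)] `&` [set w | in_cell x c (E j w)]); last first.
  apply/seteqP; split => w /=.
    by move=> h; split; apply: h; rewrite /= !inE eqxx ?orbT.
  by move=> [hi hj] k /=; rewrite !inE => /orP[] /eqP ->.
move=> ->; rewrite big_fsetU1 ?inE//= big_seq_fset1 EFinM.
by congr (_ * _)%E; exact: ball_cell_prob.
Qed.

(** The number of balls in a cell has variance at most n * x = q / N, and the
    allowed deviation is q / N ^ 2. *)
Lemma bad_cell_prob (x : R) n N q c : 0 < x -> n%:R * x * N%:R = q%:R -> (0 < q)%N ->
  (P [set w | bad_cell (E ^~ w) x n N (cell_prob x) c] <= (N%:R ^+ 3 / q%:R)%:E)%E.
Proof.
move=> x0 nq q0.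
have q0R : 0 < q%:R :> R by rewrite ltr0n.
have N0 : 0 < N%:R :> R.
  by rewrite lt_neqAle ler0n andbT; apply/eqP => N00; move: nq q0R; rewrite -N00 mulr0 => <-; rewrite ltxx.
have nx0 : 0 < n%:R * x by rewrite -(pmulr_lgt0 _ N0) nq.
have t0 : 0 < n%:R * x / N%:R by rewrite divr_gt0.
pose A j := [set w | in_cell x c (E j w)].
have mA j : measurable (A j).
  exact: (measurable_preimage_set (measurable_funPT (E j)) (measurable_cell x c)).
have PA j : P (A j) = (cell_prob x c)%:E by exact: ball_cell_prob.
have PAA i j : i != j -> P (A i `&` A j) = (cell_prob x c * cell_prob x c)%:E.
  by move=> ij; exact: ball_cell_pair.
have := count_chebyshev n mA PA PAA (cell_prob_ge0 c x0) t0.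
have -> : [set w | n%:R * x / N%:R <=
   `|(\sum_(0 <= j < n) (w \in A j))%:R - n%:R * cell_prob x c|] =
   [set w | bad_cell (E ^~ w) x n N (cell_prob x) c].
  apply/funext => w /=; rewrite /bad_cell /cell_load; congr (is_true (_ <= `|_%:R - _|)).
  by apply: eq_bigr => j _; congr nat_of_bool; apply/idP/idP; rewrite inE.
move=> /le_trans; apply; rewrite lee_fin ler_pdivrMr ?exprn_gt0//.
have -> : N%:R ^+ 3 / q%:R * (n%:R * x / N%:R) ^+ 2 = n%:R * x * (n%:R * x * N%:R / q%:R).
  by field; rewrite !gt_eqF.
rewrite nq divff ?gt_eqF// mulr1.
by rewrite ler_wpM2l// cell_prob_le.
Qed.

(** The events A c depend on S only and the events F on the balls only, so they
    are independent.  The bound m on the number of hit cells holds with large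
    probability rather than surely; it is therefore made part of A c, which
    changes nothing on the paths of interest. *)
Lemma balls_concentration (x m t1 t2 : R) n N q Nc :
  0 < x -> n%:R * x * N%:R = q%:R -> (0 < q)%N -> 0 <= m -> 0 < t1 -> 0 < t2 ->
  exists B, [/\ measurable B,
    (P B <= (N.+3%:R * (N%:R ^+ 3 / q%:R) * m / t1 + n.*2%:R * x * m / t2)%:E)%E &
    forall w, ~ B w -> (\sum_(0 <= c < Nc) hit (S ^~ w) x c)%N%:R <= m ->
      (bad_anchors (S ^~ w) (E ^~ w) x n N Nc (cell_prob x))%:R < t1 /\
      (small_box_balls (S ^~ w) (E ^~ w) x n Nc)%:R < t2 :> R].
Proof.
move=> x0 nq q0 m0 t10 t20.
pose A c := [set w | hit (S ^~ w) x c] `&`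
   [set w | (\sum_(0 <= c < Nc) hit (S ^~ w) x c)%N%:R <= m].
pose F1 c s := [set w | bad_cell (E ^~ w) x n N (cell_prob x) (c - s)].
pose F2 c i := [set w | in_cell x (c - odd i) (E i./2 w)].
have sA c : sigma_generated [set t : R | 0 <= t] S (A c).
  have : measurable (A c : set (g_sigma_algebraType GS)).
    by apply: measurableI; [apply: measurable_hit|apply: measurable_few_hits] => //;
      exact: sigma_S_measurable.
  exact.
have sF1 c s : sigma_generated setT E (F1 c s).
  have : measurable (F1 c s : set (g_sigma_algebraType GE)).
    by apply: measurable_bad_cell => j; exact: sigma_E_measurable.
  exact.
have sF2 c i : sigma_generated setT E (F2 c i).
  have : measurable (F2 c i : set (g_sigma_algebraType GE)).
    exact: (measurable_preimage_set (sigma_E_measurable i./2) (measurable_cell x _)).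
  exact.
have mA c : measurable (A c).
  by apply: measurableI; [apply: measurable_hit|apply: measurable_few_hits].
have mF1 c s : measurable (F1 c s) by exact: measurable_bad_cell.
have mF2 c i : measurable (F2 c i).
  exact: (measurable_preimage_set (measurable_funPT (E i./2)) (measurable_cell x _)).
have Am w : (\sum_(0 <= c < Nc) (w \in A c))%N%:R <= m.
  have [h|h] := leP (\sum_(0 <= c < Nc) hit (S ^~ w) x c)%N%:R m.
    apply: le_trans h; rewrite ler_nat; apply: leq_sum => c _.
    by case: (boolP (w \in A c)) => //; rewrite inE => -[/= ->].
  rewrite big1// => c _; apply/eqP; rewrite eqb0; apply/negP.
  by rewrite inE => -[_ /=]; rewrite leNgt h.
have ind1 c s : P (A c `&` F1 c s) = (P (A c) * P (F1 c s))%E.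
  by rewrite setIC muleC; exact: hES.
have ind2 c i : P (A c `&` F2 c i) = (P (A c) * P (F2 c i))%E.
  by rewrite setIC muleC; exact: hES.
have p1 c s : (P (F1 c s) <= (N%:R ^+ 3 / q%:R)%:E)%E by exact: bad_cell_prob.
have p2 c i : (P (F2 c i) <= x%:E)%E.
  by rewrite /F2 ball_cell_prob// lee_fin cell_prob_le.
have be1 : 0 <= N%:R ^+ 3 / q%:R :> R by rewrite divr_ge0// exprn_ge0.
have M1 := count_markov N.+3 mA mF1 ind1 p1 be1 t10 Am.
have M2 := count_markov n.*2 mA mF2 ind2 p2 (ltW x0) t20 Am.
have mU (F : nat -> nat -> set T) (t : R) (b : nat) : (forall c i, measurable (F c i)) ->
   measurable [set w | t <= (\sum_(0 <= c < Nc) \sum_(0 <= i < b) ((w \in A c) && (w \in F c i)))%N%:R].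
  move=> mF.
  have mX : measurable_fun [set: T]
     (fun w => (\sum_(0 <= c < Nc) \sum_(0 <= i < b) ((w \in A c) && (w \in F c i)))%N%:R : R).
    under eq_fun do rewrite natr_sum.
    apply: measurable_sum => c.
    rewrite (_ : (fun w => _) = (fun w => (\sum_(0 <= i < b) (w \in A c `&` F c i))%N%:R)); last first.
      by apply/funext => w; congr (_%:R); apply: eq_bigr => i _; rewrite in_setI.
    by apply: measurable_count => i; exact: measurableI.
  have := measurable_preimage_set mX (measurable_itv `[t, +oo[).
  by congr (measurable _); apply/seteqP; split => w /=; rewrite in_itv/= andbT.
exists ([set w | t1 <= (\sum_(0 <= c < Nc) \sum_(0 <= i < N.+3) ((w \in A c) && (w \in F1 c i)))%N%:R]
    `|` [set w | t2 <= (\sum_(0 <= c < Nc) \sum_(0 <= i < n.*2) ((w \in A c) && (w \in F2 c i)))%N%:R]).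
split.
- by apply: measurableU; exact: mU.
- by apply: prob_setU_le => //; exact: mU.
- move=> w /not_orP[/= /negP + /negP]; rewrite -!ltNge => h1 h2 few.
  have wA c : (w \in A c) = hit (S ^~ w) x c.
    by apply/idP/idP; [rewrite inE => -[]|move=> h; rewrite inE; split].
  split.
    suff <- : (\sum_(0 <= c < Nc) \sum_(0 <= i < N.+3) ((w \in A c) && (w \in F1 c i)))%N =
       bad_anchors (S ^~ w) (E ^~ w) x n N Nc (cell_prob x) by [].
    apply: eq_bigr => c _; apply: eq_bigr => i _; rewrite wA; congr (nat_of_bool (_ && _)).
    by apply/idP/idP; rewrite inE.
  suff <- : (\sum_(0 <= c < Nc) \sum_(0 <= i < n.*2) ((w \in A c) && (w \in F2 c i)))%N =
     small_box_balls (S ^~ w) (E ^~ w) x n Nc by [].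
  apply: eq_bigr => c _; apply: eq_bigr => i _; rewrite wA; congr (nat_of_bool (_ && _)).
  by apply/idP/idP; rewrite inE.
Qed.

End balls.

(** * Measurability *)

Lemma box_countE {R : realType} {T : Type} (S : R -> T -> R) (tau E : nat -> T -> R) n k w :
  box_count S tau E n k w = (\sum_(j < n) (E j w \in box S tau k w))%N.
Proof.
rewrite /box_count -sum1_card big_mkcond/=; apply: eq_bigr => j _.
have -> : (j \in [set j0 : 'I_n | E j0 w \in box S tau k w]) = (E j w \in box S tau k w).
  by apply/idP/idP; rewrite inE.
by case: (_ \in _).
Qed.

Section measurable_tests.
Context {R : realType} {d : measure_display} {T : measurableType d}.

Lemma measurable_fun_lt (f : T -> R) :
  (forall y, measurable [set w | f w < y]) -> measurable_fun [set: T] f.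
Proof.
move=> mf mT; apply: (measurability _ (RGenInftyO.measurableE R)) => //.
move=> _ [_ [y ->] <-]; rewrite setTI.
by have := mf y; congr (measurable _); apply/seteqP; split => w /=; rewrite in_itv.
Qed.

Lemma measurable_fun_gt (f : T -> R) :
  (forall y, measurable [set w | y < f w]) -> measurable_fun [set: T] f.
Proof.
move=> mf mT; apply: (measurability _ (RGenOInfty.measurableE R)) => //.
move=> _ [_ [y ->] <-]; rewrite setTI.
by have := mf y; congr (measurable _); apply/seteqP; split => w /=; rewrite in_itv/= andbT.
Qed.

End measurable_tests.

Section path_functional_measurability.
Context {R : realType} {d : measure_display} {T : measurableType d}.
Variable S : R -> T -> R.
Hypothesis mS : forall t, 0 <= t -> measurable_fun [set: T] (S t).
Hypothesis S0 : forall w, S 0 w = 0.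
Hypothesis S_nd : forall w s t, 0 <= s -> s <= t -> S s w <= S t w.
Hypothesis S_rc : forall w t, 0 <= t -> S s w @[s --> t^'+] --> S t w.

Lemma measurable_S_at (tau : T -> R) : measurable_fun [set: T] tau ->
  (forall w, 0 <= tau w) -> measurable_fun [set: T] (fun w => S (tau w) w).
Proof.
move=> mt t0; apply: measurable_fun_lt => y.
have -> : [set w | S (tau w) w < y] = \bigcup_(r : rat)
   (if 0 <= ratr r :> R then [set w | tau w < ratr r] `&` [set w | S (ratr r) w < y] else set0).
  apply/seteqP; split => w /=.
    move=> /(right_rational_time S_rc (t0 w))[r [r0 tr Sr]]; exists r => //.
    by rewrite r0; split.
  move=> [r _]; case: ifPn => // r0 [/= tr]; apply: le_lt_trans.
  by rewrite S_nd// ltW.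
apply: bigcupT_measurable_rat => r; case: ifPn => // r0; apply: measurableI.
  have := measurable_preimage_set mt (measurable_itv `]-oo, (ratr r : R)[).
  by congr (measurable _); apply/seteqP; split => w /=; rewrite in_itv.
have := measurable_preimage_set (mS r0) (measurable_itv `]-oo, y[).
by congr (measurable _); apply/seteqP; split => w /=; rewrite in_itv.
Qed.

(** The left limit is the supremum of S over [0, t[.  The alternative y < 0 is
    there because all the values of S are nonnegative. *)
Lemma left_value_gtP w t y : 0 < t ->
  (y < left_value (S ^~ w) t) <->
  (exists r : rat, [/\ 0 <= ratr r :> R, ratr r < t & y < S (ratr r) w]) \/ y < 0.
Proof.
move=> t0.
pose A := [set S s w | s in `[0, t[%classic].
have A0 : A 0.
  by exists 0; rewrite ?S0//= in_itv/= lexx.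
have ubA : has_ubound A.
  exists (S t w) => _ [s /= + <-]; rewrite in_itv/= => /andP[s0 st].
  by rewrite S_nd// ltW.
have limE : left_value (S ^~ w) t = sup A.
  rewrite /left_value t0; apply/cvg_lim => //.
  apply/cvgrPdist_lt => e e0.
  have hs : has_sup A by split => //; exists 0.
  have [_ [s /= sI <-] sS] := sup_adherent e0 hs.
  move: sI; rewrite in_itv/= => /andP[s0 st].
  near=> u.
  have su : s < u by near: u; exact: nbhs_left_gt.
  have ut : u < t by near: u; exact: nbhs_left_lt.
  have h1 : S u w <= sup A.
    by apply: sup_ubound => //; exists u => //=; rewrite in_itv/= ut (le_trans s0 (ltW su)).
  have h2 : S s w <= S u w by rewrite S_nd// ltW.
  by rewrite ger0_norm; lra.
rewrite limE; split => [ys|].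
  have hs : has_sup A by split => //; exists 0.
  have e0 : 0 < sup A - y by rewrite subr_gt0.
  have [_ [s /= + <-]] := sup_adherent e0 hs.
  rewrite opprB addrCA subrr addr0 in_itv/= => /andP[s0 st] yS.
  have [r] := rat_in_itvoo st; rewrite in_itv/= => /andP[sr rt].
  left; exists r; split => //; first by rewrite (le_trans s0 (ltW sr)).
  by apply: lt_le_trans yS _; rewrite S_nd// ltW.
move=> [[r [r0 rt yS]]|y0].
  apply: lt_le_trans yS _; apply: sup_ubound => //.
  by exists (ratr r) => //=; rewrite in_itv/= r0.
by apply: lt_le_trans y0 _; apply: sup_ubound.
Unshelve. all: end_near. Qed.

Lemma measurable_left_value (tau : T -> R) : measurable_fun [set: T] tau ->
  (forall w, 0 <= tau w) ->
  measurable_fun [set: T] (fun w => left_value (S ^~ w) (tau w)).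
Proof.
move=> mt t0; apply: measurable_fun_gt => y.
have lv0 w : tau w = 0 -> left_value (S ^~ w) (tau w) = 0.
  by move=> ->; rewrite /left_value ltxx.
have [y0|y0] := ltP y 0.
  rewrite (_ : [set w | _] = setT)//; apply/seteqP; split => // w _ /=.
  have [tw|] := eqVneq (tau w) 0; first by rewrite lv0.
  by move=> tw; apply/left_value_gtP; [rewrite lt_neqAle eq_sym tw t0|right].
have -> : [set w | y < left_value (S ^~ w) (tau w)] = \bigcup_(r : rat)
   (if 0 <= ratr r :> R then [set w | ratr r < tau w] `&` [set w | y < S (ratr r) w] else set0).
  apply/seteqP; split => w /=.
    have [tw|tw] := eqVneq (tau w) 0; first by rewrite lv0// ltNge y0.
    have tw0 : 0 < tau w by rewrite lt_neqAle eq_sym tw t0.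
    move=> /(left_value_gtP w y tw0)[[r [r0 rt yS]]|]; last by rewrite ltNge y0.
    by exists r => //; rewrite r0.
  move=> [r _]; case: ifPn => // r0 [/= rt yS].
  by apply/left_value_gtP; [exact: le_lt_trans rt|left; exists r].
apply: bigcupT_measurable_rat => r; case: ifPn => // r0; apply: measurableI.
  have := measurable_preimage_set mt (measurable_itv `](ratr r : R), +oo[).
  by congr (measurable _); apply/seteqP; split => w /=; rewrite in_itv/= andbT.
have := measurable_preimage_set (mS r0) (measurable_itv `]y, +oo[).
by congr (measurable _); apply/seteqP; split => w /=; rewrite in_itv/= andbT.
Qed.

Lemma measurable_occupied_boxes (tau E : nat -> T -> R) n i :
  (forall k, measurable_fun [set: T] (tau k)) -> (forall k w, 0 <= tau k w) ->
  (forall k, measurable_fun [set: T] (E k)) ->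
  measurable_fun [set: T] (occupied_boxes S tau E n i).
Proof.
move=> mtau tau0 mE; apply: measurable_nneseries => [k w|k]; first by rewrite lee_fin.
apply/measurable_EFinP; apply: measurable_pred_set.
have mbox j : measurable [set w | E j w \in box S tau k w].
  have -> : [set w | E j w \in box S tau k w] =
     [set w | 0 < E j w - left_value (S ^~ w) (tau k w)] `&`
     [set w | 0 < S (tau k w) w - E j w].
    apply/seteqP; split => w /=; rewrite in_itv/= !subr_gt0.
      by move=> /andP[].
    by move=> [-> ->].
  have gt0 (f : T -> R) : measurable_fun [set: T] f -> measurable [set w | 0 < f w].
    move=> mf; have := measurable_preimage_set mf (measurable_itv `]0, +oo[).
    by congr (measurable _); apply/seteqP; split => w /=; rewrite in_itv/= andbT.
  apply: measurableI; apply: gt0; apply: measurable_funB => //.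
    exact: measurable_left_value.
  exact: measurable_S_at.
have mZ : measurable_fun [set: T] (fun w => (\sum_(j < n) (E j w \in box S tau k w))%N%:R : R).
  rewrite (_ : (fun w => _) = fun w => \sum_(j < n) (E j w \in box S tau k w)%:R); last first.
    by apply/funext => w; rewrite natr_sum.
  by apply: measurable_sum => j; exact: measurable_pred_set.
have := measurable_preimage_set mZ (measurable_itv `[(i%:R : R), +oo[).
congr (measurable _); apply/seteqP.
by split => w /=; rewrite in_itv/= andbT ler_nat box_countE.
Qed.

(** Fubini-Tonelli applies once S is jointly measurable, which follows from right
    continuity and monotonicity: S (t) < y exactly when S (r) < y for some
    rational r > t. *)
Lemma measurable_exp_functional al : measurable_fun [set: T] (exp_functional al S).
Proof.
pose g (p : T * R) := S (Num.max p.2 0) p.1.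
have mg : measurable_fun [set: T * R] g.
  apply: measurable_fun_lt => y.
  have -> : [set p | g p < y] = \bigcup_(r : rat)
     (if 0 <= ratr r :> R then [set w | S (ratr r) w < y] `*` [set t | Num.max t 0 < ratr r :> R] else set0).
    apply/seteqP; split => -[w t] /=; rewrite /g/=.
      have t0 : 0 <= Num.max t 0 by rewrite le_max lexx orbT.
      move=> /(right_rational_time S_rc t0)[r [r0 tr Sr]]; exists r => //.
      by rewrite r0; split.
    move=> [r _]; case: ifPn => // r0 [/= Sr tr]; apply: le_lt_trans Sr.
    by rewrite S_nd// ?le_max ?lexx ?orbT// ltW.
  apply: bigcupT_measurable_rat => r; case: ifPn => // r0; apply: measurableX.
    have := measurable_preimage_set (mS r0) (measurable_itv `]-oo, y[).
    by congr (measurable _); apply/seteqP; split => w /=; rewrite in_itv.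
  have mm : measurable_fun [set: R] (fun t : R => Num.max t 0) by exact: measurable_maxr.
  have := measurable_preimage_set mm (measurable_itv `]-oo, (ratr r : R)[).
  by congr (measurable _); apply/seteqP; split => w /=; rewrite in_itv.
pose G (p : T * R) : \bar R := (expR (- al * g p) * \1_(`[0, +oo[%classic : set R) p.2)%:E.
have mG : measurable_fun [set: T * R] G.
  apply/measurable_EFinP; apply: measurable_funM.
    by apply: measurableT_comp => //; exact: measurable_funM.
  apply: (measurableT_comp (f := \1_(`[0, +oo[%classic : set R) : R -> R) (g := snd)).
    exact: measurable_indic.
  exact: measurable_snd.
have G0 p : (0 <= G p)%E by rewrite lee_fin mulr_ge0// expR_ge0.
have := measurable_fun_fubini_tonelli_F (m2 := @lebesgue_measure R) G mG G0.
rewrite (_ : fubini_F _ _ = exp_functional al S)//.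
apply/funext => w; rewrite /fubini_F /exp_functional [RHS]integral_mkcond.
apply: eq_integral => t _; rewrite /G /g patchE indicE.
case: ifPn => [|_]; last by rewrite mulr0.
by rewrite inE/= in_itv/= andbT => t0; rewrite mulr1 (max_idPl t0).
Qed.

End path_functional_measurability.

(** * Occupied boxes against large gaps *)

Section occupancy_bounds.
Context {R : realType} {T : Type}.
Variables (S : R -> T -> R) (tau jmp E : nat -> T -> R) (w : T).
Hypothesis pj : pure_jump (S ^~ w) (tau ^~ w) (jmp ^~ w).
Local Notation load := (box_load (S ^~ w) (tau ^~ w) (jmp ^~ w) (E ^~ w)).
Local Notation gp := (gap (S ^~ w) (tau ^~ w) (jmp ^~ w)).

Lemma box_count_load n k : box_count S tau E n k w = load n k.
Proof.
rewrite box_countE /box_load big_mkord; apply: eq_bigr => j _.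
by rewrite in_itv/= (left_value_jump pj).
Qed.

Variables (x : R) (n N q Nc : nat) (p : nat -> R).
Hypotheses (x0 : 0 < x) (NcP : 1 <= Nc%:R * x) (nq : n%:R * x * N%:R = q%:R).
Hypotheses (N2 : (2 <= N)%N) (q0 : (0 < q)%N).
Hypotheses (px : forall c, p c <= x) (pfull : forall c, c.+1%:R * x <= 1 -> p c = x).

Let EFin_count (A : pred nat) (M : R) : (forall r, (\sum_(0 <= k < r) A k)%N%:R <= M) ->
  (\sum_(0 <= k <oo) (A k)%:R%:E <= M%:E)%E.
Proof.
move=> AM; apply: nneseries_le_bound => // r.
by rewrite sumEFin lee_fin -natr_sum.
Qed.

Lemma large_gaps_le_occupied :
  (large_gaps (S ^~ w) tau jmp w (N.+3%:R * x)%R <=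
   occupied_boxes S tau E n q w + (bad_anchors (S ^~ w) (E ^~ w) x n N Nc p)%:R%:E)%E.
Proof.
pose A k := (N.+3%:R * x <= gp k)%R && (load n k < q)%N.
apply: (@le_trans _ _ (occupied_boxes S tau E n q w + \sum_(0 <= k <oo) (A k)%:R%:E)%E).
  rewrite /large_gaps /occupied_boxes -nneseriesD//.
  apply: lee_nneseries => // k _; rewrite -EFinD lee_fin -natrD ler_nat /A box_count_load.
  by case: (N.+3%:R * x <= gp k); case: (leqP q (load n k)).
rewrite leeD2l//; apply: EFin_count => r; rewrite ler_nat.
exact: (underfull_count _ pj x0 NcP nq N2 q0 pfull).
Qed.

(** An occupied box has a large gap, or a gap between x and (N - 2) * x and too
    many balls, or a gap below x and at least q balls. *)
Lemma occupied_le_large_gaps :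
  (occupied_boxes S tau E n q w <= large_gaps (S ^~ w) tau jmp w ((N - 2)%:R * x)%R +
   ((bad_anchors (S ^~ w) (E ^~ w) x n N Nc p)%:R +
    (small_box_balls (S ^~ w) (E ^~ w) x n Nc)%:R / q%:R)%:E)%E.
Proof.
pose A k := [&& (x <= gp k)%R, (gp k <= (N - 2)%:R * x)%R & (q <= load n k)%N].
pose A' k := (gp k < x)%R && (q <= load n k)%N.
apply: (@le_trans _ _ (large_gaps (S ^~ w) tau jmp w ((N - 2)%:R * x)%R +
   (\sum_(0 <= k <oo) (A k)%:R%:E + \sum_(0 <= k <oo) (A' k)%:R%:E))%E).
  rewrite /large_gaps /occupied_boxes -!nneseriesD//; last by move=> k _ _; rewrite -EFinD lee_fin.
  apply: lee_nneseries => // k _; rewrite -!EFinD lee_fin -!natrD ler_nat /A /A' box_count_load.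
  case: (leqP q (load n k)) => // _; have [xg|gx] := leP x (gp k); have [Ng|/ltW gN] := leP ((N - 2)%:R * x) (gp k).
  - by [].
  - by rewrite gN.
  - by [].
  - by rewrite addnC.
apply: leeD => //; rewrite EFinD; apply: leeD; apply: EFin_count => r; rewrite ?ler_nat.
  exact: (overfull_count _ pj x0 NcP nq N2 q0 px).
rewrite ler_pdivlMr ?ltr0n// mulrC -natrM ler_nat.
exact: (small_box_count _ pj n q x0 NcP).
Qed.

End occupancy_bounds.

Section convergence_tools.
Context {R : realType}.

Lemma cvge0_near (u : nat -> \bar R) : (forall n, (0 <= u n)%E) ->
  (forall e, 0 < e -> \forall n \near \oo, (u n <= e%:E)%E) -> u n @[n --> \oo] --> 0%E.
Proof.
move=> u0 ue.
have ufin : \forall n \near \oo, u n \is a fin_num.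
  near=> n; rewrite ge0_fin_numE//; apply: (@le_lt_trans _ _ 1%:E); last exact: ltry.
  by near: n; exact: ue.
apply/fine_cvgP; split => //; apply/cvgrPdist_le => e e0; near=> n.
rewrite sub0r normrN ger0_norm ?fine_ge0//= -lee_fin fineK; last by near: n.
by near: n; exact: ue.
Unshelve. all: end_near. Qed.

Lemma negligible_cover_le {d : measure_display} {T : measurableType d}
    (P : probability T R) (A N B : set T) (c : R) :
  measurable A -> measurable B -> P.-negligible N -> A `<=` N `|` B ->
  (P B <= c%:E)%E -> (P A <= c%:E)%E.
Proof.
move=> mA mB [N' [mN' PN' NN']] ANB PB.
apply: (@le_trans _ _ (P (N' `|` B))).
  apply: le_measure; rewrite ?inE//; first exact: measurableU.
  by move=> w /ANB [/NN'|]; [left|right].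
apply: le_trans (measureU2 _ mN' mB) _.
by rewrite [X in (X + _)%E](_ : _ = 0%E)// add0e.
Qed.

End convergence_tools.

(** * The estimate of the number of occupied boxes *)

Section assembly.
Context {R : realType} {d : measure_display} {T : measurableType d}.

Lemma near_at_right0_scale (Q : R -> Prop) z : (\forall x \near 0^'+, Q x) ->
  \forall y \near 0^'+, Q (expR z * y).
Proof.
move=> /near_at_right0[x0 x00 H]; apply/near_at_right0.
exists (x0 / expR z); first by rewrite divr_gt0 ?expR_gt0.
move=> y y0; rewrite ler_pdivlMr ?expR_gt0// mulrC => yx0.
by apply: H => //; rewrite mulr_gt0 ?expR_gt0.
Qed.

(** The numerical bookkeeping: ap and am are the tails at the two thresholds,
    A is the tail at q / n, and rho compares A with the normalisation. *)
Lemma normalised_error (I K e1 A ap am o rho : R) :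
  0 <= I -> I <= K -> 0 < e1 -> e1 <= 1 / 2 -> 0 < A ->
  (1 - e1) * A <= ap -> ap <= A -> am <= (1 + e1) * A ->
  ap * (I - e1) <= o + e1 * A -> o <= am * (I + e1) + 2 * (e1 * A) ->
  `|rho - 1| <= e1 ->
  `|o / A * rho - I| < 4 * (K + 3) * e1.
Proof.
move=> I0 IK e10 e12 A0 lap apA amA lo up; rewrite ler_norml => /andP[r1 r2].
have Ie0 : 0 <= e1 * (K - I) by rewrite mulr_ge0//; lra.
have ee : e1 * e1 <= e1 * (1 / 2) by rewrite ler_pM2l.
have o1 : o / A <= I + (K + 4) * e1.
  rewrite ler_pdivrMr//; apply: le_trans up _.
  have : am * (I + e1) <= (1 + e1) * A * (I + e1) by rewrite ler_wpM2r//; lra.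
  have : A * (e1 * e1) <= A * (e1 * (1 / 2)) by rewrite ler_pM2l.
  have : 0 <= A * (e1 * (K - I)) by rewrite mulr_ge0// ltW.
  have : 0 <= A * e1 by rewrite mulr_ge0// ltW.
  by lra.
have o2 : I - (K + 2) * e1 <= o / A.
  rewrite ler_pdivlMr//.
  have : (1 - e1) * A * I <= ap * I by rewrite ler_wpM2r.
  have : ap * e1 <= A * e1 by rewrite ler_wpM2r// ltW.
  have : 0 <= A * (e1 * (K - I)) by rewrite mulr_ge0// ltW.
  by lra.
set u := o / A in o1 o2 *.
have K0 : 0 <= K by exact: le_trans IK.
have e1K : 0 <= e1 * K by rewrite mulr_ge0// ltW.
have -> : u * rho - I = (u - I) * rho + I * (rho - 1) by ring.
have u1 : `|u - I| <= (K + 4) * e1 by rewrite ler_norml; apply/andP; split; lra.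
have rho32 : `|rho| <= 3 / 2 by rewrite ler_norml; apply/andP; split; lra.
have h1 : `|(u - I) * rho| <= (K + 4) * e1 * (3 / 2) by rewrite normrM ler_pM.
have h2 : `|I * (rho - 1)| <= K * e1.
  by rewrite normrM (ger0_norm I0); apply: ler_pM => //; rewrite ler_norml r1 r2.
apply: le_lt_trans (ler_normD _ _) _; lra.
Qed.

Variables (P : probability T R) (nu : {sigma_finite_measure set R -> \bar R}).
Variables (S : R -> {RV P >-> R}) (tau jmp E : nat -> {RV P >-> R}).
Hypothesis nu_levy : levy_measure nu.
Hypothesis ppp : poisson_point_process nu tau jmp.
Hypothesis S_nd : forall w s t, 0 <= s -> s <= t -> S s w <= S t w.
Hypothesis S_rc : forall w t, 0 <= t -> S s w @[s --> t^'+] --> S t w.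
Hypothesis hEdist : forall k (B : set R), measurable B ->
  distribution P (E k) B = exponential_prob 1 B.
Hypothesis hEind : mutually_independent P E.
Hypothesis hES : independent_systems P (sigma_generated setT E)
  (sigma_generated [set t : R | 0 <= t] S).
Variable al : R.
Hypotheses (al01 : 0 < al < 1) (rv : regvar (tail nu) al).
Local Notation a := (tail nu).

(** With y = q n / n the cells have length x = y / N.  The boxes with at least q n
    balls lie between the gaps above (N + 3) * x and those above (N - 2) * x, up
    to errors; both thresholds are y times a factor close to 1, so the law of
    large numbers gives the same limit for both. *)
Lemma occupied_boxes_estimate (q : nat -> nat) (b : nat -> R) (e eta : R) :
  q n @[n --> \oo] --> \oo ->
  (forall Q : R -> Prop, (\forall y \near 0^'+, Q y) ->
     \forall n \near \oo, Q ((q n)%:R / n%:R)) ->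
  a ((q n)%:R / n%:R) / b n @[n --> \oo] --> (1 : R) ->
  0 < e -> 0 < eta ->
  \forall n \near \oo, exists B, [/\ measurable B, (P B <= eta%:E)%E &
    forall w, pure_jump (S ^~ w) (tau ^~ w) (jmp ^~ w) -> ~ B w ->
      exists o I : R, [/\ occupied_boxes S tau E n (q n) w = o%:E,
        exp_functional al S w = I%:E & `|o / b n - I| < e]].
Proof.
move=> qoo yn0 ab e0 eta0.
have [al0 al1] : 0 < al /\ al < 1 by apply/andP.
have eta6 : 0 < eta / 6 by rewrite divr_gt0.
have [y0 y00 [y01 ay0]] : exists2 y0, 0 < y0 & y0 <= 1 /\ 0 < a y0.
  have /near_at_right0[x0 x00 H] := rv_gt0 rv.
  exists (Num.min 1 x0); first by rewrite lt_min ltr01.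
  split; first by rewrite ge_min lexx.
  by apply: H; [rewrite lt_min ltr01|rewrite ge_min lexx orbT].
pose del := y0 * al / 4.
have ya0 : 0 < y0 * al by exact: mulr_gt0.
have del0 : 0 < del by rewrite divr_gt0.
have del1 : del <= 1.
  have : y0 * al <= 1 by rewrite mulr_ile1// ltW.
  by rewrite /del; lra.
have del01 : 0 < del <= 1 by rewrite del0.
have [kap kap0 [B0 [mB0 PB0 HB0]]] := block_event nu_levy ppp y00 ay0 del01 eta6.
pose K := exp_functional_bound kap del.
have K0 : 0 < K.
  by rewrite /K /exp_functional_bound divr_gt0// subr_gt0 -expR0 ltr_expR oppr_lt0.
have [M M0 HM] := range_cover_tight S nu_levy ppp al01 rv y00 kap0 del0 erefl eta6.
pose e1 := Num.min (1 / 2) (e / (4 * (K + 3))).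
have K3 : 0 < 4 * (K + 3) by rewrite mulr_gt0//; lra.
have e10 : 0 < e1 by rewrite lt_min divr_gt0//= divr_gt0.
have e12 : e1 <= 1 / 2 by rewrite ge_min lexx.
have e1e : 4 * (K + 3) * e1 <= e.
  by rewrite mulrC -ler_pdivlMr// ge_min lexx orbT.
(* N is chosen so that the thresholds (N + 3) * x and (N - 2) * x are relatively
   close to y and that the boxes shorter than a cell are negligible; the latter
   is possible because N ^ al / N -> 0 *)
have [N [N3 Ne Nal]] : exists N : nat, [/\ (3 <= N)%N, 4 / e1 <= N%:R - 2 &
    4 * M * expR (al * ln N%:R) / (N%:R * e1) <= eta / 6].
  pose C := 4 * M / e1 / (eta / 6).
  have C0 : 0 < C by rewrite !divr_gt0// mulr_gt0.
  pose N1 := (Num.trunc (4 / e1)).+3.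
  pose N2 := (Num.trunc (expR (ln C / (1 - al)))).+1.
  have N1e : 4 / e1 <= N1%:R - 2.
    by have := truncnS_gt (4 / e1); rewrite /N1 -!natr1; lra.
  have N2C : expR (ln C / (1 - al)) <= N2%:R by rewrite ltW// truncnS_gt.
  exists (N1 + N2)%N; split; first by rewrite /N1 !addSn.
    by rewrite natrD; have : 0 <= N2%:R :> R by []; lra.
  set N := (N1 + N2)%N.
  have N0 : 0 < N%:R :> R by rewrite ltr0n.
  have NC : ln C / (1 - al) <= ln N%:R.
    rewrite -ler_expR (lnK (x := N%:R))//; apply: le_trans N2C _.
    by rewrite ler_nat leq_addl.
  have NR : N%:R = expR (ln N%:R) :> R by rewrite lnK.
  rewrite ler_pdivrMr ?mulr_gt0//.
  have -> : 4 * M = C * (eta / 6) * e1.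
    by rewrite /C; field; rewrite !gt_eqF.
  have -> : eta / 6 * (N%:R * e1) = N%:R * (eta / 6) * e1 by ring.
  rewrite mulrAC ler_pM2r// mulrAC ler_pM2r// {2}NR.
  rewrite -[X in X * _](lnK (x := C))// -expRD ler_expR.
  rewrite ler_pdivrMr in NC; last by lra.
  by lra.
have N0 : 0 < N%:R :> R by rewrite ltr0n (leq_trans _ N3).
have N20 : 0 < N%:R - 2 :> R by apply: lt_le_trans Ne; rewrite divr_gt0.
have Ne' : 4 <= e1 * (N%:R - 2) by rewrite ler_pdivrMr// mulrC in Ne.
pose zp : R := ln (N.+3%:R / N%:R); pose zm : R := ln ((N - 2)%:R / N%:R).
pose zx : R := - ln N%:R.
have N3R : N.+3%:R = N%:R + 3 :> R by rewrite -!natr1; ring.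
have N2R : (N - 2)%:R = N%:R - 2 :> R by rewrite natrB// (leq_trans _ N3).
have ezp : expR zp = (N%:R + 3) / N%:R.
  by rewrite /zp lnK ?N3R// posrE divr_gt0//; lra.
have ezm : expR zm = (N%:R - 2) / N%:R.
  by rewrite /zm lnK ?N2R// posrE divr_gt0.
have ezx : expR zx = N%:R^-1 by rewrite /zx expRN lnK.
have zp0 : 0 <= zp by rewrite -ler_expR expR0 ezp ler_pdivlMr//; lra.
have zm0 : zm <= 0 by rewrite -ler_expR expR0 ezm ler_pdivrMr//; lra.
have Hp : \forall y \near 0^'+, (1 - e1) * a y <= a (expR zp * y).
  near=> y.
  suff /andP[] : (1 - e1) * a y <= a (expR zp * y) <= (expR (- al * zp) + 1) * a y by [].
  near: y; apply: (regvar_bounds rv); rewrite ltrDl ltr01 andbT.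
  apply: (@lt_le_trans _ _ (expR (- zp))); last first.
    rewrite ler_expR; have : al * zp <= zp by rewrite ler_piMl// ltW.
    by lra.
  rewrite expRN ezp invfM invrK ltr_pdivlMl; last by lra.
  by lra.
have Hm : \forall y \near 0^'+, a (expR zm * y) <= (1 + e1) * a y.
  near=> y.
  suff /andP[] : (expR (- al * zm) - 1) * a y <= a (expR zm * y) <= (1 + e1) * a y by [].
  near: y; apply: (regvar_bounds rv); apply/andP; split; first by lra.
  apply: (@le_lt_trans _ _ (expR (- zm))).
    rewrite ler_expR; have : al * - zm <= - zm by rewrite ler_piMl ?oppr_ge0// ltW.
    by lra.
  rewrite expRN ezm invfM invrK ltr_pdivrMl//; lra.
have Hx : \forall y \near 0^'+, a (expR zx * y) <= 2 * expR (al * ln N%:R) * a y.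
  have E0 := expR_gt0 (al * ln N%:R).
  near=> y.
  suff /andP[] : 0 * a y <= a (expR zx * y) <= 2 * expR (al * ln N%:R) * a y by [].
  near: y; apply: (regvar_bounds rv); rewrite expR_gt0/= /zx mulNr mulrN opprK; lra.
have lln z := near_at_right0_scale z
   (large_gaps_lln S nu_levy ppp al01 rv y00 kap0 del0 erefl e10 eta6).
have HC := near_at_right0_scale zx HM.
(* q n > D makes the expected number of bad anchors small against a y *)
pose D := N.+3%:R * N%:R ^+ 3 * M * (2 * expR (al * ln N%:R)) / e1 / (eta / 6).
have qbig : \forall n \near \oo, ((Num.trunc D).+1 <= q n)%N.
  exact: (qoo _ (nbhs_infty_ge (Num.trunc D).+1)).
have llny z : \forall n \near \oo, exists B, [/\ measurable B, (P B <= (eta / 6)%:E)%E &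
    forall w, ~ B w -> good_path tau jmp S y0 kap del w -> forall I, exp_functional al S w = I%:E ->
      ((a (expR z * ((q n)%:R / n%:R)) * (I - e1))%:E <=
         large_gaps (S ^~ w) tau jmp w (expR z * ((q n)%:R / n%:R))%R)%E /\
      (large_gaps (S ^~ w) tau jmp w (expR z * ((q n)%:R / n%:R))%R <=
         (a (expR z * ((q n)%:R / n%:R)) * (I + e1))%:E)%E].
  exact: (yn0 _ (lln z)).
have rho : \forall n \near \oo, `|a ((q n)%:R / n%:R) / b n - 1| <= e1.
  by move/cvgrPdistC_le : ab => /(_ _ e10).
near=> n.
pose y : R := (q n)%:R / n%:R.
have n0 : (0 : R) < n%:R by rewrite ltr0n; near: n; exact: nbhs_infty_gt.
have qD : D < (q n)%:R.
  apply: lt_le_trans (truncnS_gt D) _; rewrite ler_nat.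
  by near: n.
have E0 := expR_gt0 (al * ln N%:R).
have D0 : 0 <= D.
  by rewrite /D !divr_ge0 ?mulr_ge0 ?exprn_ge0// ?ltW// mulr_gt0.
have qR0 : (0 : R) < (q n)%:R by exact: le_lt_trans qD.
have q0 : (0 < q n)%N by rewrite ltr0n in qR0.
have y_gt0 : 0 < y by exact: divr_gt0.
have hp : (1 - e1) * a y <= a (expR zp * y).
  by rewrite /y; near: n; exact: (yn0 (fun y => (1 - e1) * a y <= a (expR zp * y)) Hp).
have hm : a (expR zm * y) <= (1 + e1) * a y.
  by rewrite /y; near: n; exact: (yn0 (fun y => a (expR zm * y) <= (1 + e1) * a y) Hm).
have hx : a (expR zx * y) <= 2 * expR (al * ln N%:R) * a y.
  by rewrite /y; near: n; exact: (yn0 (fun y => a (expR zx * y) <= 2 * expR (al * ln N%:R) * a y) Hx).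
have ay : 0 < a y by rewrite /y; near: n; exact: (yn0 (fun y => 0 < a y) (rv_gt0 rv)).
have [BC [mBC PBC HBC]] : exists B, [/\ measurable B, (P B <= (eta / 6)%:E)%E &
    forall w, ~ B w -> good_path tau jmp S y0 kap del w -> forall n',
      ((\sum_(0 <= c < n'.*2) hit (S ^~ w) (expR zx * y) c)%:R <= M * a (expR zx * y) :> R)].
  by rewrite /y; near: n; exact: (yn0 _ HC).
have [Bp [mBp PBp HBp]] : exists B, [/\ measurable B, (P B <= (eta / 6)%:E)%E &
    forall w, ~ B w -> good_path tau jmp S y0 kap del w -> forall I, exp_functional al S w = I%:E ->
      ((a (expR zp * y) * (I - e1))%:E <= large_gaps (S ^~ w) tau jmp w (expR zp * y)%R)%E /\
      (large_gaps (S ^~ w) tau jmp w (expR zp * y)%R <= (a (expR zp * y) * (I + e1))%:E)%E].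
  by rewrite /y; near: n; exact: (llny zp).
have [Bm [mBm PBm HBm]] : exists B, [/\ measurable B, (P B <= (eta / 6)%:E)%E &
    forall w, ~ B w -> good_path tau jmp S y0 kap del w -> forall I, exp_functional al S w = I%:E ->
      ((a (expR zm * y) * (I - e1))%:E <= large_gaps (S ^~ w) tau jmp w (expR zm * y)%R)%E /\
      (large_gaps (S ^~ w) tau jmp w (expR zm * y)%R <= (a (expR zm * y) * (I + e1))%:E)%E].
  by rewrite /y; near: n; exact: (llny zm).
have rho1 : `|a y / b n - 1| <= e1.
  by rewrite /y; near: n; exact: rho.
pose x := y / N%:R.
have x0 : 0 < x by exact: divr_gt0.
have xE : expR zx * y = x by rewrite ezx mulrC.
have xpE : expR zp * y = N.+3%:R * x.
  by rewrite ezp N3R /x; field; rewrite gt_eqF.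
have xmE : expR zm * y = (N - 2)%:R * x.
  by rewrite ezm N2R /x; field; rewrite gt_eqF.
have nq : n%:R * x * N%:R = (q n)%:R.
  by rewrite /x /y; field; rewrite !gt_eqF.
rewrite xE in hx HBC; rewrite xpE in hp HBp; rewrite xmE in hm HBm.
pose Nc := (Num.trunc (1 / x)).+1.*2.
have NcP : 1 <= Nc%:R * x.
  have := truncnS_gt (1 / x); rewrite ltr_pdivrMr// => /ltW/le_trans; apply.
  by rewrite ler_pM2r// ler_nat /Nc -addnn leq_addl.
have m0 : 0 <= M * a x by rewrite mulr_ge0 ?(rv_ge0 rv)// ltW.
have t10 : 0 < e1 * a y by exact: mulr_gt0.
have t20 : 0 < e1 * (q n)%:R * a y by rewrite !mulr_gt0.
have [BB [mBB PBB HBB]] := balls_concentration S_nd S_rc hEdist hEind hES Nc x0 nq q0 m0 t10 t20.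
have {}PBB : (P BB <= (eta / 6 + eta / 6)%:E)%E.
  apply: le_trans PBB _; rewrite lee_fin lerD//.
    rewrite ler_pdivrMr//.
    have h1 : N.+3%:R * (N%:R ^+ 3 / (q n)%:R) * (M * a x) <=
        N.+3%:R * (N%:R ^+ 3 / (q n)%:R) * (M * (2 * expR (al * ln N%:R) * a y)).
      rewrite ler_wpM2l ?ler_pM2l// mulr_ge0// divr_ge0// exprn_ge0//; exact: ltW.
    apply: le_trans h1 _.
    have -> : N.+3%:R * (N%:R ^+ 3 / (q n)%:R) * (M * (2 * expR (al * ln N%:R) * a y)) =
       D / (q n)%:R * (eta / 6 * (e1 * a y)).
      by rewrite /D; field; rewrite !gt_eqF.
    apply: ler_piMl; first by rewrite mulr_ge0// ltW.
    by rewrite ler_pdivrMr// mul1r ltW.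
  apply: le_trans Nal; rewrite ler_pdivrMr//.
  have -> : n.*2%:R = 2 * n%:R :> R by rewrite -mul2n natrM.
  have -> : 2 * n%:R * x * (M * a x) = 2 * ((q n)%:R / N%:R) * M * a x.
    by rewrite -nq; field; rewrite gt_eqF.
  apply: (@le_trans _ _ (2 * ((q n)%:R / N%:R) * M * (2 * expR (al * ln N%:R) * a y))).
    by rewrite ler_wpM2l// !mulr_ge0 ?invr_ge0// ltW.
  rewrite le_eqVlt; apply/orP; left; apply/eqP; field.
  by rewrite !gt_eqF.
exists (B0 `|` (BC `|` (Bp `|` (Bm `|` BB)))); split.
- by repeat apply: measurableU.
- apply: le_trans (prob_setU_le mB0 _ PB0 (prob_setU_le mBC _ PBC
    (prob_setU_le mBp _ PBp (prob_setU_le mBm mBB PBm PBB)))) _.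
  + by repeat apply: measurableU.
  + by repeat apply: measurableU.
  + by repeat apply: measurableU.
  + by rewrite lee_fin le_eqVlt; apply/orP; left; apply/eqP; field.
move=> w pj /not_orP[nB0 /not_orP[nBC /not_orP[nBp /not_orP[nBm nBB]]]].
have good : good_path tau jmp S y0 kap del w by split => // m; exact: HB0.
have [I [IE I0 IK _ _]] := exp_functional_riemann (S := fun t => S t) (tau := fun k => tau k)
   (jmp := fun k => jmp k) (J := 1) (m0 := 1) (h := btime kap del 1) al0 kap0 del0 erefl pj good.2
   (lt_le_trans (mulr_gt0 ltr01 kap0) (btime_lower kap0 del0 1)) (mul1r _).
have few := HBC w nBC good (Num.trunc (1 / x)).+1.
have [bad1 small1] := HBB w nBB few.
have [lowp _] := HBp w nBp good I IE.
have [_ upm] := HBm w nBm good I IE.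
have N2 : (2 <= N)%N by exact: leq_trans N3.
have low := large_gaps_le_occupied (S := fun t => S t) (tau := fun k => tau k)
  (jmp := fun k => jmp k) (fun k => E k) pj x0 NcP nq N2 q0
  (fun c cx => cell_prob_full x0 cx).
have up := occupied_le_large_gaps (S := fun t => S t) (tau := fun k => tau k)
  (jmp := fun k => jmp k) (fun k => E k) pj x0 NcP nq N2 q0
  (fun c => cell_prob_le c x0).
have occ0 : (0 <= occupied_boxes S tau E n (q n) w)%E by apply: nneseries_ge0.
set bd := bad_anchors _ _ _ _ _ _ _ in bad1 low up.
set sb := small_box_balls _ _ _ _ _ in small1 up.
have {}up : (occupied_boxes S tau E n (q n) w <=
    (a ((N - 2)%:R * x) * (I + e1) + (bd%:R + sb%:R / (q n)%:R))%:E)%E.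
  by apply: le_trans up _; rewrite [X in (_ <= X)%E]EFinD; exact: leeD2r.
have {}low := le_trans lowp low.
case: (occupied_boxes S tau E n (q n) w) occ0 low up => [v| |] //= _ low up.
exists v, I; split => //.
rewrite lee_fin in up; rewrite -EFinD lee_fin in low.
have sb1 : sb%:R / (q n)%:R <= e1 * a y.
  rewrite ler_pdivrMr//; apply: le_trans (ltW small1) _.
  by rewrite mulrAC.
have -> : v / b n = v / a y * (a y / b n) by rewrite mulrA divfK// gt_eqF.
apply: lt_le_trans e1e.
have apy : a (N.+3%:R * x) <= a y.
  by apply: (rv_ni rv) => //; rewrite -xpE ler_peMl ?(ltW y_gt0)// -expR0 ler_expR.
apply: (normalised_error I0 IK e10 e12 ay hp apy hm) => //.
  by apply: le_trans low _; rewrite lerD2l ltW.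
by apply: le_trans up _; rewrite lerD2l [2 * _]mulr_natl mulr2n lerD// ltW.
Unshelve. all: end_near. Qed.

End assembly.

(** * Convergence in probability *)

Lemma near_ball_share {R : realType} (q : R -> nat) (Q : R -> Prop) :
  q t @[t --> +oo] --> \oo -> (q t)%:R / t @[t --> +oo] --> (0 : R) ->
  (\forall y \near 0^'+, Q y) ->
  \forall n \near \oo, Q ((q n%:R)%:R / n%:R).
Proof.
move=> hq hqo /near_at_right0[x0 x00 H].
have H1 : \forall n \near \oo, `|(q (n%:R : R))%:R / n%:R| <= x0 :> R.
  have := cvg_comp _ _ cvgr_idn hqo.
  by move=> /cvgr0_norm_le/(_ _ x00).
have H2 : \forall n \near \oo, (0 < q (n%:R : R))%N.
  exact: (cvg_comp _ _ cvgr_idn hq _ (nbhs_infty_gt 0%N)).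
near=> n; apply: H.
  rewrite divr_gt0 ?ltr0n//; first by near: n.
  by near: n; exact: nbhs_infty_gt.
apply: le_trans (ler_norm _) _.
by near: n.
Unshelve. all: end_near. Qed.

Theorem theorem1p5 (R : realType) (d : measure_display) (T : measurableType d)
    (P : probability T R)
    (nu : {sigma_finite_measure set R -> \bar R})
    (S : R -> {RV P >-> R}) (tau jmp E : nat -> {RV P >-> R})
    (alpha : R) (l : R -> R) (q : R -> nat)
    (hS : drift_free_subordinator nu S tau jmp)
    (hEdist : forall k (B : set R), measurable B ->
       distribution P (E k) B = exponential_prob 1 B)
    (hEind : mutually_independent P E)
    (hES : independent_systems P (sigma_generated setT E)
       (sigma_generated [set t : R | 0 <= t] S))
    (halpha : 0 < alpha < 1)
    (hl : slowly_varying l)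
    (hnu : fine (nu `[y, +oo[%classic) / (y `^ (- alpha) * l (1 / y))
       @[y --> 0^'+] --> (1 : R))
    (hq : q t @[t --> +oo] --> \oo)
    (hqo : (q t)%:R / t @[t --> +oo] --> (0 : R)) :
  cvg_in_probability P
    (fun n w => (((q n%:R)%:R `^ alpha)%:E
                 * occupied_boxes S tau E n (q n%:R) w
                 * ((n%:R `^ alpha * l (n%:R / (q n%:R)%:R))^-1)%:E)%E)
    (exp_functional alpha S).
Proof.
case: hS => -[S0 S_nd S_rc _ _] nu_levy ppp jumps eps eps0.
have tau0 k w : 0 <= tau k w by case: ppp => /(_ k w)[].
have [N [mN PN HN]] := ae_pure_jump nu_levy ppp S0 jumps.
have rv := regvar_tail nu_levy hl hnu.
pose q' n := q (n%:R : R).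
have qoo : q' n @[n --> \oo] --> \oo := cvg_comp _ _ cvgr_idn hq.
have yn0 Q : (\forall y \near 0^'+, Q y) ->
    \forall n \near \oo, Q ((q' n)%:R / n%:R) := @near_ball_share R q Q hq hqo.
pose b n : R := n%:R `^ alpha * l (n%:R / (q' n)%:R) / (q' n)%:R `^ alpha.
have q'_gt0 : \forall n \near \oo, (0 < q' n)%N := qoo _ (nbhs_infty_gt 0%N).
have share0 : (q' n)%:R / n%:R @[n --> \oo] --> (0 : R)^'+ by move=> A /yn0.
have ab : tail nu ((q' n)%:R / n%:R) / b n @[n --> \oo] --> (1 : R).
  (* at y = q (n) / n the powers of q (n) and n recombine into b n *)
  apply: cvg_trans (cvg_comp _ _ share0 hnu); apply: near_eq_cvg; near=> n.
  have n0 : 0 < n%:R :> R by rewrite ltr0n; near: n; exact: nbhs_infty_gt.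
  have q0 : 0 < (q' n)%:R :> R by rewrite ltr0n; near: n.
  have -> : b n = ((q' n)%:R / n%:R) `^ (- alpha) * l (1 / ((q' n)%:R / n%:R)).
    have -> : 1 / ((q' n)%:R / n%:R) = n%:R / (q' n)%:R :> R by rewrite invf_div mul1r.
    have qE : (q' n)%:R `^ alpha = ((q' n)%:R / n%:R) `^ alpha * n%:R `^ alpha :> R.
      by rewrite -powRM ?divfK ?gt_eqF// ltW// divr_gt0.
    have na0 : 0 < n%:R `^ alpha :> R by exact: powR_gt0.
    have ya0 : 0 < ((q' n)%:R / n%:R) `^ alpha :> R by rewrite powR_gt0// divr_gt0.
    by rewrite /b powRN qE; field; rewrite !gt_eqF.
  by [].
apply: cvge0_near => [n|eta eta0]; first exact: measure_ge0.
have := occupied_boxes_estimate nu_levy ppp S_nd S_rc hEdist hEind hES halpha rv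
  qoo yn0 ab eps0 eta0.
apply: filterS => n [B [mB PB HB]].
have mS t : 0 <= t -> measurable_fun [set: T] (S t) by [].
have mo : measurable_fun [set: T] (occupied_boxes S tau E n (q' n)).
  exact: measurable_occupied_boxes.
have mI : measurable_fun [set: T] (exp_functional alpha S).
  exact: measurable_exp_functional.
apply: (negligible_cover_le (N := N) _ mB _ _ PB).
- apply: measurable_ge; apply: measurableT_comp => //; apply: emeasurable_funB => //.
  by apply: emeasurable_funM => //; apply: emeasurable_funM.
- by exists N; split.
- move=> w /= far; case: (pselect (N w)) => [|nN]; [by left|right].
  apply: contrapT => nB.
  have pj : pure_jump (S ^~ w) (tau ^~ w) (jmp ^~ w).
    by apply: contrapT => npj; apply: nN; apply: HN.
  have [v [I [vE IE vI]]] := HB w pj nB.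
  move: far; rewrite vE IE -!EFinM -EFinB/= lee_fin.
  apply/negP; rewrite -ltNge; apply: le_lt_trans vI.
  by rewrite /b invf_div mulrCA mulrA.
Unshelve. all: end_near. Qed.
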